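(* Let $d\ge1$, $\gamma\in(0,1)$, $\beta\in(0,\infty)$, let $\varphi$ be a profile function, and let $(G_t)_{t>0}$ be the age-based spatial preferential attachment network. For any function $g:\mathbb{N}_0\to[0,\infty)$ growing no faster than linearly, $$\frac1t\sum_{\mathbf{x}\in G_t}g\big(|\mathcal{Z}_{\mathbf{x}}(t,G_t)|\big)=\int g\,d\mu_t\longrightarrow\int g\,d\mu$$ in probability, as $t\to\infty$, where $\mu$ is the mixed Poisson distribution whose mixing distribution has density $$f(\lambda)=\beta^{1/\gamma}(\gamma\lambda+\beta)^{-(1+1/\gamma)},\qquad\lambda>0,$$ that is, $\mu(k)=\int_0^\infty e^{-\lambda}\frac{\lambda^k}{k!}f(\lambda)\,d\lambda$ for $k\in\mathbb{N}_0$.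
   Context: A profile function is a nonincreasing integrable function $\varphi:[0,\infty)\to[0,1]$ with $\int_{\mathbb{R}^d}\varphi(|x|^d)\,dx=1$ ($|\cdot|$ Euclidean norm). Let $\mathbb{T}^d_1=(-\tfrac12,\tfrac12]^d$ with torus metric $d_1(x,y)=\min\{|x-y+v|: v\in\{-1,0,1\}^d\}$. The age-based spatial preferential attachment network $(G_t)_{t>0}$: vertices $(x,u)$ (position $x\in\mathbb{T}_1^d$, birth time $u>0$) arrive according to a standard (unit rate) Poisson process in time and are placed independently and uniformly on $\mathbb{T}^d_1$. The vertices of $G_t$ are those born in $(0,t]$. A vertex $(x,u)$, at its birth time $u$, is connected to each already existing vertex $(y,s)$, $s<u$, independently with probability $\varphi\big(\frac{u\,d_1(x,y)^d}{\beta\,(u/s)^\gamma}\big)$. For a vertex $\mathbf{x}=(x,u)$ of $G_t$, $\mathcal{Z}_{\mathbf{x}}(t,G_t)=\{\mathbf{y}=(y,r)\in G_t:\ \mathbf{y}\leftrightarrow\mathbf{x},\ u<r\le t\}$ is the set of its younger neighbours ($\leftrightarrow$ means joined by an edge); its cardinality is the indegree of $\mathbf{x}$ in $G_t$. The empirical indegree distribution is $\mu_t(k)=\frac1t\sum_{\mathbf{x}\in G_t}\mathbf{1}\{|\mathcal{Z}_{\mathbf{x}}(t,G_t)|=k\}$, $k\in\mathbb{N}_0$ (normalised by $t$). *)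

(* Defs.v *)
From HB Require Import structures.
From mathcomp Require Import all_boot all_order all_algebra.
From mathcomp Require Import finmap.
From mathcomp Require Import all_classical all_reals all_analysis.

Set Implicit Arguments.
Unset Strict Implicit.
Unset Printing Implicit Defensive.
Import Order.TTheory GRing.Theory Num.Theory.
Import numFieldNormedType.Exports.

Local Open Scope classical_set_scope.
Local Open Scope ring_scope.

Definition Rspace (R : realType) (d : nat) := d.-tuple (measurableTypeR R).

(* d-dimensional Lebesgue measure, by iterating the binary product measure. *)
Section lebesgue_tuple.
Variable R : realType.

Definition tuple_join n (p : measurableTypeR R * Rspace R n) : Rspace R n.+1 :=
  [tuple of p.1 :: p.2].

Definition tuple_split n (x : Rspace R n.+1) : measurableTypeR R * Rspace R n :=
  (thead x, [tuple of behead x]).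

Lemma tuple_joinK n : cancel (@tuple_join n) (@tuple_split n).
Proof.
move=> [a t]; rewrite /tuple_split /tuple_join/=; congr pair.
by apply/val_inj.
Qed.

Lemma measurable_tuple_join n : measurable_fun setT (@tuple_join n).
Proof. by apply: measurable_cons. Qed.

Lemma measurable_tuple_split n : measurable_fun setT (@tuple_split n).
Proof.
apply/measurable_fun_pairP; split => /=.
  exact: (measurable_tnth ord0).
exact: measurable_behead.
Qed.

Section step.
Variables (n : nat) (m : {sigma_finite_measure set (Rspace R n) -> \bar R}).

Definition lebesgue_step : set (Rspace R n.+1) -> \bar R :=
  pushforward (@lebesgue_measure R \x m)%E (@tuple_join n).

Let mjoin A : measurable A -> measurable (@tuple_join n @^-1` A).
Proof. by rewrite -[X in _ -> measurable X]setTI; exact: measurable_tuple_join. Qed.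

Let lebesgue_step0 : lebesgue_step set0 = 0%E.
Proof. by rewrite /lebesgue_step /pushforward preimage_set0 measure0. Qed.

Let lebesgue_step_ge0 A : (0 <= lebesgue_step A)%E.
Proof. by rewrite /lebesgue_step /pushforward measure_ge0. Qed.

Let lebesgue_step_sigma_additive : semi_sigma_additive lebesgue_step.
Proof.
move=> F mF tF mUF; rewrite /lebesgue_step /pushforward preimage_bigcup.
apply: measure_semi_sigma_additive.
- by move=> i; exact: mjoin.
- apply/trivIsetP => i j _ _ ij; rewrite -preimage_setI.
  by move/trivIsetP : tF => /(_ _ _ _ _ ij) ->//; rewrite preimage_set0.
- by rewrite -preimage_bigcup; exact: mjoin.
Qed.

HB.instance Definition _ := isMeasure.Build _ _ _ lebesgue_step
  lebesgue_step0 lebesgue_step_ge0 lebesgue_step_sigma_additive.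

Lemma lebesgue_step_sigma_finite : sigma_finite setT lebesgue_step.
Proof.
have /sigma_finiteP[F [FT ndF mF]] := sigma_finiteT (@lebesgue_measure R).
have /sigma_finiteP[G [GT ndG mG]] := sigma_finiteT m.
exists (fun i => @tuple_split n @^-1` (F i `*` G i)).
  rewrite -preimage_bigcup; suff -> : \bigcup_i (F i `*` G i) = setT by [].
  apply/seteqP; split=> // -[a x] _.
  have : (\bigcup_i F i) a by rewrite -FT.
  have : (\bigcup_i G i) x by rewrite -GT.
  move=> [j _ Gjx] [i _ Fia]; exists (maxn i j) => //; split => /=.
    by move: a Fia; exact/subsetPset/ndF/leq_maxl.
  by move: x Gjx; exact/subsetPset/ndG/leq_maxr.
move=> i; have [mFi Fi] := mF i; have [mGi Gi] := mG i; split.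
  rewrite -[X in measurable X]setTI; apply: measurable_tuple_split => //.
  exact: measurableX.
rewrite /lebesgue_step /pushforward -comp_preimage.
rewrite (_ : _ \o _ = id); last by apply/funext => x; exact: tuple_joinK.
rewrite preimage_id.
by rewrite product_measure1E// lte_mul_pinfty// ge0_fin_numE.
Qed.

HB.instance Definition _ := @Measure_isSigmaFinite.Build _ _ _
  lebesgue_step lebesgue_step_sigma_finite.
End step.

Fixpoint lebesgue_Rd (n : nat) : {sigma_finite_measure set (Rspace R n) -> \bar R} :=
  match n with
  | 0 => \d_([tuple] : Rspace R 0)
  | n'.+1 => lebesgue_step (lebesgue_Rd n')
  end.

Lemma lebesgue_Rd_box n (A : 'I_n -> set (measurableTypeR R)) :
  (forall i, measurable (A i)) ->
  lebesgue_Rd n [set x | forall i, A i (tnth x i)] =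
  (\prod_(i < n) lebesgue_measure (A i))%E.
Proof.
elim: n A => [|n IHn] A mA.
  by rewrite big_ord0 /= diracE mem_set// => -[].
rewrite big_ord_recl -IHn; last by move=> i; exact: mA.
rewrite -product_measure1E//.
  rewrite /= /lebesgue_step /pushforward; congr (_ _).
  apply/seteqP; split => [[a x] /= Aax|[a x] /= [Aa Ax] i].
    split=> [|i /=]; first by have := Aax ord0.
    by have := Aax (lift ord0 i); rewrite tnthS.
  by case: (unliftP ord0 i) => [j|] ->; rewrite ?tnthS//; exact: Ax.
rewrite [X in measurable X](_ : _ =
  \big[setI/setT]_(i < n) ((fun x => tnth x i) @^-1` A (lift ord0 i))).
  apply: bigsetI_measurable => i _.
  by rewrite -[X in measurable X]setTI; exact: measurable_tnth.
apply/seteqP; split => x /=; last by move=> + i; rewrite (bigD1 i)//= => -[].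
by move=> Ax; elim/big_rec : _ => // i B _ Bx; split.
Qed.

End lebesgue_tuple.

(* The measure on nat with the given point masses. *)
Section pmf_measure.
Variables (R : realType) (m : nat -> \bar R).
Hypothesis m_ge0 : forall k, (0 <= m k)%E.

Definition pmf_measure of (forall k, (0 <= m k)%E) : set nat -> \bar R :=
  fun A => (\esum_(k in A) m k)%E.

Local Notation mu := (pmf_measure m_ge0).

Let mu0 : mu set0 = 0%E.
Proof. exact: esum_set0. Qed.

Let mu_ge0 A : (0 <= mu A)%E.
Proof. exact: esum_ge0. Qed.

Let mu_sigma_additive : semi_sigma_additive mu.
Proof.
move=> F mF tF mUF; apply: cvg_toP; last first.
  by rewrite /pmf_measure nneseries_sum_bigcup.
apply: ereal_nondecreasing_is_cvgn => a b ab.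
by apply: lee_sum_nneg_natr => // n _ _; exact: mu_ge0.
Qed.

HB.instance Definition _ := isMeasure.Build _ _ _ mu mu0 mu_ge0 mu_sigma_additive.

End pmf_measure.

Section geometry.
Variables (R : realType) (d : nat).

Definition euclidean_norm (v : 'I_d -> R) : R :=
  Num.sqrt (\sum_(i < d) v i ^+ 2).

Definition torus : set (Rspace R d) :=
  [set x | forall i : 'I_d, - 2^-1 < (tnth x i : R) <= 2^-1].

(* A shift v in {-1, 0, 1}^d is encoded by a function into 'I_3, minus 1; the
   zero shift, which is among them, also serves as the unit of the minimum. *)
Definition torus_dist (x y : Rspace R d) : R :=
  let diff i := (tnth x i : R) - (tnth y i : R) in
  \big[Num.min/euclidean_norm diff]_(v : {ffun 'I_d -> 'I_3})
    euclidean_norm (fun i => diff i + ((v i)%:R - 1)).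

Definition profile_function (phi : R -> R) : Prop :=
  [/\ forall x, 0 <= x -> 0 <= phi x <= 1,
      forall x y, 0 <= x -> x <= y -> phi y <= phi x,
      (@lebesgue_measure R).-integrable `[0, +oo[ (EFin \o phi) &
      (\int[lebesgue_Rd R d]_x
         (phi (euclidean_norm (fun i => tnth x i : R) ^+ d))%:E = 1)%E].

End geometry.

Section network.
Variables (R : realType) (d : nat).
Context {dO : measure_display} {Omega : measurableType dO}.
Variable P : probability Omega R.

(* The points of a unit rate Poisson process on (0, +oo), in increasing order:
   numbers of points in disjoint intervals are independent and Poisson. *)
Definition unit_poisson_process (T : nat -> {RV P >-> measurableTypeR R}) : Prop :=
  [/\ forall w, 0 < (T 0%N w : R),
      forall n w, (T n w : R) < T n.+1 w &
      forall (m : nat) (s : nat -> R) (k : nat -> nat),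
        0 <= s 0%N -> (forall i, (i < m)%N -> s i < s i.+1) ->
        P (\bigcap_(i < m)
             [set w | ([set n | s i < (T n w : R) <= s i.+1] #= `I_(k i))%card]) =
        (\prod_(i < m) poisson_pmf (s i.+1 - s i) (k i))%:E].

Definition generated_sigma_algebra d' (S : measurableType d')
    (Y : nat -> Omega -> S) : set (set Omega) :=
  <<s \bigcup_n preimage_set_system setT (Y n) measurable >>.

(* X is an i.i.d. sequence, uniform on the torus and independent of T. *)
Definition iid_uniform_positions (T : nat -> {RV P >-> measurableTypeR R})
    (X : nat -> {RV P >-> Rspace R d}) : Prop :=
  forall (A : set Omega) (n : nat) (B : nat -> set (Rspace R d)),
    generated_sigma_algebra T A -> (forall i, measurable (B i)) ->
    P (A `&` \bigcap_(i < n) (X i @^-1` B i)) =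
    (P A * \prod_(i < n) lebesgue_Rd R d (B i `&` @torus R d))%E.

Definition connection_probability (gamma beta : R) (phi : R -> R)
    (x : Rspace R d) (u : R) (y : Rspace R d) (s : R) : R :=
  phi (u * torus_dist x y ^+ d / (beta * (u / s) `^ gamma)).

(* Vertex n is (X n, T n), so that i < j means that i is older than j; for
   i < j, E i j is the event that j connects to i at its birth. Given the
   vertices, these events are independent with the prescribed probabilities. *)
Definition independent_edges (gamma beta : R) (phi : R -> R)
    (T : nat -> {RV P >-> measurableTypeR R}) (X : nat -> {RV P >-> Rspace R d})
    (E : nat -> nat -> set Omega) : Prop :=
  (forall i j, (i < j)%N -> measurable (E i j)) /\
  forall (A : set Omega) (F : seq (nat * nat)),
    generated_sigma_algebra (fun n w => (X n w, T n w)) A ->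
    uniq F -> (forall e, e \in F -> (e.1 < e.2)%N) ->
    P (A `&` \bigcap_(e in [set` F]) E e.1 e.2) =
    (\int[P]_(w in A) (\prod_(e <- F) connection_probability gamma beta phi
       (X e.2 w) (T e.2 w) (X e.1 w) (T e.1 w))%:E)%E.

Definition age_based_network (gamma beta : R) (phi : R -> R)
    (T : nat -> {RV P >-> measurableTypeR R}) (X : nat -> {RV P >-> Rspace R d})
    (E : nat -> nat -> set Omega) : Prop :=
  [/\ unit_poisson_process T, iid_uniform_positions T X &
      independent_edges gamma beta phi T X E].

End network.

Section indegree.
Variables (R : realType) (Omega : Type).
Variables (T : nat -> Omega -> R) (E : nat -> nat -> set Omega).

Definition vertices (t : R) (w : Omega) : set nat := [set i | T i w <= t].

Definition joined (w : Omega) (i j : nat) : Prop :=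
  ((i < j)%N /\ E i j w) \/ ((j < i)%N /\ E j i w).

Definition younger_neighbours (t : R) (w : Omega) (i : nat) : set nat :=
  [set j | [/\ vertices t w j, joined w j i & T i w < T j w]].

(* fset_set sends an infinite set to the empty one; in the network this does
   not happen outside a null set. *)
Definition indegree (t : R) (w : Omega) (i : nat) : nat :=
  (#|` fset_set (younger_neighbours t w i)|)%fset.

(* (1/t) sum over the vertices x of G_t of h (indegree of x) *)
Definition vertex_average (h : nat -> R) (t : R) (w : Omega) : \bar R :=
  (t^-1%:E * \esum_(i in vertices t w) (h (indegree t w i))%:E)%E.

Definition empirical_pmf (t : R) (w : Omega) (k : nat) : \bar R :=
  vertex_average (fun n => (n == k)%:R) t w.

Lemma empirical_pmf_ge0 (t : R) (t0 : 0 < t) (w : Omega) (k : nat) :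
  (0 <= empirical_pmf t w k)%E.
Proof.
apply: mule_ge0; first by rewrite lee_fin invr_ge0 ltW.
by apply: esum_ge0 => i _; rewrite lee_fin ler0n.
Qed.

Definition empirical_indegree (t : R) (t0 : 0 < t) (w : Omega) :=
  pmf_measure (empirical_pmf_ge0 t0 w).

End indegree.

Section limit.
Variables (R : realType) (gamma beta : R).

Definition mixing_density (l : R) : R :=
  beta `^ gamma^-1 * (gamma * l + beta) `^ (- (1 + gamma^-1)).

Definition mixed_poisson_pmf (k : nat) : \bar R :=
  (\int[@lebesgue_measure R]_(l in `]0%R, +oo[)
     (expR (- l) * (l ^+ k / k`!%:R) * mixing_density l)%:E)%E.

Lemma mixed_poisson_pmf_ge0 k : (0 <= mixed_poisson_pmf k)%E.
Proof.
apply: integral_ge0 => l; rewrite /= in_itv/= andbT => l0.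
by rewrite lee_fin !mulr_ge0 ?powR_ge0 ?expR_ge0 ?exprn_ge0 ?invr_ge0 ?ler0n// ltW.
Qed.

Definition mixed_poisson := pmf_measure mixed_poisson_pmf_ge0.

End limit.

(* Main.v *)
(* Given the arrival times, the edges towards a fixed vertex i are independent
   after averaging over the positions: j joins i with probability q_ij ~ 1/r_ij,
   where r_ij = T_j / (beta (T_j / T_i)^gamma), because r q(r) -> 1. Hence the
   generating function x^(indegree of i) has mean prod_j (1 - (1 - x) q_ij). Since
   T_n / n -> 1 almost surely, the average of these products over i converges to
   the integral over v in (0, 1) of exp(-(1 - x) lam v), where
   lam v = (beta / gamma) (v^(-gamma) - 1); substituting l = lam v turns this into
   the generating function of the mixed Poisson law. Averaging over the positions
   of two vertices decouples their indegrees up to common younger neighbours, of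
   which there are few, so the averages of x^indegree converge in L^2 on the
   events where T_n is of order n for all n. Letting x -> 0 yields convergence of
   the frequencies of all indegrees. The same generating functions bound the part
   of the average indegree carried by indegrees >= K by a constant times
   K^-(1 - gamma), uniformly in t, which extends the convergence to functions of
   linear growth. *)
From HB Require Import structures.
Require Import Defs.
From mathcomp Require Import all_boot all_order all_algebra.
From mathcomp Require Import finmap.
From mathcomp Require Import all_classical all_reals all_analysis.
From mathcomp Require Import measurable_realfun ring lra.
Import Order.TTheory GRing.Theory Num.Theory.
Import numFieldNormedType.Exports.

Set Implicit Arguments.
Unset Strict Implicit.
Unset Printing Implicit Defensive.
Local Open Scope classical_set_scope.
Local Open Scope ring_scope.

(** * Integration on the torus *)

(** Two edges that share a vertex are dependent through its position. What saves the factorisation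
    is the homogeneity of the torus: the average of a connection probability over either endpoint is
    the same for every position of the other one. A vertex that occurs in a single factor can
    therefore be averaged out, leaving a weight that depends on the arrival times only. Stars come
    apart completely in this way; two stars with common younger neighbours may contain cycles, so
    for pairs only an upper bound is obtained, which is all that a second moment needs. The number
    of vertices at time t is random. It is fixed by splitting the regular configurations into the
    events [cell M t n], which depend on the arrival times alone and so are admissible weights in
    every average. The rate K^-(1 - gamma) has this origin: vertex i has expected indegree of order
    (n / i)^gamma, and the moment of order 1 + (1 - gamma) of these values stays bounded on average
    because gamma (2 - gamma) < 1. *)

Section lebesgue_affine.
Variable R : realType.
Local Notation mu := (@lebesgue_measure R).

Lemma measurable_affine (a b : R) : measurable_fun setT (fun y : R => a * y + b).
Proof. by apply: measurable_funD => //; exact: mulrl_measurable. Qed.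

(** Lebesgue measure is determined by half-open intervals, and on these it agrees with a times its
    image under y -> a y + b. *)
Lemma ge0_integral_affine (a b : R) (f : R -> \bar R) : 0 < a ->
  measurable_fun setT f -> (forall x, 0 <= f x)%E ->
  (a%:E * \int[mu]_y f (a * y + b)%R = \int[mu]_y f y)%E.
Proof.
move=> a0 mf f0.
pose h (y : measurableTypeR R) : measurableTypeR R := a * y + b.
have mh : measurable_fun setT h by exact: measurable_affine.
pose nu := mscale (NngNum (ltW a0)) (pushforward mu h).
transitivity (\int[nu mh]_y f y)%E.
  rewrite ge0_integral_mscale//; congr (_ * _)%E.
  by rewrite ge0_integral_pushforward// preimage_setT.
apply: eq_measure_integral => A mA _; apply/esym.
apply: (@lebesgue_measure_unique R (nu mh)) => // _ [[x y] /= _ <-].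
rewrite /nu /mscale/= /pushforward/=.
have -> : h @^-1` `]x, y]%classic = `](x - b) / a, (y - b) / a]%classic.
  apply/seteqP; split => z /=; rewrite !in_itv/= /h ltr_pdivrMr// ler_pdivlMr// => /andP[? ?]; apply/andP; split; lra.
rewrite !lebesgue_measure_itv/= !lte_fin ltr_pM2r ?invr_gt0// ltrD2r.
case: ifPn => xy; last by rewrite mule0.
by rewrite -!EFinD -EFinM; congr (_%:E); field; rewrite gt_eqF.
Qed.

Lemma ge0_integral_affine_itv (a b : R) (i j : interval R) (f : R -> \bar R) : 0 < a ->
  (forall y, (y \in i) = (a * y + b \in j)) ->
  measurable_fun setT f -> (forall x, 0 <= f x)%E ->
  (a%:E * \int[mu]_(y in [set` i]) f (a * y + b)%R = \int[mu]_(y in [set` j]) f y)%E.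
Proof.
move=> a0 ij mf f0; rewrite [RHS]integral_mkcond [X in (_ * X)%E]integral_mkcond.
rewrite -[RHS](@ge0_integral_affine a b)//.
- congr (_ * _)%E; apply: eq_integral => y _; rewrite !patchE/=.
  by rewrite !mem_setE ij.
- by apply/(measurable_restrictT _ _).1 => //; apply: measurable_funTS.
- by move=> x; exact: erestrict_ge0.
Qed.

End lebesgue_affine.

(** * Integrals over cubes of functions of a sum over the coordinates *)

Section box_integrals.
Variable R : realType.
Local Notation mu := (@lebesgue_measure R).
Local Notation Leb := (lebesgue_Rd R).

Definition box n (I : interval R) : set (Rspace R n) :=
  [set x | forall k, (tnth x k : R) \in I].

Arguments box : clear implicits.
Lemma torus_box d : @torus R d = box d `]- 2^-1, 2^-1].
Proof. by apply/seteqP; split => x /= h k; have := h k; rewrite in_itv. Qed.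

Lemma measurable_box n I : measurable (box n I).
Proof.
rewrite (_ : box n I =
  \big[setI/setT]_(i < n) ((fun x => tnth x i) @^-1` [set` I])).
  apply: bigsetI_measurable => i _; rewrite -[X in measurable X]setTI.
  apply: measurable_tnth => //; exact: measurable_itv.
apply/seteqP; split => x /=; last by move=> + i; rewrite (bigD1 i)//= => -[].
by move=> Ax; elim/big_rec : _ => // i B _ Bx; split => //; exact: Ax.
Qed.

Lemma ge0_integral_lebesgue_RdS n (f : Rspace R n.+1 -> \bar R) :
  measurable_fun setT f -> (forall x, 0 <= f x)%E ->
  (\int[Leb n.+1]_x f x = \int[mu]_a \int[Leb n]_y f (tuple_join (a, y)))%E.
Proof.
move=> mf f0.
have mj : measurable_fun setT (@tuple_join R n) by exact: measurable_tuple_join.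
transitivity (\int[(mu \x Leb n)%E]_p f (tuple_join p))%E.
  by rewrite [LHS]ge0_integral_pushforward.
rewrite (fubini_tonelli1 (fun p => f (tuple_join p)))//.
exact: measurableT_comp.
Qed.

Lemma measurable_sum_tnth n (u : 'I_n -> R -> R) :
  (forall i, measurable_fun setT (u i)) ->
  measurable_fun setT (fun y : Rspace R n => \sum_i u i (tnth y i)).
Proof.
move=> mu_; apply: measurable_sum => i.
by apply: (measurableT_comp (mu_ i)); exact: measurable_tnth.
Qed.

Lemma box_join n (I : interval R) a (y : Rspace R n) :
  box n.+1 I (tuple_join (a, y)) <-> a \in I /\ box n I y.
Proof.
split => [h|[aI h] k].
  split; first by have := h ord0.
  by move=> k; have := h (lift ord0 k); rewrite tnthS.
by case: (unliftP ord0 k) => [j|] ->; rewrite ?tnthS//; exact: h.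
Qed.

Lemma box_integralS n (I : interval R) (u : 'I_n.+1 -> R -> R) (K : R -> \bar R) :
  (forall i, measurable_fun setT (u i)) ->
  measurable_fun setT K -> (forall x, 0 <= K x)%E ->
  (\int[Leb n.+1]_(y in box n.+1 I) K (\sum_i u i (tnth y i))%R =
   \int[mu]_(a in [set` I])
     \int[Leb n]_(y in box n I) K (u ord0 a + \sum_i u (lift ord0 i) (tnth y i))%R)%E.
Proof.
move=> mu_ mK K0; rewrite integral_mkcond ge0_integral_lebesgue_RdS; last 2 first.
- apply/(measurable_restrictT _ _).1; first exact: measurable_box.
  by apply: measurable_funTS; apply: measurableT_comp => //; exact: measurable_sum_tnth.
- by move=> x; exact: erestrict_ge0.
rewrite [RHS]integral_mkcond; apply: eq_integral => a _; rewrite patchE.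
case: ifPn => aI; last first.
  apply: integral0_eq => y _; rewrite patchE; case: ifPn => // /set_mem.
  by move=> /box_join[aI']; move: aI; rewrite mem_setE/= aI'.
rewrite [RHS]integral_mkcond; apply: eq_integral => y _; rewrite !patchE.
have -> : (tuple_join (a, y) \in box n.+1 I) = (y \in box n I).
  apply/idP/idP => /set_mem h; apply/mem_set; first by case/box_join : h.
  by apply/box_join; move: aI; rewrite mem_setE.
case: ifPn => // _; rewrite big_ord_recl /=; congr (K (_ + _)).
by apply: eq_bigr => i _; rewrite tnthS.
Qed.

(** Makes the inner integral, as a function of the first summand, an admissible test function for
    the one-dimensional hypothesis of [box_integral_transfer]. *)
Lemma measurable_box_integral n (I : interval R) (u : 'I_n -> R -> R) (K : R -> \bar R) :
  (forall i, measurable_fun setT (u i)) ->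
  measurable_fun setT K -> (forall x, 0 <= K x)%E ->
  measurable_fun setT (fun s : R =>
    \int[Leb n]_(y in box n I) K (s + \sum_i u i (tnth y i))%R)%E.
Proof.
move=> mu_ mK K0.
under eq_fun do rewrite integral_mkcond.
pose F (p : R * Rspace R n) :=
  ((fun y => K (p.1 + \sum_i u i (tnth y i))%R) \_ (box n I)) p.2.
have F0 p : (0 <= F p)%E by rewrite /F patchE; case: ifPn.
apply: (measurable_fun_fubini_tonelli_F F _ F0).
rewrite (_ : F = (fun p => if p.2 \in box n I
  then K (p.1 + \sum_i u i (tnth p.2 i))%R else 0%E)); last first.
  by apply/funext => p; rewrite /F patchE.
apply: measurable_fun_ifT => //.
- apply: (measurable_fun_bool true).
  rewrite setTI [X in measurable X](_ : _ = setT `*` box n I).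
    by apply: measurableX => //; exact: measurable_box.
  by apply/seteqP; split => -[a y]/=; [move/set_mem|case=> _ /mem_set ->].
- apply: measurableT_comp => //; apply: measurable_funD => //.
  by apply: (measurableT_comp (measurable_sum_tnth _)) => //; exact: measurable_snd.
Qed.

(** Under a product measure the law of a sum is determined by the laws of its summands, so a
    one-dimensional identity of image measures carries over to n coordinates. It serves twice: with
    a = 1 for translations of the torus, and with a = r^(1/d) for rescaling. *)
Lemma box_integral_transfer n (I J : interval R) (a : R)
    (u v : 'I_n -> R -> R) : 0 <= a ->
  (forall i, measurable_fun setT (u i)) -> (forall i, measurable_fun setT (v i)) ->
  (forall i (K : R -> \bar R), measurable_fun setT K -> (forall x, 0 <= K x)%E ->
    a%:E * \int[mu]_(y in [set` I]) K (u i y) =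
    \int[mu]_(y in [set` J]) K (v i y))%E ->
  forall K : R -> \bar R, measurable_fun setT K -> (forall x, 0 <= K x)%E ->
  ((a ^+ n)%:E * \int[Leb n]_(y in box n I) K (\sum_i u i (tnth y i))%R =
   \int[Leb n]_(y in box n J) K (\sum_i v i (tnth y i))%R)%E.
Proof.
move=> a0; elim: n u v => [|n IH] u v mu_ mv uv K mK K0.
  rewrite expr0 mul1e [LHS]integral_mkcond [RHS]integral_mkcond.
  apply: eq_integral => y _; rewrite !patchE !big_ord0.
  have h L : (y \in box 0 L) = true by apply/mem_set => -[].
  by rewrite !h.
rewrite (box_integralS I mu_)// (box_integralS J mv)// exprS EFinM -muleA.
have mS (w : 'I_n.+1 -> R -> R) L : (forall i, measurable_fun setT (w i)) ->
    measurable_fun setT (fun s : R =>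
    \int[Leb n]_(y in box n L) K (s + \sum_i w (lift ord0 i) (tnth y i))%R)%E.
  by move=> mw; apply: (@measurable_box_integral n L (fun i => w (lift ord0 i))).
rewrite -ge0_integralZl//; last 3 first.
- by apply: measurable_funTS; exact: (measurableT_comp (mS u I mu_) (mu_ ord0)).
- by move=> b _; apply: integral_ge0.
- by rewrite lee_fin exprn_ge0.
(* The first coordinate is exchanged with the whole inner integral as test function; the induction
   hypothesis then treats the inner integral with K shifted by the first summand. *)
rewrite -(uv ord0 (fun s => \int[Leb n]_(y in box n J)
  K (s + \sum_i v (lift ord0 i) (tnth y i))%R)%E); last 2 first.
- exact: mS.
- by move=> s; exact: integral_ge0.
congr (_ * _)%E; apply: eq_integral => b _.
apply: (IH (fun i => u (lift ord0 i)) (fun i => v (lift ord0 i)) _ _ _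
  (fun s => K (u ord0 b + s)%R)) => //.
  by move=> i; exact: uv.
by apply: measurableT_comp => //; exact: measurable_funD.
Qed.

End box_integrals.

(** * The torus metric and its homogeneity *)

Section torus_geometry.
Variable R : realType.
Local Notation mu := (@lebesgue_measure R).
Local Notation Leb := (lebesgue_Rd R).

(* Squared circle distance: the minimum over the shifts in [torus_dist] can be
   taken coordinate by coordinate. *)
Definition wrap2 (w : R) : R := Num.min (w ^+ 2) (Num.min ((w - 1) ^+ 2) ((w + 1) ^+ 2)).

Lemma wrap2N w : wrap2 (- w) = wrap2 w.
Proof.
rewrite /wrap2 [Num.min ((- w - 1) ^+ 2) _]minC sqrrN; congr (Num.min _ (Num.min _ _)).
  by rewrite -sqrrN; congr (_ ^+ 2); ring.
by rewrite -sqrrN; congr (_ ^+ 2); ring.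
Qed.

Lemma measurable_wrap2 : measurable_fun setT wrap2.
Proof.
apply: measurable_minr; first exact: exprn_measurable.
by apply: measurable_minr; apply: measurable_funX; apply: measurable_funD.
Qed.

Lemma wrap2_shift (w : R) : exists j : 'I_3, wrap2 w = (w + (j%:R - 1)) ^+ 2.
Proof.
rewrite /wrap2; case: (leP (w ^+ 2)) => _.
  by exists (inord 1); rewrite inordK// subrr addr0.
case: (leP ((w - 1) ^+ 2)) => _.
  by exists ord0; rewrite sub0r.
by exists (inord 2); rewrite inordK//; congr ((_ + _) ^+ 2); lra.
Qed.

Lemma wrap2_le (w : R) (j : 'I_3) : wrap2 w <= (w + (j%:R - 1)) ^+ 2.
Proof.
rewrite /wrap2 !ge_min; case: j => -[|[|[|//]]] ?/=.
- by rewrite sub0r lexx !orbT.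
- by rewrite subrr addr0 lexx.
- by rewrite (_ : 2 - 1 = 1) ?lexx ?orbT//; lra.
Qed.

Lemma wrap2_le0 (w : R) : wrap2 w <= w ^+ 2.
Proof. by rewrite /wrap2 ge_min lexx. Qed.

(** The entries of a shift vector are chosen independently, so the coordinatewise optimal shifts
    form one admissible vector. *)
Lemma torus_distE d (x y : Rspace R d) :
  torus_dist x y = Num.sqrt (\sum_i wrap2 ((tnth x i : R) - (tnth y i : R))).
Proof.
rewrite /torus_dist; apply/le_anti/andP; split.
  have /choice[v vE] := fun i : 'I_d => wrap2_shift ((tnth x i : R) - (tnth y i : R)).
  apply: (bigmin_inf [ffun i => v i]) => //.
  rewrite /euclidean_norm; apply: ler_wsqrtr; apply: ler_sum => i _.
  by rewrite vE ffunE.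
apply: le_bigmin => [|v _].
  by apply: ler_wsqrtr; apply: ler_sum => i _; exact: wrap2_le0.
by apply: ler_wsqrtr; apply: ler_sum => i _; exact: wrap2_le.
Qed.

Lemma torus_distC d (x y : Rspace R d) : torus_dist x y = torus_dist y x.
Proof.
rewrite !torus_distE; congr Num.sqrt; apply: eq_bigr => i _.
by rewrite -wrap2N opprB.
Qed.

Lemma ge0_integral_itv_split (l m u : R) (f : R -> \bar R) : l <= m -> m <= u ->
  measurable_fun setT f -> (forall x, 0 <= f x)%E ->
  (\int[mu]_(y in `]l, u]) f y =
   \int[mu]_(y in `]l, m]) f y + \int[mu]_(y in `]m, u]) f y)%E.
Proof.
move=> lm mu_ mf f0; rewrite -ge0_integral_setU//=.
- rewrite (_ : `]l, m] `|` `]m, u] = `]l, u])%classic//.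
  apply/seteqP; split => y /=; rewrite !in_itv/=; last first.
    by move=> /andP[ly yu]; case: (leP y m) => ym; [left|right]; apply/andP.
  by move=> [] /andP[? ?]; apply/andP; split; lra.
- exact: measurable_funTS.
- by apply/disj_setPRL => y /=; rewrite !in_itv/= => /andP[? ?]; apply/negP; rewrite negb_and -!leNgt; lra.
Qed.

Lemma measurable_comp_sqr (K : R -> \bar R) : measurable_fun setT K ->
  measurable_fun setT (fun y : R => K (y ^+ 2)).
Proof. by move=> mK; apply: measurableT_comp => //; exact: exprn_measurable. Qed.

(** Translation invariance of the circle. The interval is cut at the antipode of x, and the two
    pieces, moved by -x and by 1 - x (or -1 - x when x < 0), reassemble to the same interval in
    swapped order. *)
Lemma wrap2_transfer (x : R) (K : R -> \bar R) : - 2^-1 < x <= 2^-1 ->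
  measurable_fun setT K -> (forall x, 0 <= K x)%E ->
  (\int[mu]_(y in `](- 2^-1)%R, (2^-1)%R]) K (wrap2 (y - x)) =
   \int[mu]_(y in `](- 2^-1)%R, (2^-1)%R]) K (y ^+ 2)%R)%E.
Proof.
move=> /andP[x1 x2] mK K0; have mKs := measurable_comp_sqr mK.
have mKw : measurable_fun setT (fun y : R => K (wrap2 (y - x))).
  apply: measurableT_comp => //; apply: (measurableT_comp measurable_wrap2).
  exact: measurable_funD.
have piece (l u b : R) : (forall y : R, l < y <= u -> wrap2 (y - x) = (y + b) ^+ 2) ->
    (\int[mu]_(y in `]l, u]) K (wrap2 (y - x)) =
     \int[mu]_(y in `](l + b)%R, (u + b)%R]) K (y ^+ 2)%R)%E.
  move=> h; rewrite -(@ge0_integral_affine_itv _ 1 b `]l, u] `](l + b)%R, (u + b)%R]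
    (fun y => K (y ^+ 2)%R))//.
    by rewrite mul1e; apply: eq_integral => y; rewrite inE/= in_itv/= => /h ->; rewrite mul1r.
  by move=> y; rewrite !in_itv/= mul1r ltrD2r lerD2r.
have sq (a b : R) : (a ^+ 2 <= b ^+ 2) = (`|a| <= `|b|).
  by rewrite -[a ^+ 2]real_normK ?num_real// -[b ^+ 2]real_normK ?num_real// ler_pXn2r ?nnegrE.
have w0 (y : R) : - 2^-1 <= y <= 2^-1 -> wrap2 y = y ^+ 2.
  move=> /andP[? ?]; rewrite /wrap2 min_l// le_min !expr2; apply/andP; split; nra.
have w1 (y : R) : 2^-1 <= y <= 3/2 -> wrap2 y = (y - 1) ^+ 2.
  move=> /andP[? ?]; rewrite /wrap2 min_r ?min_l ?ge_min//; rewrite ?expr2; try nra.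
have [x0|x0] := leP 0 x.
  have [h1 h2] : - 2^-1 <= x - 2^-1 /\ x - 2^-1 <= 2^-1 by split; lra.
  have [h3 h4] : - 2^-1 <= 2^-1 - x /\ 2^-1 - x <= 2^-1 by split; lra.
  rewrite (ge0_integral_itv_split h1 h2 mKw)// (ge0_integral_itv_split h3 h4 mKs)//.
  rewrite addeC (piece (x - 2^-1) 2^-1 (- x)); last first.
    by move=> y /andP[? ?]; apply: w0; apply/andP; split; lra.
  rewrite (piece (- 2^-1) (x - 2^-1) (1 - x)); last first.
    move=> y /andP[? ?]; rewrite -wrap2N w1; last by apply/andP; split; lra.
    by rewrite -sqrrN; congr (_ ^+ 2); ring.
  rewrite (_ : x - 2^-1 - x = - 2^-1); last by ring.
  rewrite (_ : - 2^-1 + (1 - x) = 2^-1 - x); last by lra.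
  by rewrite (_ : x - 2^-1 + (1 - x) = 2^-1); last by lra.
have [h1 h2] : - 2^-1 <= x + 2^-1 /\ x + 2^-1 <= 2^-1 by split; lra.
have [h3 h4] : - 2^-1 <= - 2^-1 - x /\ - 2^-1 - x <= 2^-1 by split; lra.
rewrite (ge0_integral_itv_split h1 h2 mKw)// (ge0_integral_itv_split h3 h4 mKs)//.
rewrite addeC (piece (- 2^-1) (x + 2^-1) (- x)); last first.
  by move=> y /andP[? ?]; apply: w0; apply/andP; split; lra.
rewrite (piece (x + 2^-1) 2^-1 (- 1 - x)); last first.
  move=> y /andP[? ?]; rewrite w1; last by apply/andP; split; lra.
  by congr (_ ^+ 2); ring.
rewrite (_ : x + 2^-1 - x = 2^-1); last by ring.
rewrite (_ : x + 2^-1 + (- 1 - x) = - 2^-1); last by lra.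
by rewrite (_ : 2^-1 + (- 1 - x) = - 2^-1 - x); last by lra.
Qed.

(** The right-hand side does not involve x: this is the homogeneity of the torus, coordinate by
    coordinate from [wrap2_transfer]. *)
Lemma torus_dist_integral d (x : Rspace R d) (K : R -> \bar R) : @torus R d x ->
  measurable_fun setT K -> (forall x, 0 <= K x)%E ->
  (\int[Leb d]_(y in @torus R d) K (torus_dist y x) =
   \int[Leb d]_(y in @torus R d) K (euclidean_norm (fun i => tnth y i : R)))%E.
Proof.
move=> tx mK K0.
rewrite torus_box; under eq_integral do rewrite torus_distE.
rewrite -[LHS]mul1e -[1%E]/((1:R)%:E) -[X in X%:E](expr1n _ d).
apply: (@box_integral_transfer R d `]- 2^-1, 2^-1] `]- 2^-1, 2^-1] 1
  (fun i y => wrap2 (y - (tnth x i : R))) (fun i y => y ^+ 2) ler01 _ _ _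
  (fun s => K (Num.sqrt s))).
- move=> i; apply: (measurableT_comp measurable_wrap2); exact: measurable_funD.
- by move=> i; exact: exprn_measurable.
- by move=> i K' mK' K'0; rewrite mul1e; apply: wrap2_transfer => //; exact: tx.
- apply: measurableT_comp => //; by apply: continuous_measurable_fun; exact: sqrt_continuous.
- by [].
Qed.

End torus_geometry.

(** * The connection probability averaged over one endpoint *)

Section edge_mass.
Variables (R : realType) (d : nat) (phi : R -> R).
Hypotheses (d_gt0 : (0 < d)%N) (phi_profile : profile_function d phi).
Local Notation mu := (@lebesgue_measure R).
Local Notation Leb := (lebesgue_Rd R).
Local Notation norm y := (euclidean_norm (fun i => tnth y i : R)).

(* [phi] is unconstrained on the negative half-line. *)
Definition phi0 (x : R) : R := phi (Num.max x 0).

Lemma phi0E x : 0 <= x -> phi0 x = phi x.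
Proof. by move=> x0; rewrite /phi0 max_l. Qed.

Lemma phi0_ge0 x : 0 <= phi0 x.
Proof.
have [/(_ (Num.max x 0))] := phi_profile.
by rewrite le_max lexx orbT => /(_ isT)/andP[].
Qed.

Lemma phi0_le1 x : phi0 x <= 1.
Proof.
have [/(_ (Num.max x 0))] := phi_profile.
by rewrite le_max lexx orbT => /(_ isT)/andP[].
Qed.

Lemma phi0_nonincreasing x y : x <= y -> phi0 y <= phi0 x.
Proof.
move=> xy; have [_ /(_ (Num.max x 0) (Num.max y 0)) + _ _] := phi_profile.
by apply; rewrite ?ge_max ?le_max ?lexx ?orbT ?xy.
Qed.

Lemma measurable_phi0 : measurable_fun setT phi0.
Proof. by apply: nonincreasing_measurable => // x y; exact: phi0_nonincreasing. Qed.

Lemma euclidean_norm_ge0 n (v : 'I_n -> R) : 0 <= euclidean_norm v.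
Proof. exact: sqrtr_ge0. Qed.

Lemma measurable_euclidean_norm n :
  measurable_fun setT (fun y : Rspace R n => norm y).
Proof.
apply: (measurableT_comp (f := @Num.sqrt R)).
  by apply: continuous_measurable_fun; exact: sqrt_continuous.
by apply: (@measurable_sum_tnth R n (fun _ y => y ^+ 2)) => _; exact: exprn_measurable.
Qed.

Lemma measurable_phi0_norm r :
  measurable_fun setT (fun y : Rspace R d => (phi0 (r * norm y ^+ d))%:E).
Proof.
apply/measurable_EFinP; apply: measurableT_comp; first exact: measurable_phi0.
apply: measurable_funM => //; apply: measurable_funX.
exact: measurable_euclidean_norm.
Qed.

(** Written in terms of the squared norm, because that is the coordinate sum to which
    [box_integral_transfer] applies. *)
Let radial (r : R) (s : R) : \bar R := (phi0 (r * Num.sqrt s ^+ d))%:E.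

Let measurable_radial r : measurable_fun setT (radial r).
Proof.
apply/measurable_EFinP; apply: measurableT_comp; first exact: measurable_phi0.
apply: measurable_funM => //; apply: measurable_funX.
by apply: continuous_measurable_fun; exact: sqrt_continuous.
Qed.

Let radial_ge0 r s : (0 <= radial r s)%E.
Proof. by rewrite lee_fin phi0_ge0. Qed.

Lemma lebesgue_torus : Leb d (@torus R d) = 1%E.
Proof.
have := @lebesgue_Rd_box R d (fun=> `]- 2^-1, 2^-1]%classic)
  (fun _ => measurable_itv _).
rewrite (_ : [set x | _] = @torus R d); last first.
  by apply/seteqP; split => x /= h i; have := h i; rewrite in_itv.
move=> ->; rewrite big1// => i _.
rewrite lebesgue_measure_itv/= lte_fin ifT; last lra.
by rewrite -EFinD; congr (_%:E); lra.
Qed.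

Lemma measurable_torus : measurable (@torus R d).
Proof. by rewrite torus_box; exact: measurable_box. Qed.

(** The function q of the overview. Centring at the origin loses nothing by homogeneity. *)
Definition edge_mass (r : R) : R :=
  fine (\int[Leb d]_(y in @torus R d) (phi0 (r * norm y ^+ d))%:E)%E.

Lemma edge_massE r :
  (edge_mass r)%:E = (\int[Leb d]_(y in @torus R d) (phi0 (r * norm y ^+ d))%:E)%E.
Proof.
rewrite /edge_mass fineK// ge0_fin_numE; last first.
  by apply: integral_ge0 => y _; rewrite lee_fin phi0_ge0.
apply: (@le_lt_trans _ _ (\int[Leb d]_(y in @torus R d) (cst 1%E) y)%E).
  apply: ge0_le_integral => //; first exact: measurable_torus.
  - by move=> y _; rewrite lee_fin phi0_ge0.
  - by apply: measurable_funTS; exact: measurable_phi0_norm.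
  - by move=> y _; rewrite lee_fin phi0_le1.
rewrite integral_cst; last exact: measurable_torus.
by rewrite mul1e; have /= -> := lebesgue_torus; exact: ltry.
Qed.

Lemma edge_mass_ge0 r : 0 <= edge_mass r.
Proof.
by rewrite fine_ge0// integral_ge0// => y _; rewrite lee_fin phi0_ge0.
Qed.

Lemma edge_mass_nonincreasing r s : r <= s -> edge_mass s <= edge_mass r.
Proof.
move=> rs; rewrite -lee_fin !edge_massE; apply: ge0_le_integral => //.
- exact: measurable_torus.
- by move=> y _; rewrite lee_fin phi0_ge0.
- by apply: measurable_funTS; exact: measurable_phi0_norm.
- by apply: measurable_funTS; exact: measurable_phi0_norm.
- move=> y _; rewrite lee_fin phi0_nonincreasing// ler_wpM2r//.
  by rewrite exprn_ge0// euclidean_norm_ge0.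
Qed.

Lemma measurable_edge_mass : measurable_fun setT edge_mass.
Proof. by apply: nonincreasing_measurable => // x y; exact: edge_mass_nonincreasing. Qed.

Lemma edge_mass_le1 r : edge_mass r <= 1.
Proof.
rewrite -lee_fin edge_massE.
apply: (@le_trans _ _ (\int[Leb d]_(y in @torus R d) (cst 1%E) y)%E).
  apply: ge0_le_integral => //; first exact: measurable_torus.
  - by move=> y _; rewrite lee_fin phi0_ge0.
  - by apply: measurable_funTS; exact: measurable_phi0_norm.
  - by move=> y _; rewrite lee_fin phi0_le1.
rewrite integral_cst; last exact: measurable_torus.
by rewrite mul1e; have /= -> := lebesgue_torus.
Qed.

(** Averaging over one endpoint erases the position of the other one; every later decoupling of
    edges rests on this. *)
Lemma torus_dist_edge_mass r (x : Rspace R d) : @torus R d x ->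
  (\int[Leb d]_(y in @torus R d) (phi0 (r * torus_dist y x ^+ d))%:E =
   (edge_mass r)%:E)%E.
Proof.
move=> tx; rewrite edge_massE.
apply: (torus_dist_integral (K := fun s => (phi0 (r * s ^+ d))%:E) tx).
- apply/measurable_EFinP; apply: measurableT_comp; first exact: measurable_phi0.
  by apply: measurable_funM => //; exact: exprn_measurable.
- by move=> s; rewrite lee_fin phi0_ge0.
Qed.

(** Substituting r^(1/d) y for y turns r q(r) into the integral of the profile over a cube of side
    r^(1/d). The normalisation of the profile then yields both r q(r) <= 1 and r q(r) -> 1. *)
Lemma edge_mass_scale r : 0 < r ->
  (r * edge_mass r)%:E =
  (\int[Leb d]_(y in @box R d `](- (r `^ d%:R^-1 / 2))%R, (r `^ d%:R^-1 / 2)%R])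
     (phi0 (norm y ^+ d))%:E)%E.
Proof.
move=> r0; set a := r `^ _; have a0 : 0 < a by exact: powR_gt0.
have ad : a ^+ d = r.
  rewrite -powR_mulrn ?(ltW a0)// -powRrM mulVf ?powRr1 ?(ltW r0)//.
  by rewrite pnatr_eq0 -lt0n.
rewrite EFinM edge_massE -{1}ad torus_box.
transitivity ((a ^+ d)%:E * \int[Leb d]_(y in @box R d `](- 2^-1)%R, (2^-1)%R])
    radial 1 (\sum_i (a * (tnth y i : R)) ^+ 2)%R)%E.
  congr (_ * _)%E; apply: eq_integral => y _.
  rewrite /radial mul1r -ad -exprMn; congr (phi0 (_ ^+ d))%:E.
  rewrite /euclidean_norm; under [in RHS]eq_bigr do rewrite exprMn.
  by rewrite -mulr_sumr sqrtrM ?sqr_ge0// sqrtr_sqr gtr0_norm.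
rewrite (@box_integral_transfer R d _ `](- (a / 2))%R, (a / 2)%R] _
  (fun _ y => (a * y) ^+ 2) (fun _ y => y ^+ 2) (ltW a0))//.
- by apply: eq_integral => y _; rewrite /radial mul1r.
- by move=> i; apply: measurable_funX; exact: mulrl_measurable.
- move=> i K mK K0.
  rewrite -(@ge0_integral_affine_itv _ a 0 `](- 2^-1)%R, (2^-1)%R] _ (fun y => K (y ^+ 2)%R))//.
  + by under [in RHS]eq_integral do rewrite addr0.
  + move=> y; rewrite !in_itv/= addr0; congr andb.
      by rewrite (_ : - (a / 2) = a * - 2^-1) ?ltr_pM2l//; ring.
    by rewrite ler_pM2l.
  + exact: measurable_comp_sqr.
Qed.

Lemma integral_phi0_norm : (\int[Leb d]_y (phi0 (norm y ^+ d))%:E = 1)%E.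
Proof.
have [_ _ _ <-] := phi_profile; apply: eq_integral => y _.
by rewrite phi0E// exprn_ge0// euclidean_norm_ge0.
Qed.

Lemma edge_mass_le r : 0 < r -> edge_mass r <= r^-1.
Proof.
move=> r0; rewrite -[r^-1]mul1r ler_pdivlMr// mulrC -lee_fin.
rewrite -[X in (_ <= X)%E]integral_phi0_norm.
rewrite edge_mass_scale//; apply: ge0_subset_integral => //.
- exact: measurable_box.
- by under eq_fun do rewrite -[_ ^+ d]mul1r; exact: measurable_phi0_norm.
- by move=> y _; rewrite lee_fin phi0_ge0.
Qed.

Lemma edge_mass_asymp (e : R) : 0 < e ->
  exists2 r0 : R, 0 < r0 & forall r, r0 <= r -> 1 - e <= r * edge_mass r.
Proof.
move=> e0.
pose B (n : nat) := @box R d `](- n%:R)%R, (n%:R : R)%R].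
have mf : measurable_fun setT (fun y : Rspace R d => (phi0 (norm y ^+ d))%:E).
  by under eq_fun do rewrite -[_ ^+ d]mul1r; exact: measurable_phi0_norm.
have subB (a b : R) : a <= b -> @box R d `](- a)%R, a] `<=` @box R d `](- b)%R, b].
  move=> ab y /= h i; have := h i; rewrite !in_itv/= => /andP[? ?].
  by apply/andP; split; lra.
have UB : \bigcup_n B n = setT.
  apply/seteqP; split => // y _.
  exists (Num.truncn (\sum_i `|tnth y i : R|)).+1 => //= i.
  have h : `|tnth y i : R| < (Num.truncn (\sum_i `|tnth y i : R|)).+1%:R.
    apply: le_lt_trans (truncnS_gt _).
    by rewrite (bigD1 i)//= lerDl sumr_ge0.
  by move: h; rewrite in_itv/= ltr_norml => /andP[-> /ltW ->].
have := @ge0_nondecreasing_set_cvg_integral _ _ _ B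
  (fun y : Rspace R d => (phi0 (norm y ^+ d))%:E) (Leb d).
rewrite UB integral_phi0_norm.
have ndB : nondecreasing_seq B.
  by move=> m n mn; apply/subsetPset/subB; rewrite ler_nat.
have mB n : measurable (B n) by exact: measurable_box.
move=> /(_ ndB mB _ _)/=.
have mf' : measurable_fun (\bigcup_n B n) (fun y : Rspace R d => (phi0 (norm y ^+ d))%:E) by exact: measurable_funTS.
move=> h.
have {h} : (\int[Leb d]_(y in B n) (phi0 (norm y ^+ d))%:E @[n --> \oo] --> 1)%E.
  by apply: h => // [n|n y _]; [exact: measurable_funTS|rewrite lee_fin phi0_ge0].
move=> /fine_cvgP[fB] /cvgrPdist_le/(_ e e0)[N _ /(_ N (leqnn N))/= hN].
(* From (2 N)^d on, the rescaled cube contains the cube of half-side N; [N.+1] keeps the threshold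
   positive. *)
exists ((N.+1%:R * 2) ^+ d); first by rewrite exprn_gt0.
move=> r rN.
have r0 : 0 < r by apply: lt_le_trans rN; rewrite exprn_gt0.
rewrite -lee_fin edge_mass_scale//.
have BN : ((1 - e)%:E <= \int[Leb d]_(y in B N) (phi0 (norm y ^+ d))%:E)%E.
  have I0 : (0 <= \int[Leb d]_(y in B N) (phi0 (norm y ^+ d))%:E)%E.
    by apply: integral_ge0 => y _; rewrite lee_fin phi0_ge0.
  have I1 : (\int[Leb d]_(y in B N) (phi0 (norm y ^+ d))%:E <= 1)%E.
    rewrite -[X in (_ <= X)%E]integral_phi0_norm; apply: ge0_subset_integral => //.
    by move=> y _; rewrite lee_fin phi0_ge0.
  rewrite -[leRHS]fineK ?ge0_fin_numE ?(le_lt_trans I1) ?ltry// lee_fin.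
  by move: hN; rewrite ler_distl => /andP[? ?]; lra.
apply: (le_trans BN); apply: ge0_subset_integral => //.
- exact: measurable_box.
- exact: measurable_funTS.
- by move=> y _; rewrite lee_fin phi0_ge0.
- apply: subB; rewrite ler_pdivlMr//.
  have N0 : 0 <= N%:R * 2 :> R by rewrite mulr_ge0.
  have dd : d%:R * d%:R^-1 = 1 :> R by rewrite mulfV// pnatr_eq0 -lt0n.
  have -> : N%:R * 2 = ((N%:R * 2) ^+ d) `^ d%:R^-1 :> R.
    by rewrite -powR_mulrn// -powRrM dd powRr1.
  apply: ge0_ler_powR; rewrite ?nnegrE ?invr_ge0 ?exprn_ge0 ?(ltW r0)//.
  apply: le_trans rN; apply: lerXn2r; rewrite ?nnegrE ?mulr_ge0//.
  by rewrite ler_wpM2r// ler_nat.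
Qed.

End edge_mass.

(** * Averaging over positions *)

Section freezing.
Context {R : realType} {dO : measure_display} {Omega : measurableType dO}.
Variable P : probability Omega R.
Variable C : set (set Omega).
Hypothesis mC : C `<=` measurable.
Local Notation OmegaC := (g_sigma_algebraType C).

Lemma g_sigma_measurable : <<s C >> `<=` measurable.
Proof. by apply: smallest_sub => //; exact: sigma_algebra_measurable. Qed.

Lemma measurable_g_sigma_id : measurable_fun setT (id : Omega -> OmegaC).
Proof. by move=> _ A mA; rewrite setTI; exact: g_sigma_measurable. Qed.

Lemma g_sigma_measurable_fun d' (S : measurableType d') (f : Omega -> S) :
  measurable_fun [set: OmegaC] f -> measurable_fun [set: Omega] f.
Proof. by move=> mf _ B mB; rewrite setTI; apply: g_sigma_measurable; rewrite -[X in <<s _ >> X]setTI; exact: mf. Qed.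

Context d' (S : measurableType d').
Variable Z : {RV P >-> S}.
Hypothesis indepZ : forall A B, <<s C >> A -> measurable B ->
  P (A `&` Z @^-1` B) = (P A * distribution P Z B)%E.

(** View the identity as a random variable with values in Omega carrying the smaller sigma-algebra.
    Independence of [Z] says that the pair of the two has a product law, and Tonelli freezes the
    first component. *)
Lemma independent_freezing (h : OmegaC * S -> \bar R) :
  measurable_fun setT h -> (forall p, 0 <= h p)%E ->
  (\int[P]_w h (w, Z w) = \int[P]_w \int[distribution P Z]_y h (w, y))%E.
Proof.
move=> mh h0.
pose iC : {RV P >-> OmegaC} := HB.pack (id : Omega -> OmegaC)
  (isMeasurableFun.Build _ _ _ _ _ measurable_g_sigma_id).
have mW : measurable_fun setT (fun w : Omega => (w : OmegaC, Z w)).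
  by apply/measurable_fun_pairP; split; [exact: measurable_g_sigma_id|].
pose W : {RV P >-> (OmegaC * S)%type} := HB.pack (fun w : Omega => (w : OmegaC, Z w))
  (isMeasurableFun.Build _ _ _ _ _ mW).
transitivity (\int[distribution P W]_p h p)%E.
  by rewrite ge0_integral_distribution.
transitivity (\int[(distribution P iC \x distribution P Z)%E]_p h p)%E.
  apply: eq_measure_integral => A mA _; apply/esym.
  exact: product_measure_unique.
rewrite (fubini_tonelli1 h)//= ge0_integral_distribution//.
- exact: measurable_fun_fubini_tonelli_F.
- by move=> w; exact: integral_ge0.
Qed.

End freezing.

Section positions.
Context {R : realType} {d : nat} {dO : measure_display} {Omega : measurableType dO}.
Variable P : probability Omega R.
Variables (T : nat -> {RV P >-> measurableTypeR R}) (X : nat -> {RV P >-> Rspace R d}).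
Hypothesis iidX : iid_uniform_positions T X.
Local Notation Leb := (lebesgue_Rd R).
Local Notation sigT := (generated_sigma_algebra T).

Lemma generated_sigma_algebra_measurable d' (S : measurableType d')
    (Y : nat -> {RV P >-> S}) : generated_sigma_algebra Y `<=` measurable.
Proof.
apply: g_sigma_measurable => A [n _ [B mB <-]].
exact: (measurable_funP (Y n)).
Qed.

Lemma generated_sigma_algebraT d' (S : measurableType d') (Y : nat -> Omega -> S) :
  generated_sigma_algebra Y setT.
Proof. exact: (@measurableT _ (g_sigma_algebraType _)). Qed.

Lemma measurable_generated d' (S : measurableType d') (Y : nat -> Omega -> S) n :
  measurable_fun [set: g_sigma_algebraType (\bigcup_n preimage_set_system setT (Y n) measurable)] (Y n).
Proof. by move=> _ B mB; apply: sub_sigma_algebra; exists n => //; exists B. Qed.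

(* pi-system generating the sigma-algebra of the arrival times and of all
   positions but the k-th *)
Definition cylinders_but (k : nat) : set (set Omega) :=
  [set D | exists A n (B : nat -> set (Rspace R d)),
     [/\ sigT A, forall i, measurable (B i), B k = setT &
         D = A `&` \bigcap_(i < n) (X i @^-1` B i)]].

Lemma cylinders_but_measurable k : cylinders_but k `<=` measurable.
Proof.
move=> _ [A [n [B [sA mB _ ->]]]]; apply: measurableI.
  exact: generated_sigma_algebra_measurable sA.
apply: fin_bigcap_measurable => // i _.
by rewrite -[X in measurable X]setTI; exact: (measurable_funP (X i)).
Qed.

Lemma cylinders_but_setI k : setI_closed (cylinders_but k).
Proof.
move=> _ _ [A [n [B [sA mB Bk ->]]]] [A' [n' [B' [sA' mB' Bk' ->]]]].
exists (A `&` A'), (maxn n n'),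
  (fun i => (if (i < n)%N then B i else setT) `&` (if (i < n')%N then B' i else setT)).
split.
- exact: (@measurableI _ (g_sigma_algebraType _)).
- by move=> i; apply: measurableI; case: ifP.
- by rewrite Bk Bk' !if_same setTI.
- apply/seteqP; split => [w /= [[Aw h] [Aw' h']]|w /= [[Aw Aw'] h]].
    split=> // i _ /=; split; case: ifPn => // hi; [exact: h|exact: h'].
  split; split=> // i /= hi.
    have /= := h i _; rewrite leq_max hi => /(_ isT)[]. by [].
  by have /= := h i _; rewrite leq_max hi orbT => /(_ isT)[].
Qed.

Lemma distribution_position k B : measurable B ->
  distribution P (X k) B = Leb d (B `&` @torus R d).
Proof.
move=> mB.
have mif i : measurable (if i == k then B else setT : set (Rspace R d)) by case: ifP.
have := @iidX setT k.+1 _ (@generated_sigma_algebraT _ _ T) mif.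
rewrite probability_setT mul1e setTI big_ord_recr/= eqxx big1; last first.
  move=> i _; rewrite (ltn_eqF (ltn_ord i)) (setTI (@torus R d)); exact: lebesgue_torus.
rewrite mul1e => <-; congr (P _); apply/seteqP; split => [w Bw i _/=|w].
  by case: ifPn => // /eqP ->.
by move=> /(_ k (ltnSn k)) /=; rewrite eqxx.
Qed.

(** Both sides are finite measures in [A], so it suffices to compare them on the pi-system
    [cylinders_but]. There slot k is free and can be filled with [B]. *)
Lemma position_independent k A B : <<s cylinders_but k >> A -> measurable B ->
  P (A `&` X k @^-1` B) = (P A * distribution P (X k) B)%E.
Proof.
move=> sA mB.
have mXB : measurable (X k @^-1` B).
  by rewrite -[X in measurable X]setTI; exact: (measurable_funP (X k)).
have pfin : distribution P (X k) B \is a fin_num by exact: fin_num_measure.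
pose m1 : {measure set Omega -> \bar R} := mrestr P mXB.
pose m2 : {measure set Omega -> \bar R} :=
  mscale (NngNum (fine_ge0 (measure_ge0 (distribution P (X k)) B))) P.
have -> : (P A * distribution P (X k) B)%E = m2 A.
  by rewrite /m2/= /mscale/= fineK// muleC.
apply: (@g_sigma_algebra_measure_unique _ _ _ (cylinders_but k)
  (@cylinders_but_measurable k) (fun=> setT) _ _ m1 m2 _ _ _ A sA).
- move=> _; exists setT, 0%N, (fun=> setT); split => //.
    exact: generated_sigma_algebraT.
  by rewrite setTI; apply/seteqP; split.
- by apply/seteqP; split => // w _; exists 0%N.
- exact: cylinders_but_setI.
- move=> _ [D [n [B' [sD mB' Bk ->]]]].
  rewrite /m1 /m2/= /mrestr /mscale/= fineK// distribution_position//.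
  (* The conditions are padded with [setT] up to an index beyond k, so that slot k occurs in the
     product even when k >= n. *)
  pose C i := if (i < n)%N then B' i else setT.
  have mC i : measurable (C i) by rewrite /C; case: ifP.
  have Ck : C k = setT by rewrite /C Bk if_same.
  have Cn : D `&` \bigcap_(i < n) X i @^-1` B' i = D `&` \bigcap_(i < maxn n k.+1) X i @^-1` C i.
    congr (_ `&` _); apply/seteqP; split => w /= h i /= hi.
      by rewrite /C; case: ifPn => //; exact: h.
    by have /= := h i; rewrite leq_max hi /C hi; exact.
  have mif i : measurable (if i == k then B else C i) by case: ifP.
  have kM : (k < maxn n k.+1)%N by rewrite leq_max ltnSn orbT.
  rewrite Cn [in RHS]iidX// -setIA.
  rewrite (_ : _ `&` X k @^-1` B =
      \bigcap_(i < maxn n k.+1) X i @^-1` (if i == k then B else C i)); last first.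
    apply/seteqP; split => [w [h Bw] i /= hi|w h].
      by case: ifPn => [/eqP ->//|_]; exact: h.
    split; last by have /= := h k kM; rewrite eqxx.
    by move=> i /= hi; have := h i hi; case: ifPn => //= /eqP ->; rewrite Ck.
  rewrite iidX// (bigD1 (Ordinal kM))//= eqxx [in RHS](bigD1 (Ordinal kM))//= Ck setTI.
  rewrite lebesgue_torus mul1e muleCA; congr (_ * (_ * _))%E.
  by apply: eq_bigr => i /negP ik; case: ifPn => // /eqP ik'; case: ik; apply/eqP/val_inj.
- move=> _; rewrite /m1/= /mrestr setTI.
  by rewrite ltey_eq fin_num_measure.
Qed.

End positions.

(** * Real-valued expectations of bounded measurable functions *)

Section bounded_measurable.
Context {R : realType} {d} {S : measurableType d}.
Implicit Types f g : S -> R.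

(** These functions form an algebra on which expectations are real numbers, so that sums, products
    and linearity need no separate integrability argument. *)
Definition bmf f := measurable_fun setT f /\ exists M, forall w, `|f w| <= M.

Lemma bmf_cst (c : R) : bmf (fun=> c).
Proof. by split => //; exists `|c|. Qed.

Lemma bmfD f g : bmf f -> bmf g -> bmf (fun w => f w + g w).
Proof.
move=> [mf [M fM]] [mg [N gN]]; split; first exact: measurable_funD.
by exists (M + N) => w; rewrite (le_trans (ler_normD _ _))// lerD.
Qed.

Lemma bmfM f g : bmf f -> bmf g -> bmf (fun w => f w * g w).
Proof.
move=> [mf [M fM]] [mg [N gN]]; split; first exact: measurable_funM.
by exists (M * N) => w; rewrite normrM ler_pM.
Qed.

Lemma bmfN f : bmf f -> bmf (fun w => - f w).
Proof.
move=> [mf [M fM]]; split; first exact: measurable_funN.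
by exists M => w; rewrite normrN.
Qed.

Lemma bmfB f g : bmf f -> bmf g -> bmf (fun w => f w - g w).
Proof. by move=> bf bg; apply: bmfD => //; exact: bmfN. Qed.

Lemma bmf_sum I (s : seq I) (Q : pred I) (h : I -> S -> R) :
  (forall i, bmf (h i)) -> bmf (fun w => \sum_(i <- s | Q i) h i w).
Proof.
move=> bh; elim: s => [|i s IH]; first by under eq_fun do rewrite big_nil; exact: bmf_cst.
under eq_fun do rewrite big_cons.
by case: (Q i) => //; exact: bmfD.
Qed.

Lemma bmf_prod I (s : seq I) (h : I -> S -> R) :
  (forall i, bmf (h i)) -> bmf (fun w => \prod_(i <- s) h i w).
Proof.
move=> bh; elim: s => [|i s IH]; first by under eq_fun do rewrite big_nil; exact: bmf_cst.
under eq_fun do rewrite big_cons; exact: bmfM.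
Qed.

Lemma bmf_indic (A : set S) : measurable A -> bmf (\1_A : S -> R).
Proof.
move=> mA; split; first exact: measurable_indic.
by exists 1 => w; rewrite indicE; case: (_ \in _); rewrite ?normr1 ?normr0.
Qed.

Lemma bmf01 f : measurable_fun setT f -> (forall w, 0 <= f w <= 1) -> bmf f.
Proof.
by move=> mf f01; split=> //; exists 1 => w; have /andP[f0 f1] := f01 w; rewrite ger0_norm.
Qed.

Variable P : probability S R.

Definition Ex f : R := (\int[P]_w f w)%R.

Lemma bmf_integrable f : bmf f -> P.-integrable setT (EFin \o f).
Proof.
move=> [mf [M fM]]; apply: measurable_bounded_integrable => //.
  by rewrite -ge0_fin_numE// fin_num_measure.
by exists M; split; [exact: num_real|move=> x Mx w _; exact: le_trans (fM w) (ltW Mx)].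
Qed.

Lemma ExE f : bmf f -> (Ex f)%:E = (\int[P]_w (f w)%:E)%E.
Proof.
by move=> bf; rewrite /Ex /Rintegral fineK//; exact: integrable_fin_num (bmf_integrable bf).
Qed.

Lemma ExD f g : bmf f -> bmf g -> Ex (fun w => f w + g w) = Ex f + Ex g.
Proof. by move=> bf bg; rewrite /Ex RintegralD//; exact: bmf_integrable. Qed.

Lemma ExB f g : bmf f -> bmf g -> Ex (fun w => f w - g w) = Ex f - Ex g.
Proof. by move=> bf bg; rewrite /Ex RintegralB//; exact: bmf_integrable. Qed.

Lemma ExZ c f : bmf f -> Ex (fun w => c * f w) = c * Ex f.
Proof. by move=> bf; rewrite /Ex RintegralZl//; exact: bmf_integrable. Qed.

Lemma Ex_cst c : Ex (fun=> c) = c.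
Proof.
rewrite /Ex Rintegral_cst//; have /= -> := @probability_setT _ _ _ P.
by rewrite mulr1.
Qed.

Lemma Ex_sum I (s : seq I) (Q : pred I) (h : I -> S -> R) :
  (forall i, bmf (h i)) ->
  Ex (fun w => \sum_(i <- s | Q i) h i w) = \sum_(i <- s | Q i) Ex (h i).
Proof.
move=> bh; elim: s => [|i s IH].
  by under eq_fun do rewrite big_nil; rewrite big_nil Ex_cst.
under eq_fun do rewrite big_cons; rewrite big_cons.
by case: (Q i) => //; rewrite ExD// ?IH//; exact: bmf_sum.
Qed.

Lemma Ex_le f g : bmf f -> bmf g -> (forall w, f w <= g w) -> Ex f <= Ex g.
Proof.
by move=> bf bg fg; apply: le_Rintegral => //; exact: bmf_integrable.
Qed.

Lemma Ex_ge0 f : (forall w, 0 <= f w) -> 0 <= Ex f.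
Proof. by move=> f0; apply: Rintegral_ge0. Qed.

Lemma eq_Ex f g : f =1 g -> Ex f = Ex g.
Proof. by move=> fg; rewrite /Ex; apply: eq_Rintegral => w _; exact: fg. Qed.

Lemma Ex_indic A : measurable A -> Ex \1_A = fine (P A).
Proof.
by move=> mA; rewrite /Ex /Rintegral integral_indic// setIT.
Qed.

End bounded_measurable.
Arguments Ex {R d S} P f.

Lemma bmf_g_sigma {R : realType} {d} {S : measurableType d} (C : set (set S)) (f : S -> R) :
  C `<=` measurable -> bmf (f : g_sigma_algebraType C -> R) -> bmf f.
Proof. by move=> mC [mf bf]; split => //; exact: g_sigma_measurable_fun mf. Qed.

Ltac bmf_tac := repeat first [assumption | exact: bmf_cst | apply: bmfB | apply: bmfD | apply: bmfM
  | match goal with H : forall _, _ |- _ => exact: H end].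

Lemma measurable_torus_dist {R : realType} {d} {dS} {S : measurableType dS}
    (f g : S -> Rspace R d) : measurable_fun setT f -> measurable_fun setT g ->
  measurable_fun setT (fun s => torus_dist (f s) (g s)).
Proof.
move=> mf mg; under eq_fun do rewrite torus_distE.
apply: (measurableT_comp (f := @Num.sqrt R)).
  by apply: continuous_measurable_fun; exact: sqrt_continuous.
apply: measurable_sum => i; apply: (measurableT_comp (@measurable_wrap2 R)).
apply: measurable_funB.
  by apply: (measurableT_comp (@measurable_tnth _ _ _ i) mf).
by apply: (measurableT_comp (@measurable_tnth _ _ _ i) mg).
Qed.

(** * Replacing edge indicators by averaged connection probabilities *)

Section conditional_edges.
Context {R : realType} {d : nat} {dO : measure_display} {Omega : measurableType dO}.
Variables (P : probability Omega R) (gamma beta : R) (phi : R -> R).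
Variables (T : nat -> {RV P >-> measurableTypeR R}) (X : nat -> {RV P >-> Rspace R d}).
Variable E : nat -> nat -> set Omega.
Hypotheses (d_gt0 : (0 < d)%N) (phi_profile : profile_function d phi).
Hypotheses (gamma01 : 0 < gamma < 1) (beta0 : 0 < beta).
Hypotheses (iidX : iid_uniform_positions T X)
  (indepE : independent_edges gamma beta phi T X E).
Hypotheses (T_gt0 : forall w, 0 < (T 0%N w : R))
  (T_incr : forall n w, (T n w : R) < T n.+1 w).
Local Notation Leb := (lebesgue_Rd R).
Local Notation genT := (\bigcup_n preimage_set_system setT (T n) measurable).
Local Notation OmegaT := (g_sigma_algebraType genT).
Local Notation OmegaX k := (g_sigma_algebraType (cylinders_but T X k)).
Local Notation q_ r := (edge_mass d phi r).

Lemma arrival_gt0 n w : 0 < (T n w : R).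
Proof. by elim: n => // n; move/lt_trans; exact. Qed.

Lemma arrival_lt i j w : (i < j)%N -> (T i w : R) < T j w.
Proof. by apply: (@homo_ltn _ (fun n => T n w : R) _ lt_trans) => n; exact: T_incr. Qed.

(** The r_ij of the overview, with the powers of the two arrival times separated. *)
Definition rate i j w : R :=
  beta^-1 * ((T j w : R) `^ (1 - gamma) * (T i w : R) `^ gamma).

Definition pedge i j w : R := phi0 phi (rate i j w * torus_dist (X j w) (X i w) ^+ d).

Definition qedge i j w : R := q_ (rate i j w).

Lemma connection_probabilityE i j w :
  connection_probability gamma beta phi (X j w) (T j w) (X i w) (T i w) = pedge i j w.
Proof.
rewrite /connection_probability -phi0E; last first.
  apply: divr_ge0; last by rewrite mulr_ge0 ?powR_ge0 ?(ltW beta0).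
  by rewrite mulr_ge0 ?(ltW (arrival_gt0 _ _))// exprn_ge0// torus_distE sqrtr_ge0.
rewrite /pedge; congr (phi0 _ _); rewrite /rate.
have Ti := arrival_gt0 i w; have Tj := arrival_gt0 j w.
rewrite powRM ?invr_ge0 ?(ltW Ti) ?(ltW Tj)//.
have -> : ((T i w : R)^-1) `^ gamma = ((T i w : R) `^ gamma)^-1.
  by rewrite -powR_inv1 ?(ltW Ti)// -powRrM mulrC powRrM powR_inv1// powR_ge0.
have -> : (T j w : R) `^ (1 - gamma) = T j w / (T j w : R) `^ gamma.
  by rewrite powRB ?powRr1 ?(ltW Tj)//; apply/implyP => _; rewrite gt_eqF.
have g1 : (T j w : R) `^ gamma != 0 by rewrite gt_eqF ?powR_gt0.
have g2 : (T i w : R) `^ gamma != 0 by rewrite gt_eqF ?powR_gt0.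
have b0 : beta != 0 by rewrite gt_eqF.
by field; rewrite g1 g2 b0.
Qed.

Lemma pedge_ge0 i j w : 0 <= pedge i j w.
Proof. exact: phi0_ge0 phi_profile _. Qed.
Lemma pedge_le1 i j w : pedge i j w <= 1.
Proof. exact: phi0_le1 phi_profile _. Qed.
Lemma qedge_ge0 i j w : 0 <= qedge i j w.
Proof. exact: edge_mass_ge0 phi_profile _. Qed.
Lemma qedge_le1 i j w : qedge i j w <= 1.
Proof. exact: edge_mass_le1 phi_profile _. Qed.

Lemma genT_measurable : genT `<=` measurable.
Proof.
by move=> A [n _ [B mB <-]]; exact: (measurable_funP (T n)).
Qed.

Lemma genT_OmegaX k d' (S : measurableType d') (f : Omega -> S) :
  measurable_fun [set: OmegaT] f -> measurable_fun [set: OmegaX k] f.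
Proof.
move=> mf _ B mB; apply: sub_sigma_algebra; exists (setT `&` f @^-1` B), 0%N, (fun=> setT).
split => //; first exact: mf.
by apply/seteqP; split => // w [].
Qed.

Lemma measurable_position k l : l != k -> measurable_fun [set: OmegaX k] (X l).
Proof.
move=> lk _ B mB; apply: sub_sigma_algebra.
exists setT, l.+1, (fun i => if i == l then B else setT); split.
- exact: (@generated_sigma_algebraT _ _ _ _ T).
- by move=> i; case: ifP.
- by rewrite eq_sym (negbTE lk).
- rewrite !setTI; apply/seteqP; split => w /=.
    by move=> Bw i /= _; case: ifPn => // /eqP ->.
  by move=> /(_ l (ltnSn l))/=; rewrite eqxx.
Qed.

Lemma measurable_rate i j : measurable_fun [set: OmegaT] (rate i j).
Proof.
apply: measurable_funM => //; apply: measurable_funM.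
  by apply: (measurableT_comp (measurable_powR _)); exact: measurable_generated.
by apply: (measurableT_comp (measurable_powR _)); exact: measurable_generated.
Qed.

Lemma bmf_qedge i j : bmf (qedge i j : OmegaT -> R).
Proof.
apply: bmf01 => [|w]; last by rewrite qedge_ge0 qedge_le1.
exact: (measurableT_comp (measurable_edge_mass phi_profile) (measurable_rate i j)).
Qed.

Lemma bmf_pedge k i j : i != k -> j != k -> bmf (pedge i j : OmegaX k -> R).
Proof.
move=> ik jk; apply: bmf01 => [|w]; last by rewrite pedge_ge0 pedge_le1.
have m : measurable_fun [set: OmegaX k]
    (fun w => rate i j w * torus_dist (X j w) (X i w) ^+ d).
  apply: measurable_funM; first by apply: genT_OmegaX; exact: measurable_rate.
  by apply: measurable_funX; apply: measurable_torus_dist; exact: measurable_position.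
exact: (measurableT_comp (measurable_phi0 phi_profile) m).
Qed.

Lemma bmfT_X k (f : Omega -> R) : bmf (f : OmegaT -> R) -> bmf (f : OmegaX k -> R).
Proof. by move=> [mf bf]; split => //; exact: genT_OmegaX. Qed.

Lemma bmfT (f : Omega -> R) : bmf (f : OmegaT -> R) -> bmf f.
Proof. exact: bmf_g_sigma genT_measurable. Qed.

Lemma bmfX k (f : Omega -> R) : bmf (f : OmegaX k -> R) -> bmf f.
Proof. exact: bmf_g_sigma (@cylinders_but_measurable _ _ _ _ _ _ _ k). Qed.

Lemma bmf_pedge_Omega i j : bmf (pedge i j : Omega -> R).
Proof.
(* Any index different from both i and j would do. *)
apply: (@bmfX (i + j).+1); apply: bmf_pedge; rewrite ltn_eqF// ltnS.
  exact: leq_addr.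
exact: leq_addl.
Qed.

Lemma ae_position_torus k : P (X k @^-1` (~` @torus R d)) = 0%E.
Proof.
have := distribution_position iidX k (measurableC (@measurable_torus R d)).
by rewrite /distribution /pushforward setICl measure0.
Qed.

Lemma integral_position k (f : Rspace R d -> \bar R) :
  measurable_fun setT f -> (forall y, 0 <= f y)%E ->
  (\int[distribution P (X k)]_y f y = \int[Leb d]_(y in @torus R d) f y)%E.
Proof.
move=> mf f0.
rewrite (@ge0_negligible_integral _ _ _ _ _ (~` @torus R d))//; last 2 first.
- exact: measurableC (@measurable_torus R d).
- exact: ae_position_torus.
rewrite setTD setCK; apply: eq_measure_integral => A mA AT.
have := distribution_position iidX k mA; rewrite (setIidl AT); exact.
Qed.

(** [V], [r] and [X l] are measurable for the sigma-algebra that omits position k, hence are frozen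
    while [X k] is integrated out. By homogeneity the result depends on [r] alone. *)
Lemma peel_position k l (V r : Omega -> R) : l != k ->
  bmf (V : OmegaX k -> R) -> (forall w, 0 <= V w) ->
  measurable_fun [set: OmegaX k] r ->
  Ex P (fun w => V w * phi0 phi (r w * torus_dist (X k w) (X l w) ^+ d)) =
  Ex P (fun w => V w * q_ (r w)).
Proof.
move=> lk bV V0 mr.
have mphi := measurable_phi0 phi_profile.
have mq := measurable_edge_mass phi_profile.
pose h (p : OmegaX k * Rspace R d) : \bar R :=
  (V p.1 * phi0 phi (r p.1 * torus_dist p.2 (X l p.1) ^+ d))%:E.
have mh : measurable_fun setT h.
  apply/measurable_EFinP; apply: measurable_funM.
    exact: (measurableT_comp bV.1 measurable_fst).
  have m : measurable_fun [set: OmegaX k * Rspace R d]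
      (fun p => r p.1 * torus_dist p.2 (X l p.1) ^+ d).
    apply: measurable_funM; first exact: (measurableT_comp mr measurable_fst).
    apply: measurable_funX; apply: measurable_torus_dist => //.
    exact: (measurableT_comp (measurable_position lk) measurable_fst).
  exact: (measurableT_comp mphi m).
have h0 p : (0 <= h p)%E by rewrite lee_fin mulr_ge0// (phi0_ge0 phi_profile).
have bq : bmf (fun w => V w * q_ (r w)).
  apply: bmfM; first exact: bmfX bV.
  apply: (@bmfX k); apply: bmf01 => [|w].
    exact: (measurableT_comp mq mr).
  by rewrite (edge_mass_ge0 phi_profile) (edge_mass_le1 phi_profile).
have bp : bmf (fun w => V w * phi0 phi (r w * torus_dist (X k w) (X l w) ^+ d)).
  apply: bmfM; first exact: bmfX bV.
  apply: bmf01 => [|w]; last by rewrite (phi0_ge0 phi_profile) (phi0_le1 phi_profile).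
  have m : measurable_fun setT (fun w => r w * torus_dist (X k w) (X l w) ^+ d).
    apply: measurable_funM; last by apply: measurable_funX; exact: measurable_torus_dist.
    exact: g_sigma_measurable_fun (@cylinders_but_measurable _ _ _ _ _ _ _ k) _ _ _ mr.
  exact: (measurableT_comp mphi m).
apply: EFin_inj; rewrite !ExE//.
have := independent_freezing (@cylinders_but_measurable _ _ _ _ P T X k)
  (position_independent iidX (k := k)) mh h0.
rewrite /h/= => ->.
apply: ge0_ae_eq_integral => //.
- have m := measurable_fun_fubini_tonelli_F (m2 := distribution P (X k)) h mh h0.
  exact: g_sigma_measurable_fun (@cylinders_but_measurable _ _ _ _ _ _ _ k) _ _ _ m.
- exact/measurable_EFinP/bq.1.
- by move=> w _; apply: integral_ge0 => y _; exact: h0 (w, y).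
- by move=> w _; rewrite lee_fin mulr_ge0// (edge_mass_ge0 phi_profile).
(* Homogeneity is available only for centres in the torus, which [X l] leaves with probability
   zero. *)
exists (X l @^-1` (~` @torus R d)); split.
- rewrite -[X in measurable X]setTI; apply: (measurable_funP (X l)) => //.
  exact: measurableC (@measurable_torus R d).
- exact: ae_position_torus.
move=> w /= hw tw; apply: hw => _.
have mw : measurable_fun setT
    (fun y => (phi0 phi (r w * torus_dist y (X l w) ^+ d))%:E).
  apply/measurable_EFinP.
  have m : measurable_fun [set: Rspace R d] (fun y => r w * torus_dist y (X l w) ^+ d).
    by apply: measurable_funM => //; apply: measurable_funX; exact: measurable_torus_dist.
  exact: (measurableT_comp mphi m).
under eq_integral do rewrite EFinM.
rewrite ge0_integralZl//; last 2 first.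
- by move=> y _; rewrite lee_fin (phi0_ge0 phi_profile).
- by rewrite lee_fin.
rewrite integral_position//; last by move=> y; rewrite lee_fin (phi0_ge0 phi_profile).
by rewrite (torus_dist_edge_mass phi_profile).
Qed.

Lemma peel_pedge_younger i j (V : Omega -> R) : i != j ->
  bmf (V : OmegaX j -> R) -> (forall w, 0 <= V w) ->
  Ex P (fun w => V w * pedge i j w) = Ex P (fun w => V w * qedge i j w).
Proof.
move=> ij bV V0; apply: peel_position => //.
by apply: genT_OmegaX; exact: measurable_rate.
Qed.

(** The distance is symmetric, so the older endpoint can be averaged out as well as the younger
    one. *)
Lemma peel_pedge_older i j (V : Omega -> R) : j != i ->
  bmf (V : OmegaX i -> R) -> (forall w, 0 <= V w) ->
  Ex P (fun w => V w * pedge i j w) = Ex P (fun w => V w * qedge i j w).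
Proof.
move=> ij bV V0; rewrite /pedge; under eq_Ex do rewrite torus_distC.
apply: peel_position => //.
by apply: genT_OmegaX; exact: measurable_rate.
Qed.

Lemma bmf_onem {dS} {S : measurableType dS} (c : R) (f : S -> R) :
  bmf f -> bmf (fun w => 1 - c * f w).
Proof. by move=> bf; apply: bmfB; [exact: bmf_cst|apply: bmfM => //; exact: bmf_cst]. Qed.

(** * Factorisation of products over one and two stars *)

Section decoupling.
Variables (c : R) (p q : nat -> nat -> Omega -> R).
Hypotheses (c01 : 0 <= c <= 1) (p01 : forall i j w, 0 <= p i j w <= 1)
  (q01 : forall i j w, 0 <= q i j w <= 1)
  (bmf_p : forall k i j, i != k -> j != k -> bmf (p i j : OmegaX k -> R))
  (bmf_q : forall i j, bmf (q i j : OmegaT -> R))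
  (p_younger : forall i j (V : Omega -> R), i != j ->
    bmf (V : OmegaX j -> R) -> (forall w, 0 <= V w) ->
    Ex P (fun w => V w * p i j w) = Ex P (fun w => V w * q i j w))
  (p_older : forall i j (V : Omega -> R), j != i ->
    bmf (V : OmegaX i -> R) -> (forall w, 0 <= V w) ->
    Ex P (fun w => V w * p i j w) = Ex P (fun w => V w * q i j w)).

Let p_ge0 i j w : 0 <= p i j w. Proof. by case/andP: (p01 i j w). Qed.
Let q_ge0 i j w : 0 <= q i j w. Proof. by case/andP: (q01 i j w). Qed.

Let bmf_pO i j : bmf (p i j : Omega -> R).
Proof.
apply: (@bmfX (i + j).+1); apply: bmf_p; rewrite ltn_eqF// ltnS.
  exact: leq_addr.
exact: leq_addl.
Qed.

Lemma onem01 (x : R) : 0 <= x <= 1 -> 0 <= 1 - c * x <= 1.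
Proof. by move: c01 => /andP[? ?] /andP[? ?]; apply/andP; split; nra. Qed.

Definition pprod i a n w : R := \prod_(a <= j < n) (1 - c * p i j w).
Definition qprod i a n w : R := \prod_(a <= j < n) (1 - c * q i j w).

Lemma pprod01 i a n w : 0 <= pprod i a n w <= 1.
Proof.
rewrite prodr_ge0/=; last first.
  by move=> j _; have /andP[] := onem01 (p01 i j w).
apply: prodr_ile1 => j _.
exact: onem01 (p01 i j w).
Qed.

Lemma qprod01 i a n w : 0 <= qprod i a n w <= 1.
Proof.
rewrite prodr_ge0/=; last first.
  by move=> j _; have /andP[] := onem01 (q01 i j w).
apply: prodr_ile1 => j _.
exact: onem01 (q01 i j w).
Qed.

Lemma bmf_pprod k i a n : i != k -> (n <= k)%N -> bmf (pprod i a n : OmegaX k -> R).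
Proof.
move=> ik nk; rewrite /pprod.
(* [bmf_prod] asks for every factor to be measurable without position k. Factors with j >= k are
   replaced by 1, and the range never reaches them. *)
rewrite (_ : (fun w => _) =
    (fun w => \prod_(j <- index_iota a n) (if (j < k)%N then 1 - c * p i j w else 1))).
  apply: bmf_prod => j; case: (ltnP j k) => jk; last exact: bmf_cst.
  by apply: bmf_onem; apply: bmf_p => //; rewrite ltn_eqF.
apply/funext => w; rewrite big_seq [in RHS]big_seq; apply: eq_bigr => j.
by rewrite mem_index_iota => /andP[_ jn]; rewrite (leq_trans jn).
Qed.

Lemma bmf_qprod i a n : bmf (qprod i a n : OmegaT -> R).
Proof. by apply: bmf_prod => j; apply: bmf_onem; exact: bmf_q. Qed.

(** The position of the youngest vertex occurs in a single factor and is averaged out first. The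
    resulting factor depends on the arrival times only and is absorbed into the weight, which is why
    the induction runs over all [W]. *)
Lemma Ex_pprod i n (W : Omega -> R) :
  bmf (W : OmegaT -> R) -> (forall w, 0 <= W w) ->
  Ex P (fun w => W w * pprod i i.+1 n w) = Ex P (fun w => W w * qprod i i.+1 n w).
Proof.
elim: n W => [|n IH] W bW W0; first by rewrite /pprod/qprod; under eq_Ex do rewrite big_geq//; under [RHS]eq_Ex do rewrite big_geq//.
have [ni|ni] := leqP n i.
  by rewrite /pprod/qprod; under eq_Ex do rewrite big_geq//; under [RHS]eq_Ex do rewrite big_geq//.
pose V w := W w * pprod i i.+1 n w.
have bV : bmf (V : OmegaX n -> R).
  by apply: bmfM; [exact: bmfT_X|apply: bmf_pprod => //; rewrite ltn_eqF].
have bp := bmf_pO i n.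
have bq := bmfT (bmf_q i n).
transitivity (Ex P (fun w => V w - c * (V w * p i n w))).
  by apply: eq_Ex => w; rewrite /V /pprod big_nat_recr//=; ring.
have V0 w : 0 <= V w by rewrite mulr_ge0//; case/andP: (pprod01 i i.+1 n w).
have bV' : bmf V by exact: bmfX bV.
rewrite ExB ?ExZ//; [|exact: bmfM|apply: bmfM; [exact: bmf_cst|exact: bmfM]].
rewrite p_younger//; last by rewrite ltn_eqF.
rewrite -ExZ; last exact: bmfM.
rewrite -ExB//; last by apply: bmfM; [exact: bmf_cst|exact: bmfM].
transitivity (Ex P (fun w => (W w * (1 - c * q i n w)) * pprod i i.+1 n w)).
  by apply: eq_Ex => w; rewrite /V; ring.
rewrite IH.
- by apply: eq_Ex => w; rewrite /qprod [in RHS]big_nat_recr//=; ring.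
- by apply: bmfM => //; apply: bmf_onem; exact: bmf_q.
- move=> w; rewrite mulr_ge0//.
  by have /andP[] := onem01 (q01 i n w).
Qed.

(** The two edges form a path. Its endpoint i' occurs in one factor only, and once it has been
    averaged out, so does j. *)
Lemma Ex_p2 i i' j (W : Omega -> R) : (i < i')%N -> (i' < j)%N ->
  bmf (W : OmegaT -> R) -> (forall w, 0 <= W w) ->
  Ex P (fun w => W w * (p i j w * p i' j w)) =
  Ex P (fun w => W w * (q i j w * q i' j w)).
Proof.
move=> ii' ij bW W0.
transitivity (Ex P (fun w => (W w * p i j w) * p i' j w)).
  by apply: eq_Ex => w; rewrite mulrA.
rewrite p_older ?gtn_eqF//; last 2 first.
- apply: bmfM; first exact: bmfT_X.
  by apply: bmf_p; rewrite ?(gtn_eqF ij)// (ltn_eqF ii').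
- by move=> w; rewrite mulr_ge0// p_ge0.
transitivity (Ex P (fun w => (W w * q i' j w) * p i j w)).
  by apply: eq_Ex => w; rewrite mulrAC.
rewrite p_younger ?(ltn_eqF (ltn_trans ii' ij))//; last 2 first.
- by apply: bmfT_X; apply: bmfM => //; exact: bmf_q.
- by move=> w; rewrite mulr_ge0// q_ge0.
by apply: eq_Ex => w; rewrite mulrA mulrAC.
Qed.

(* Averaging over the positions of the two older vertices decouples a common
   younger neighbour, so only the probability of having one matters. *)
Lemma Ex_pprod2 i i' n (W : Omega -> R) : (i < i')%N -> (i' < n)%N ->
  bmf (W : OmegaT -> R) -> (forall w, 0 <= W w) ->
  Ex P (fun w => W w * (pprod i i.+1 n w * pprod i' i'.+1 n w)) <=
  Ex P (fun w => W w * (qprod i i.+1 n w * qprod i' i'.+1 n w)) +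
  Ex P (fun w => W w * \sum_(i'.+1 <= j < n) q i j w * q i' j w).
Proof.
move=> ii' i'n; elim: n i'n W => // n IH; rewrite ltnS leq_eqVlt => /orP[/eqP <-|i'n] W bW W0.
  rewrite -[leLHS]addr0 lerD//; last first.
    by apply: Ex_ge0 => w; rewrite big_geq// mulr0.
  have -> : Ex P (fun w => W w * (pprod i i.+1 i'.+1 w * pprod i' i'.+1 i'.+1 w)) =
      Ex P (fun w => W w * pprod i i.+1 i'.+1 w).
    by apply: eq_Ex => w; rewrite [X in _ * (_ * X)]/pprod big_geq// mulr1.
  rewrite Ex_pprod// le_eqVlt; apply/orP; left; apply/eqP.
  by apply: eq_Ex => w; rewrite [X in _ * (_ * X)]/qprod big_geq// mulr1.
have ini : (i < n)%N by exact: ltn_trans i'n.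
pose V w := W w * (pprod i i.+1 n w * pprod i' i'.+1 n w).
have q01' l w := onem01 (q01 l n w).
have pp01 l w := pprod01 l l.+1 n w.
have bVX : bmf (V : OmegaX n -> R).
  apply: bmfM; first exact: bmfT_X.
  by apply: bmfM; apply: bmf_pprod => //; rewrite ltn_eqF.
have bV : bmf V by exact: bmfX bVX.
have bWO : bmf W by exact: bmfT bW.
have bp l : bmf (p l n) by exact: bmf_pO.
have bq l : bmf (q l n) by exact: bmfT (bmf_q l n).
have V0 w : 0 <= V w.
  by rewrite !mulr_ge0//; [case/andP: (pp01 i w)|case/andP: (pp01 i' w)].
have VW w : V w <= W w.
  rewrite ler_piMr//; have /andP[? ?] := pp01 i w; have /andP[? ?] := pp01 i' w.
  exact: mulr_ile1.
(* Of the four terms of the last two factors, those of degree at most one in the edges to n decouple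
   exactly; only the quadratic one contains a common neighbour. *)
have -> : Ex P (fun w => W w * (pprod i i.+1 n.+1 w * pprod i' i'.+1 n.+1 w)) =
    Ex P (fun w => V w - c * (V w * p i n w) - c * (V w * p i' n w) +
      c ^+ 2 * (V w * (p i n w * p i' n w))).
  apply: eq_Ex => w; rewrite /V /pprod !(big_nat_recr n)//=.
  by move: (p i n w) (p i' n w) => a b; ring.
have bc (x : R) : bmf (fun _ : Omega => x) by exact: bmf_cst.
(* The linear terms are completed to the averaged product by adding a nonnegative quadratic term. In
   the true quadratic term V is bounded by W, after which only a path is left and [Ex_p2]
   applies. *)
have step : Ex P (fun w => V w - c * (V w * p i n w) - c * (V w * p i' n w) +
      c ^+ 2 * (V w * (p i n w * p i' n w))) <=
    Ex P (fun w => V w * ((1 - c * q i n w) * (1 - c * q i' n w))) +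
    Ex P (fun w => W w * (q i n w * q i' n w)).
  rewrite ExD ?ExB ?ExZ; try by bmf_tac.
  rewrite !p_younger ?ltn_eqF// -Ex_p2//.
  rewrite -!ExZ; try by bmf_tac.
  rewrite -!ExB; try by bmf_tac.
  have /andP[c0 c1] := c01.
  apply: lerD; (apply: Ex_le; [by bmf_tac|by bmf_tac|move=> w]).
    have := q_ge0 i n w; have := q_ge0 i' n w.
    move: (q i n w) (q i' n w) => a b b0 a0.
    rewrite -subr_ge0 (_ : _ - _ = c ^+ 2 * (V w * (b * a))); last ring.
    by apply: mulr_ge0; [exact: sqr_ge0|apply: mulr_ge0 => //; exact: mulr_ge0].
  have pp0 : 0 <= p i n w * p i' n w by rewrite mulr_ge0 ?p_ge0.
  apply: (@le_trans _ _ (V w * (p i n w * p i' n w))).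
    by rewrite ler_piMl ?expr_le1// mulr_ge0.
  by rewrite ler_wpM2r.
apply: (le_trans step).
(* The averaged factors of vertex n are functions of the arrival times and join the weight. *)
have {}IH := IH i'n (fun w => W w * ((1 - c * q i n w) * (1 - c * q i' n w))).
have -> : Ex P (fun w => V w * ((1 - c * q i n w) * (1 - c * q i' n w))) =
    Ex P (fun w => W w * ((1 - c * q i n w) * (1 - c * q i' n w)) *
      (pprod i i.+1 n w * pprod i' i'.+1 n w)).
  by apply: eq_Ex => w; rewrite /V mulrAC.
have bqp l : bmf (qprod l l.+1 n) by exact: bmfT (bmf_qprod _ _ _).
have bqq l j : bmf (q l j) by exact: bmfT (bmf_q l j).
have bS : bmf (fun w => \sum_(i'.+1 <= j < n) q i j w * q i' j w).
  by apply: bmf_sum => j; exact: bmfM.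
apply: (@le_trans _ _ (Ex P (fun w => W w * ((1 - c * q i n w) * (1 - c * q i' n w)) *
       (qprod i i.+1 n w * qprod i' i'.+1 n w)) +
   Ex P (fun w => W w * \sum_(i'.+1 <= j < n) q i j w * q i' j w) +
   Ex P (fun w => W w * (q i n w * q i' n w)))).
  rewrite lerD2r; apply: (le_trans (IH _ _)).
  - by apply: bmfM => //; apply: bmfM; apply: bmf_onem; exact: bmf_q.
  - by move=> w; rewrite !mulr_ge0//; [case/andP: (q01' i w)|case/andP: (q01' i' w)].
  rewrite lerD2l; apply: Ex_le => [| |w].
  - by apply: bmfM => //; apply: bmfM => //; apply: bmfM; apply: bmf_onem.
  - exact: bmfM.
  - rewrite -mulrA ler_wpM2l// ler_piMl//.
      by apply: sumr_ge0 => j _; rewrite mulr_ge0 ?q_ge0.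
    have /andP[? ?] := q01' i w; have /andP[? ?] := q01' i' w.
    exact: mulr_ile1.
rewrite -addrA lerD// le_eqVlt; apply/orP; left; apply/eqP.
  apply: eq_Ex => w; rewrite /qprod !(big_nat_recr n)//=.
  by move: (q i n w) (q i' n w) => a b; ring.
rewrite -ExD; [|exact: bmfM|by apply: bmfM => //; exact: bmfM].
by apply: eq_Ex => w; rewrite (big_nat_recr n)//= mulrDr.
Qed.

End decoupling.

Definition eprod c i a n (w : Omega) : R := \prod_(a <= j < n) (1 - c * (\1_(E i j) w : R)).

Lemma sigT_sigXT A : generated_sigma_algebra T A ->
  generated_sigma_algebra (fun n w => (X n w, T n w)) A.
Proof.
move: A; apply: smallest_sub; first exact: smallest_sigma_algebra.
move=> B [n _ [D mD <-]]; apply: sub_sigma_algebra.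
exists n => //; exists (setT `*` D); first exact: measurableX.
by apply/seteqP; split => [w [_ [_ Dw]]|w [_ Dw]].
Qed.

Lemma prod_indic (F : seq (nat * nat)) (w : Omega) :
  \prod_(e <- F) (\1_(E e.1 e.2) w : R) = \1_(\bigcap_(e in [set` F]) E e.1 e.2) w.
Proof.
elim: F => [|e F IH].
  by rewrite big_nil indicE mem_set// => e /=; rewrite in_nil.
rewrite big_cons IH -[_ * _]/((\1_(E e.1 e.2) \* \1__) w) -indicI.
congr (\1__ w); apply/seteqP; split => [x [xe h] e'/=|x h].
  by rewrite inE => /orP[/eqP ->|eF] //; exact: h.
split; first by apply: (h e); rewrite /= inE eqxx.
by move=> e' /= eF; apply: (h e'); rewrite /= inE eF orbT.
Qed.

Lemma Ex_edges (F : seq (nat * nat)) A : generated_sigma_algebra T A ->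
  uniq F -> (forall e, e \in F -> (e.1 < e.2)%N) ->
  Ex P (fun w => \1_A w * \prod_(e <- F) (\1_(E e.1 e.2) w : R)) =
  Ex P (fun w => \1_A w * \prod_(e <- F) pedge e.1 e.2 w).
Proof.
move=> sA uF oF.
have mA : measurable A by exact: generated_sigma_algebra_measurable sA.
have mE : measurable (\bigcap_(e in [set` F]) E e.1 e.2).
  by apply: fin_bigcap_measurable => // e eF; apply: (indepE.1); exact: oF.
have h : P (A `&` \bigcap_(e in [set` F]) E e.1 e.2) =
    (\int[P]_(w in A) (\prod_(e <- F) pedge e.1 e.2 w)%:E)%E.
  rewrite (indepE.2 A F (sigT_sigXT sA) uF oF); apply: eq_integral => w _.
  by congr (_%:E); apply: eq_bigr => e _; rewrite connection_probabilityE.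
have -> : Ex P (fun w => \1_A w * \prod_(e <- F) (\1_(E e.1 e.2) w : R)) =
    Ex P (\1_(A `&` \bigcap_(e in [set` F]) E e.1 e.2)).
  by apply: eq_Ex => w; rewrite prod_indic indicI.
rewrite Ex_indic; last exact: measurableI.
rewrite h /Ex /Rintegral; congr fine.
rewrite [LHS]integral_mkcond; apply: eq_integral => w _.
rewrite patchE indicE; case: (w \in A); first by rewrite mul1r.
by rewrite mul0r.
Qed.

Lemma bmf_E i j : (i < j)%N -> bmf (\1_(E i j) : Omega -> R).
Proof. by move=> ij; apply: bmf_indic; exact: indepE.1. Qed.

(** Inclusion-exclusion: independence is given for intersections of edge events. Expanding one
    factor 1 - c 1_E of [F2] either drops the edge or moves it to [F1]. *)
Lemma Ex_edges_onem c (F1 F2 : seq (nat * nat)) A : generated_sigma_algebra T A ->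
  uniq (F1 ++ F2) -> (forall e, e \in F1 ++ F2 -> (e.1 < e.2)%N) ->
  Ex P (fun w => \1_A w * \prod_(e <- F1) (\1_(E e.1 e.2) w : R) *
    \prod_(e <- F2) (1 - c * (\1_(E e.1 e.2) w : R))) =
  Ex P (fun w => \1_A w * \prod_(e <- F1) pedge e.1 e.2 w *
    \prod_(e <- F2) (1 - c * pedge e.1 e.2 w)).
Proof.
move=> sA; elim: F2 F1 => [|e F2 IH] F1 uF oF.
  under eq_Ex do rewrite big_nil mulr1; under [RHS]eq_Ex do rewrite big_nil mulr1.
  by rewrite cats0 in uF oF; exact: Ex_edges.
have mA : measurable A by exact: generated_sigma_algebra_measurable sA.
have bc (x : R) : bmf (fun _ : Omega => x) by exact: bmf_cst.
have bA : bmf (\1_A : Omega -> R) by exact: bmf_indic.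
have bprod (F : seq (nat * nat)) (h : nat * nat -> Omega -> R) :
    (forall e, e \in F -> bmf (h e)) -> bmf (fun w => \prod_(e <- F) h e w).
  elim: F => [|f F IHF] hF; first by under eq_fun do rewrite big_nil; exact: bc.
  under eq_fun do rewrite big_cons; apply: bmfM; first by apply: hF; rewrite inE eqxx.
  by apply: IHF => e' e'F; apply: hF; rewrite inE e'F orbT.
have bE f : f \in F1 ++ e :: F2 -> bmf (\1_(E f.1 f.2) : Omega -> R).
  by move=> fF; apply: bmf_E; exact: oF.
have bE1 : bmf (fun w => \prod_(e <- F1) (\1_(E e.1 e.2) w : R)).
  by apply: bprod => f fF; apply: bE; rewrite mem_cat fF.
have bE2 : bmf (fun w => \prod_(e <- F2) (1 - c * (\1_(E e.1 e.2) w : R))).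
  by apply: bprod => f fF; apply: bmf_onem; apply: bE; rewrite mem_cat inE fF !orbT.
have bEe : bmf (\1_(E e.1 e.2) : Omega -> R) by apply: bE; rewrite mem_cat inE eqxx orbT.
have bP1 : bmf (fun w => \prod_(e <- F1) pedge e.1 e.2 w).
  by apply: bprod => f fF; exact: bmf_pedge_Omega.
have bP2 : bmf (fun w => \prod_(e <- F2) (1 - c * pedge e.1 e.2 w)).
  by apply: bprod => f fF; apply: bmf_onem; exact: bmf_pedge_Omega.
have bPe : bmf (pedge e.1 e.2) by exact: bmf_pedge_Omega.
pose a w := \1_A w * \prod_(e <- F1) (\1_(E e.1 e.2) w : R) *
    \prod_(e <- F2) (1 - c * (\1_(E e.1 e.2) w : R)).
pose b w := \1_A w * \prod_(f <- e :: F1) (\1_(E f.1 f.2) w : R) *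
    \prod_(e <- F2) (1 - c * (\1_(E e.1 e.2) w : R)).
pose a' w := \1_A w * \prod_(e <- F1) pedge e.1 e.2 w *
    \prod_(e <- F2) (1 - c * pedge e.1 e.2 w).
pose b' w := \1_A w * \prod_(f <- e :: F1) pedge f.1 f.2 w *
    \prod_(e <- F2) (1 - c * pedge e.1 e.2 w).
have ba : bmf a by do 2![apply: bmfM => //].
have ba' : bmf a' by do 2![apply: bmfM => //].
have bb : bmf b.
  do 2![apply: bmfM => //]; under eq_fun do rewrite big_cons; exact: bmfM.
have bb' : bmf b'.
  do 2![apply: bmfM => //]; under eq_fun do rewrite big_cons; exact: bmfM.
transitivity (Ex P (fun w => a w - c * b w)).
  apply: eq_Ex => w; rewrite /a /b !big_cons.
  by move: (\1_A w) (\1_(E _ _) w) (\prod_(_ <- _) _) (\prod_(_ <- _) _) => x1 x2 x3 x4; ring.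
transitivity (Ex P (fun w => a' w - c * b' w)); last first.
  apply: eq_Ex => w; rewrite /a' /b' !big_cons.
  by move: (\1_A w) (pedge _ _ w) (\prod_(_ <- _) _) (\prod_(_ <- _) _) => x1 x2 x3 x4; ring.
have bcM (h : Omega -> R) : bmf h -> bmf (fun w => c * h w) by move=> bh; exact: bmfM.
rewrite !ExB ?ExZ//; try exact: bcM.
have perm : perm_eq (F1 ++ e :: F2) ((e :: F1) ++ F2) by rewrite -cat1s -[e :: F1]cat1s -catA perm_catCA.
congr (_ - c * _).
  apply: IH; first by move: uF; rewrite (perm_uniq perm) /= => /andP[].
  by move=> f fF; apply: oF; rewrite (perm_mem perm) inE fF orbT.
apply: IH; first by rewrite -(perm_uniq perm).
by move=> f; rewrite -(perm_mem perm); exact: oF.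
Qed.

Lemma eprod_seq c i a n w :
  eprod c i a n w = \prod_(e <- [seq (i, j) | j <- index_iota a n]) (1 - c * (\1_(E e.1 e.2) w : R)).
Proof. by rewrite big_map. Qed.

Lemma pprod_seq c i a n w :
  pprod c pedge i a n w = \prod_(e <- [seq (i, j) | j <- index_iota a n]) (1 - c * pedge e.1 e.2 w).
Proof. by rewrite big_map. Qed.

Lemma edge_seq_uniq i n : uniq [seq (i, j) | j <- index_iota i.+1 n].
Proof. by rewrite map_inj_uniq ?iota_uniq// => j k []. Qed.

Lemma edge_seq_lt i n e : e \in [seq (i, j) | j <- index_iota i.+1 n] -> (e.1 < e.2)%N.
Proof. by move=> /mapP[j]; rewrite mem_index_iota => /andP[ij _] ->. Qed.

Lemma pedge01 i j w : 0 <= pedge i j w <= 1.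
Proof. by rewrite pedge_ge0 pedge_le1. Qed.

Lemma qedge01 i j w : 0 <= qedge i j w <= 1.
Proof. by rewrite qedge_ge0 qedge_le1. Qed.

Lemma bmf_sigT A : generated_sigma_algebra T A -> bmf (\1_A : OmegaT -> R).
Proof. by move=> sA; exact: (@bmf_indic _ _ OmegaT). Qed.

Lemma Ex_edge i j A : (i < j)%N -> generated_sigma_algebra T A ->
  Ex P (fun w => \1_A w * \1_(E i j) w) = Ex P (fun w => \1_A w * qedge i j w).
Proof.
move=> ij sA.
transitivity (Ex P (fun w => \1_A w * pedge i j w)).
  have h : forall e, e \in [:: (i, j)] -> (e.1 < e.2)%N by move=> e; rewrite inE => /eqP ->.
  have {h} := @Ex_edges [:: (i, j)] A sA isT h.
  under eq_Ex do rewrite big_seq1.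
  by under [X in _ = X -> _]eq_Ex do rewrite big_seq1.
apply: peel_pedge_younger; first by rewrite ltn_eqF.
  by apply: bmfT_X; exact: bmf_sigT.
by move=> w; rewrite indicE.
Qed.

Lemma Ex_eprod c i n A : 0 <= c <= 1 -> generated_sigma_algebra T A ->
  Ex P (fun w => \1_A w * eprod c i i.+1 n w) =
  Ex P (fun w => \1_A w * qprod c qedge i i.+1 n w).
Proof.
move=> c01 sA.
transitivity (Ex P (fun w => \1_A w * pprod c pedge i i.+1 n w)).
  have := @Ex_edges_onem c [::] _ A sA (edge_seq_uniq i n) (@edge_seq_lt i n).
  under eq_Ex do rewrite big_nil mulr1 -eprod_seq.
  by under [X in _ = X -> _]eq_Ex do rewrite big_nil mulr1 -pprod_seq.
apply: (Ex_pprod c01 pedge01 qedge01 bmf_pedge bmf_qedge peel_pedge_younger).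
  exact: bmf_sigT.
by move=> w; rewrite indicE.
Qed.

Lemma Ex_eprod2 c i i' n A : 0 <= c <= 1 -> (i < i')%N -> (i' < n)%N ->
  generated_sigma_algebra T A ->
  Ex P (fun w => \1_A w * (eprod c i i.+1 n w * eprod c i' i'.+1 n w)) <=
  Ex P (fun w => \1_A w * (qprod c qedge i i.+1 n w * qprod c qedge i' i'.+1 n w)) +
  Ex P (fun w => \1_A w * \sum_(i'.+1 <= j < n) qedge i j w * qedge i' j w).
Proof.
move=> c01 ii' i'n sA.
have -> : Ex P (fun w => \1_A w * (eprod c i i.+1 n w * eprod c i' i'.+1 n w)) =
    Ex P (fun w => \1_A w * (pprod c pedge i i.+1 n w * pprod c pedge i' i'.+1 n w)).
  have u : uniq ([seq (i, j) | j <- index_iota i.+1 n] ++ [seq (i', j) | j <- index_iota i'.+1 n]).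
    rewrite cat_uniq !edge_seq_uniq andbT/=; apply/hasPn => e /mapP[j _ ->].
    by apply/mapP => -[j' _ [/eqP]]; rewrite gtn_eqF.
  have l e : e \in [seq (i, j) | j <- index_iota i.+1 n] ++ [seq (i', j) | j <- index_iota i'.+1 n] ->
      (e.1 < e.2)%N.
    by rewrite mem_cat => /orP[]; exact: edge_seq_lt.
  have := @Ex_edges_onem c [::] _ A sA u l.
  under eq_Ex do rewrite big_nil mulr1 big_cat/= -!eprod_seq.
  by under [X in _ = X -> _]eq_Ex do rewrite big_nil mulr1 big_cat/= -!pprod_seq.
apply: (Ex_pprod2 c01 pedge01 qedge01 bmf_pedge bmf_qedge peel_pedge_younger peel_pedge_older) => //.
exact: bmf_sigT.
Qed.

End conditional_edges.

(** * Asymptotics of the arrival times *)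

Section exponential_bounds.
Variable R : realType.
Implicit Types (t x : R) (k n : nat).

Lemma exp_partial_le t n : 0 <= t -> \sum_(0 <= j < n) t ^+ j / j`!%:R <= expR t.
Proof.
move=> t0; apply: (@nondecreasing_cvgn_le _ (series (exp_coeff t))).
  by apply: nondecreasing_series => j _ _; exact: exp_coeff_ge0.
exact: is_cvg_series_exp_coeff.
Qed.

(** Chernoff bound for the lower Poisson tail: x^k <= x^j for j <= k and x <= 1. *)
Lemma exp_head_le t x k : 0 <= t -> 0 <= x <= 1 ->
  x ^+ k * (\sum_(0 <= j < k.+1) t ^+ j / j`!%:R) <= expR (x * t).
Proof.
move=> t0 /andP[x0 x1]; apply: le_trans (exp_partial_le k.+1 _); last exact: mulr_ge0.
rewrite mulr_sumr !big_mkord; apply: ler_sum => j _.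
rewrite exprMn mulrA; apply: ler_wpM2r; first by rewrite invr_ge0.
rewrite ler_wpM2r ?exprn_ge0//; apply: ler_wiXn2l => //.
by rewrite -ltnS.
Qed.

(** Chernoff bound for the upper Poisson tail: x^k <= x^j for j > k and x >= 1. *)
Lemma exp_tail_le t x k : 0 <= t -> 1 <= x ->
  x ^+ k * (expR t - \sum_(0 <= j < k.+1) t ^+ j / j`!%:R) <= expR (x * t).
Proof.
move=> t0 x1; have x0 : 0 < x by exact: lt_le_trans x1.
have xk : 0 < x ^+ k by exact: exprn_gt0.
rewrite mulrC -ler_pdivlMr// lerBlDr /expR.
apply: limr_le; first exact: is_cvg_series_exp_coeff.
exists k.+1 => // n /= kn; rewrite /series/= (big_cat_nat (n := k.+1))//= addrC lerD2r.
rewrite ler_pdivlMr// mulr_suml.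
apply: (@le_trans _ _ (\sum_(k.+1 <= j < n) (x * t) ^+ j / j`!%:R)).
  apply: ler_sum_nat => j /andP[kj _]; rewrite exprMn mulrC mulrA.
  apply: ler_wpM2r; first by rewrite invr_ge0.
  by rewrite ler_wpM2r ?exprn_ge0// ler_weXn2l// ltnW.
apply: le_trans (exp_partial_le n _); last by rewrite mulr_ge0// ltW.
rewrite [leRHS](big_cat_nat (n := k.+1))//= lerDr sumr_ge0// => j _.
by rewrite mulr_ge0 ?invr_ge0// exprn_ge0// mulr_ge0// ltW.
Qed.

End exponential_bounds.

Section arrival_times.
Context {R : realType} {dO : measure_display} {Omega : measurableType dO}.
Variable P : probability Omega R.
Variable T : nat -> {RV P >-> measurableTypeR R}.
Hypothesis poissonT : unit_poisson_process T.

Let T_gt0 w : 0 < (T 0%N w : R). Proof. by case: poissonT => + _ _; exact. Qed.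
Let T_incr n w : (T n w : R) < T n.+1 w. Proof. by case: poissonT => _ + _; exact. Qed.

Lemma arrival_le i j w : (i <= j)%N -> (T i w : R) <= T j w.
Proof.
by rewrite leq_eqVlt => /orP[/eqP ->//|/(arrival_lt T_incr w)/ltW].
Qed.

Lemma measurable_arrival_gt k (t : R) : measurable [set w | t < (T k w : R)].
Proof.
rewrite (_ : [set w | _] = T k @^-1` `]t, +oo[).
  by rewrite -[X in measurable X]setTI; exact: (measurable_funP (T k)).
by apply/seteqP; split => w /=; rewrite in_itv/= andbT.
Qed.

(** Arrivals are numbered from 0, so [T k] is the first one after t precisely when k of them have
    occurred. *)
Lemma arrival_count k (t : R) w :
  ([set n | 0 < (T n w : R) <= t] #= `I_k)%card <->
  t < T k w /\ (forall j, (j < k)%N -> (T j w : R) <= t).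
Proof.
have -> : [set n | 0 < (T n w : R) <= t] = [set n | (T n w : R) <= t].
  by apply/seteqP; split => n /=; rewrite (arrival_gt0 T_gt0 T_incr).
split=> [cS|[tk h]]; last first.
  rewrite (_ : [set n | _] = `I_k) //; apply/seteqP; split => n /=; last exact: h.
  by rewrite ltnNge => nt; apply/negP => kn; have := le_lt_trans nt tk; rewrite ltNge arrival_le.
have sub m : (T m w : R) <= t -> (m < k)%N.
  move=> mt; have : (`I_m.+1 #<= `I_k)%card.
    rewrite -(card_le_eqr cS) subset_card_le// => n /= nm.
    by rewrite (le_trans _ mt)// arrival_le.
  by rewrite card_le_II.
split; first by rewrite ltNge; apply/negP => /sub; rewrite ltnn.
move=> j jk; rewrite leNgt; apply/negP => tj.
have : (`I_k #<= `I_j)%card.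
  rewrite -(card_le_eql cS) subset_card_le// => n /= nt.
  by rewrite ltnNge; apply/negP => jn; have := lt_le_trans tj (arrival_le w jn); rewrite ltNge nt.
by rewrite card_le_II leqNgt jk.
Qed.

Lemma arrival_poisson k (t : R) : 0 < t ->
  P [set w | t < T k w /\ (forall j, (j < k)%N -> (T j w : R) <= t)] =
  (poisson_pmf t k)%:E.
Proof.
move=> t0; have [_ _ /(_ 1%N (fun i => if i == 0%N then 0 else t) (fun=> k))] := poissonT.
rewrite /= lexx => /(_ isT) /(_ _)/=; rewrite big_ord1 /= subr0 => <-; last by case.
congr (P _); apply/seteqP; split => [w /arrival_count h i /=|w].
  by case: i.
by move=> /(_ 0%N isT) /= /arrival_count.
Qed.

Lemma arrival_gt_prob k (t : R) : 0 < t ->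
  P [set w | t < T k w] = (\sum_(0 <= j < k.+1) poisson_pmf t j)%:E.
Proof.
move=> t0; elim: k => [|k IH].
  rewrite big_nat1 -arrival_poisson//; congr (P _).
  by apply/seteqP; split => [w /= ?|w []].
pose C := [set w | t < T k.+1 w /\ (forall j, (j < k.+1)%N -> (T j w : R) <= t)].
rewrite (_ : [set w | _] = [set w | t < T k w] `|` C).
  rewrite measureU.
  - rewrite [in RHS]big_nat_recr//= EFinD; congr (_ + _)%E; first exact: IH.
    exact: arrival_poisson.
  - exact: measurable_arrival_gt.
  - rewrite (_ : C = [set w | t < T k.+1 w] `\` [set w | t < T k w]).
      by apply: measurableD; exact: measurable_arrival_gt.
    apply/seteqP; split => w /=.
      by move=> [h1 h2]; split => //; apply/negP; rewrite -leNgt h2.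
    move=> [h1 /negP]; rewrite -leNgt => h2; split => // j.
    by rewrite ltnS => jk; rewrite (le_trans _ h2)// arrival_le.
  - by apply/seteqP; split => // w /= [tk [_ /(_ k (ltnSn k))]]; rewrite leNgt tk.
apply/seteqP; split => w /=; last by case=> [|[]//]; move/lt_trans; apply; exact: T_incr.
move=> tk; have [tk'|tk'] := ltP t (T k w : R); [by left|right; split => // j].
by rewrite ltnS => jk; rewrite (le_trans _ tk')// arrival_le.
Qed.

Lemma poisson_sumE k (t : R) : 0 < t ->
  \sum_(0 <= j < k) poisson_pmf t j = expR (- t) * \sum_(0 <= j < k) t ^+ j / j`!%:R.
Proof.
by move=> t0; rewrite mulr_sumr; apply: eq_bigr => j _; rewrite /poisson_pmf t0 mulrC.
Qed.

Lemma arrival_late_bound k (e : R) : 0 < e -> (0 < k)%N ->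
  (P [set w | ((1 + e) * k%:R < T k w)%R] <= (((1 + e) * expR (- e)) ^+ k)%:E)%E.
Proof.
move=> e0 k0; have e1 : 0 < 1 + e by lra.
have kR : 0 < k%:R :> R by rewrite ltr0n.
rewrite arrival_gt_prob ?mulr_gt0// lee_fin poisson_sumE ?mulr_gt0//.
(* The optimal Chernoff parameter is k / t = 1 / (1 + e), which makes the exponent x t equal to k.
   The early bound uses 1 / (1 - e) in the same way. *)
have := @exp_head_le R ((1 + e) * k%:R) (1 + e)^-1 k (mulr_ge0 (ltW e1) (ltW kR)) _.
rewrite invr_ge0 ltW//= invf_le1// lerDl (ltW e0) => /(_ isT).
rewrite mulrA mulVf ?gt_eqF// mul1r exprVn mulrC ler_pdivrMr ?exprn_gt0// => h.
apply: (le_trans (ler_wpM2l (expR_ge0 _) h)).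
rewrite exprMn -expRM_natl mulrA -expRD mulrC ler_wpM2l ?exprn_ge0 ?(ltW e1)//.
by rewrite ler_expR; lra.
Qed.

Lemma arrival_early_bound k (e : R) : 0 < e < 1 -> (0 < k)%N ->
  (P [set w | ((T k w : R) <= (1 - e) * k%:R)%R] <= (((1 - e) * expR e) ^+ k)%:E)%E.
Proof.
move=> /andP[e0 e1'] k0; have e1 : 0 < 1 - e by lra.
have kR : 0 < k%:R :> R by rewrite ltr0n.
have t0 : 0 < (1 - e) * k%:R by rewrite mulr_gt0.
rewrite (_ : [set w | _] = ~` [set w | (1 - e) * k%:R < T k w]); last first.
  by apply/seteqP; split => w /=; rewrite leNgt => /negP.
rewrite probability_setC; last exact: measurable_arrival_gt.
rewrite arrival_gt_prob// poisson_sumE// -EFinD lee_fin.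
have := @exp_tail_le R ((1 - e) * k%:R) (1 - e)^-1 k (ltW t0) _.
rewrite invf_ge1// lerBlDr lerDl (ltW e0) => /(_ isT).
rewrite mulrA mulVf ?gt_eqF// mul1r exprVn mulrC ler_pdivrMr ?exprn_gt0// => h.
have <- (x : R) : expR (- ((1 - e) * k%:R)) * (expR ((1 - e) * k%:R) - x) =
    1 - expR (- ((1 - e) * k%:R)) * x.
  by rewrite mulrBr -expRD addNr expR0.
apply: (le_trans (ler_wpM2l (expR_ge0 _) h)).
rewrite exprMn -expRM_natl mulrA -expRD mulrC ler_wpM2l ?exprn_ge0 ?(ltW e1)//.
by rewrite ler_expR; lra.
Qed.

(** Borel-Cantelli for geometrically decaying probabilities. *)
Lemma lim_sup_set_geometric (F : (set Omega)^nat) (z : R) : 0 <= z < 1 ->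
  (forall k, measurable (F k)) ->
  (forall k, (P (F k) <= (z ^+ k.+1)%:E)%E) -> P (lim_sup_set F) = 0%E.
Proof.
move=> /andP[z0 z1] mF hF; apply: lim_sup_set_cvg0 => //.
apply: (@le_lt_trans _ _ (z / (1 - z))%:E); last exact: ltry.
apply: lime_le; first exact: is_cvg_nneseries.
apply: nearW => n; apply: (@le_trans _ _ (\sum_(0 <= k < n) (z ^+ k.+1)%:E)%E).
  by apply: lee_sum => k _; exact: hF.
rewrite sumEFin lee_fin.
have -> : \sum_(0 <= k < n) z ^+ k.+1 = series (geometric z z) n.
  by rewrite /series/=; apply: eq_bigr => k _; rewrite exprS.
rewrite geometric_seriesE ?lt_eqF//= ler_wpM2r ?invr_ge0 ?subr_ge0 ?(ltW z1)//.
by rewrite ler_piMr// gerBl exprn_ge0.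
Qed.

(** The tolerances 1 / (m + 2) lie strictly between 0 and 1, as the early bound requires, and tend
    to 0, so countably many null sets suffice. *)
Definition bad_arrival (m k : nat) : set Omega :=
  [set w | (1 + m.+2%:R^-1) * k.+1%:R < (T k.+1 w : R)] `|`
  [set w | (T k.+1 w : R) <= (1 - m.+2%:R^-1) * k.+1%:R].

Lemma arrival_asymptotic : exists2 N : set Omega, P N = 0%E /\ measurable N &
  forall w, ~ N w -> (T n.+1 w : R) / n.+1%:R @[n --> \oo] --> (1 : R).
Proof.
have mgt (t : R) k : measurable [set w | (T k w : R) <= t].
  rewrite (_ : [set w | _] = ~` [set w | t < (T k w : R)]).
    by apply: measurableC; exact: measurable_arrival_gt.
  by apply/seteqP; split => w /=; rewrite leNgt => /negP.
have mB m k : measurable (bad_arrival m k).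
  by apply: measurableU; [exact: measurable_arrival_gt|exact: mgt].
have mL m : measurable (lim_sup_set (bad_arrival m)).
  by apply: bigcapT_measurable => n; apply: bigcup_measurable => k _; exact: mB.
have PL m : P (lim_sup_set (bad_arrival m)) = 0%E.
  pose e : R := m.+2%:R^-1.
  have e0 : 0 < e by rewrite invr_gt0.
  have e1 : e < 1 by rewrite invf_lt1// ltr1n.
  pose L k := [set w | (1 + e) * k.+1%:R < (T k.+1 w : R)].
  pose M k := [set w | (T k.+1 w : R) <= (1 - e) * k.+1%:R].
  have P0L : P (lim_sup_set L) = 0%E.
    apply: (@lim_sup_set_geometric _ ((1 + e) * expR (- e))) => [|k|k].
    - rewrite mulr_ge0 ?expR_ge0//=; last by rewrite addr_ge0// ltW.
      by rewrite expRN -ltr_pdivlMr ?invr_gt0 ?expR_gt0// invrK mul1r expR_gt1Dx// gt_eqF.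
    - exact: measurable_arrival_gt.
    - exact: arrival_late_bound.
  have P0M : P (lim_sup_set M) = 0%E.
    apply: (@lim_sup_set_geometric _ ((1 - e) * expR e)) => [|k|k].
    - rewrite mulr_ge0 ?expR_ge0//=; last by rewrite subr_ge0 ltW.
      rewrite -[e in expR e]opprK expRN -ltr_pdivlMr ?invr_gt0 ?expR_gt0// invrK mul1r.
      by rewrite expR_gt1Dx// oppr_eq0 gt_eqF.
    - exact: mgt.
    - by apply: arrival_early_bound => //; rewrite e0 e1.
  have mLL : measurable (lim_sup_set L).
    by apply: bigcapT_measurable => n; apply: bigcup_measurable => k _; exact: measurable_arrival_gt.
  have mMM : measurable (lim_sup_set M).
    by apply: bigcapT_measurable => n; apply: bigcup_measurable => k _; exact: mgt.
  apply: (@subset_measure0 _ _ _ _ _ (lim_sup_set L `|` lim_sup_set M)) => //.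
  - exact: measurableU.
  - move=> w h; apply: contrapT => /not_orP[].
    move=> /existsNP[n1 /not_implyP[_ h1]] /existsNP[n2 /not_implyP[_ h2]].
    have [k /= + [?|?]] := h (maxn n1 n2) I; rewrite geq_max => /andP[k1 k2].
      by apply: h1; exists k.
    by apply: h2; exists k.
  - exact: (etrans (measureU0 mLL mMM P0M) P0L).
exists (\bigcup_m lim_sup_set (bad_arrival m)).
  split; last exact: bigcupT_measurable.
  apply/negligibleP; first exact: bigcupT_measurable.
  apply: negligible_bigcup => m; exists (lim_sup_set (bad_arrival m)).
  by split; [exact: mL|exact: PL|].
move=> w hw; apply/cvgrPdist_le => e e0.
pose m := Num.truncn e^-1.
have me : m.+2%:R^-1 <= e.
  rewrite -[e]invrK lef_pV2 ?posrE ?invr_gt0//.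
  have := truncnS_gt e^-1; rewrite -/m => h; rewrite (le_trans (ltW h))// ler_nat.
  exact: leqnSn.
have : ~ lim_sup_set (bad_arrival m) w by move=> h; apply: hw; exists m.
move=> /existsNP[n /not_implyP[_ hn]].
exists n => // k /= nk.
have : ~ bad_arrival m k w by move=> h; apply: hn; exists k.
move=> /not_orP[/negP + /negP]; rewrite -leNgt -ltNge => h1 h2.
have k0 : 0 < k.+1%:R :> R by [].
rewrite ler_distl; apply/andP; split.
  by rewrite lerBlDr ler_pdivrMr// (le_trans h1)// ler_pM2r// lerD2l.
rewrite -lerBlDr ler_pdivlMr// (le_trans _ (ltW h2))// ler_pM2r//.
by rewrite lerD2l lerN2.
Qed.

End arrival_times.

(** * Comparison of sums of powers with their integrals *)

Section power_sums.
Variable R : realType.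
Implicit Types (s x : R).

Lemma powR_bernoulli s x : 0 < s < 1 -> 0 <= x -> x `^ s <= 1 + s * (x - 1).
Proof.
move=> /andP[s0 s1] x0; have s1' : 0 < 1 - s by lra.
(* Young's inequality for x^s and 1 with the conjugate exponents 1 / s and 1 / (1 - s). *)
have := @conjugate_powR R (x `^ s) 1 s^-1 (1 - s)^-1 (powR_ge0 _ _) ler01.
rewrite !invr_gt0 => /(_ s0 s1'); rewrite !invrK => /(_ _).
rewrite mulr1 -powRrM mulfV ?gt_eqF// powRr1// powR1 => h.
by apply: le_trans (h _) _; [ring|nra].
Qed.

Lemma powR_subr1 x s : 0 < x -> x `^ (s - 1) = x `^ s / x.
Proof.
move=> x0; rewrite powRB; last by rewrite (gt_eqF x0) implybT.
by rewrite powRr1// ltW.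
Qed.

Lemma powR_tangent s a b : 0 < s < 1 -> 0 < a -> 0 <= b ->
  b `^ s <= a `^ s + s * (b - a) * a `^ (s - 1).
Proof.
move=> s01 a0 b0; have a0' : a != 0 by rewrite gt_eqF.
have h : b `^ s = a `^ s * (b / a) `^ s.
  by rewrite -powRM ?divr_ge0 ?(ltW a0)//; congr (_ `^ _); field.
rewrite {}h powR_subr1//.
apply: (le_trans (ler_wpM2l (powR_ge0 _ _) (powR_bernoulli s01 _))).
  by rewrite divr_ge0// ltW.
by rewrite le_eqVlt; apply/orP; left; apply/eqP; field.
Qed.

(** Here and in [powR_pred_ge], concavity of x^s bounds its increment by a tangent slope;
    telescoping then plays the role of comparing the sum with an integral. *)
Lemma powR_succ_le s (j : nat) : 0 < s < 1 -> (0 < j)%N ->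
  (j.+1%:R `^ s - j%:R `^ s) / s <= j%:R `^ (s - 1).
Proof.
move=> s01 j0; have /andP[s0 s1] := s01; have jR : 0 < j%:R :> R by rewrite ltr0n.
rewrite ler_pdivrMr// lerBlDl (le_trans (powR_tangent s01 jR _))// lerD2l.
by rewrite -natrB// subSnn mulr1 mulrC.
Qed.

Lemma powR_pred_ge s (j : nat) : 0 < s < 1 ->
  j.+1%:R `^ (s - 1) <= (j.+1%:R `^ s - j%:R `^ s) / s.
Proof.
move=> s01; have /andP[s0 s1] := s01; have jR : 0 < j.+1%:R :> R by [].
rewrite ler_pdivlMr//; have := powR_tangent s01 jR (ler0n R j).
rewrite (_ : j%:R - j.+1%:R = -1); last by rewrite -natr1; ring.
move: (_ `^ (s - 1)) (_ `^ s) (_ `^ s) => x y z; lra.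
Qed.

Lemma sum_powR_le s (i n : nat) : 0 < s < 1 -> (i <= n)%N ->
  \sum_(i <= j < n) j.+1%:R `^ (s - 1) <= (n%:R `^ s - i%:R `^ s) / s.
Proof.
move=> s01 /subnKC <-; elim: (n - i)%N => [|k IH].
  by rewrite addn0 big_geq// subrr mul0r.
rewrite addnS big_nat_recr ?leq_addr//=.
apply: (le_trans (lerD IH (powR_pred_ge (i + k) s01))).
by rewrite -mulrDl ler_wpM2r//; [case/andP: s01 => s0 _; rewrite invr_ge0 ltW|lra].
Qed.

Lemma sum_powR_ge s (i n : nat) : 0 < s < 1 -> (i <= n)%N ->
  (n.+1%:R `^ s - i.+1%:R `^ s) / s <= \sum_(i <= j < n) j.+1%:R `^ (s - 1).
Proof.
move=> s01 /subnKC <-; elim: (n - i)%N => [|k IH].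
  by rewrite addn0 big_geq// subrr mul0r.
rewrite addnS big_nat_recr ?leq_addr//=.
apply: le_trans (lerD IH (powR_succ_le s01 (ltn0Sn (i + k)))).
by rewrite -mulrDl ler_wpM2r//; [case/andP: s01 => s0 _; rewrite invr_ge0 ltW|lra].
Qed.

Lemma sum_powRN_le s (n : nat) : 0 < s < 1 ->
  \sum_(0 <= i < n) i.+1%:R `^ (- s) <= n%:R `^ (1 - s) / (1 - s).
Proof.
move=> s01; have s01' : 0 < 1 - s < 1 by lra.
have := sum_powR_le s01' (leq0n n); rewrite powR0; last by lra.
by rewrite subr0 (_ : 1 - s - 1 = - s)//; ring.
Qed.

End power_sums.

(** * Pathwise limit of the generating function *)

Lemma cvg_eq_from {R : realType} (u v : nat -> R) (l : R) (N : nat) :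
  (forall n, (N <= n)%N -> u n = v n) ->
  u n @[n --> \oo] --> l -> v n @[n --> \oo] --> l.
Proof.
move=> uv; apply: cvg_trans; apply: near_eq_cvg; exists N => // n; exact: uv.
Qed.

Lemma cvg_powRl {R : realType} (s : R) (u : nat -> R) (l : R) : 0 < l ->
  u n @[n --> \oo] --> l -> u n `^ s @[n --> \oo] --> l `^ s.
Proof.
move=> l0 ul.
have dl : derivable (fun x : R => x `^ s) l 1.
  by apply: derivable_powR; rewrite in_itv/= andbT.
have cl : {for l, continuous (fun x : R => x `^ s)}.
  by apply: differentiable_continuous; apply/derivable1_diffP.
exact: (continuous_cvg _ cl ul).
Qed.

Lemma onem_ge_expR {R : realType} (x : R) : 0 <= x < 1 -> expR (- (x / (1 - x))) <= 1 - x.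
Proof.
move=> /andP[x0 x1]; have x1' : 0 < 1 - x by lra.
rewrite expRN -[leRHS]invrK lef_pV2 ?posrE ?expR_gt0 ?invr_gt0//.
apply: le_trans (expR_ge1Dx _).
by rewrite le_eqVlt; apply/orP; left; apply/eqP; field; rewrite gt_eqF.
Qed.

Section pathwise_limit.
Variables (R : realType) (gamma beta : R) (kappa : R -> R) (tau : nat -> R).
Hypotheses (gamma01 : 0 < gamma < 1) (beta0 : 0 < beta).
Hypotheses (kappa01 : forall r, 0 <= kappa r <= 1)
  (kappa_le : forall r, 0 < r -> kappa r <= r^-1)
  (kappa_asymp : forall e : R, 0 < e ->
     exists2 r0 : R, 0 < r0 & forall r, r0 <= r -> 1 - e <= r * kappa r).
Hypothesis tau0 : forall n, 0 < tau n.

Definition trate i j : R := beta^-1 * (tau j `^ (1 - gamma) * tau i `^ gamma).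

(** The value of 1 / r_ij when the arrival times are replaced by i + 1 and j + 1. *)
Definition weight i j : R := beta * (j.+1%:R `^ (gamma - 1) * i.+1%:R `^ (- gamma)).

Let g0 : 0 < gamma. Proof. by case/andP: gamma01. Qed.
Let g1 : 0 < 1 - gamma. Proof. by rewrite subr_gt0; case/andP: gamma01. Qed.

Lemma weight_gt0 i j : 0 < weight i j.
Proof. by rewrite !mulr_gt0// powR_gt0. Qed.

Lemma weightV i j :
  (weight i j)^-1 = beta^-1 * (j.+1%:R `^ (1 - gamma) * i.+1%:R `^ gamma).
Proof.
rewrite /weight !invfM -!powRN opprK opprB; by [].
Qed.

Lemma trate_gt0 i j : 0 < trate i j.
Proof. by rewrite !mulr_gt0 ?invr_gt0// powR_gt0. Qed.

(** The rate is homogeneous of degree 1 in the pair of arrival times, so a factor common to both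
    bounds comes out to the first power. *)
Let powR_split (l x y : R) : 0 < l -> 0 < x -> 0 < y ->
  (l * x) `^ (1 - gamma) * (l * y) `^ gamma = l * (x `^ (1 - gamma) * y `^ gamma).
Proof.
move=> l0 x0 y0; rewrite !powRM ?(ltW l0) ?(ltW x0) ?(ltW y0)//.
rewrite mulrACA -powRD; last by rewrite (gt_eqF l0) implybT.
by rewrite subrK powRr1// ltW.
Qed.

Lemma trate_ge (l : R) i j : 0 < l -> l * i.+1%:R <= tau i -> l * j.+1%:R <= tau j ->
  l / weight i j <= trate i j.
Proof.
move=> l0 li lj; rewrite weightV mulrCA -powR_split// ler_pM2l ?invr_gt0//.
by apply: ler_pM; rewrite ?powR_ge0//; apply: ge0_ler_powR => //;
  rewrite ?nnegrE ?mulr_ge0 ?(ltW l0) ?(ltW g1) ?(ltW g0) ?(ltW (tau0 _)).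
Qed.

Lemma trate_le (l : R) i j : 0 < l -> tau i <= l * i.+1%:R -> tau j <= l * j.+1%:R ->
  trate i j <= l / weight i j.
Proof.
move=> l0 li lj; rewrite weightV mulrCA -powR_split// ler_pM2l ?invr_gt0//.
by apply: ler_pM; rewrite ?powR_ge0//; apply: ge0_ler_powR => //;
  rewrite ?nnegrE ?mulr_ge0 ?(ltW l0) ?(ltW g1) ?(ltW g0) ?(ltW (tau0 _)).
Qed.

Lemma kappa_weight_le (l : R) i j : 0 < l ->
  l * i.+1%:R <= tau i -> l * j.+1%:R <= tau j ->
  kappa (trate i j) <= l^-1 * weight i j.
Proof.
move=> l0 li lj; apply: (le_trans (kappa_le (trate_gt0 i j))).
rewrite -[leRHS]invrK lef_pV2 ?posrE ?trate_gt0 ?invr_gt0 ?mulr_gt0 ?invr_gt0 ?weight_gt0//.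
by rewrite invfM invrK; exact: trate_ge.
Qed.

Lemma weight_le i j : (i < j)%N -> weight i j <= beta / i.+1%:R.
Proof.
move=> ij; rewrite -[leRHS]invrK -[leLHS]invrK.
rewrite lef_pV2 ?posrE ?invr_gt0 ?divr_gt0 ?weight_gt0//.
rewrite weightV invfM invrK ler_pM2l ?invr_gt0//.
rewrite [leLHS](_ : _ = i.+1%:R `^ (1 - gamma) * i.+1%:R `^ gamma); last first.
  by rewrite -powRD ?pnatr_eq0 ?implybT// subrK powRr1.
apply: ler_wpM2r; first exact: powR_ge0.
by apply: ge0_ler_powR; rewrite ?nnegrE ?(ltW g1)// ler_nat ltnS ltnW.
Qed.

Hypothesis tau_asymp : tau n.+1 / n.+1%:R @[n --> \oo] --> (1 : R).

Lemma tau_near (e : R) : 0 < e -> exists N, forall n, (N <= n)%N ->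
  (1 - e) * n.+1%:R <= tau n <= (1 + e) * n.+1%:R.
Proof.
move=> e0; have e20 : 0 < e / 2 by rewrite divr_gt0.
move/cvgrPdist_le : tau_asymp => /(_ _ e20)[N _ hN].
(* The hypothesis compares [tau n.+1] with n + 1, the claim compares it with n + 2. Half of e pays
   for this shift once n + 1 >= 2 / e. *)
exists (N + (Num.truncn (2 / e)).+1)%N => -[|n nN]; first by rewrite addnS.
have /hN/= : (N <= n)%N.
  by rewrite -ltnS (leq_trans _ nN)// addnS ltnS leq_addr.
have nR : 0 < n.+1%:R :> R by [].
have ne : 2 / e <= n.+1%:R.
  by rewrite (le_trans (ltW (truncnS_gt _)))// ler_nat (leq_trans _ nN)// leq_addl.
rewrite ler_pdivrMr// in ne.
rewrite ler_distl => /andP[]; rewrite lerBlDr ler_pdivrMr// -lerBlDr ler_pdivlMr// => h1 h2.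
rewrite -[n.+2%:R]natr1; move: (n.+1%:R : R) nR ne h1 h2 => x x0 ne h1 h2.
by apply/andP; split; nra.
Qed.

Lemma kappa_weight_asymp (h : R) : 0 < h < 1 -> exists N, forall i j, (N <= i)%N -> (i < j)%N ->
  (1 - h) * weight i j <= kappa (trate i j) <= (1 + h) * weight i j.
Proof.
move=> /andP[h0 h1]; have h4 : 0 < h / 4 by rewrite divr_gt0.
have [N hN] := tau_near h4.
have [r0 r00 hr0] := kappa_asymp (divr_gt0 h0 (ltr0Sn _ 1)).
(* Makes the rate at least (i + 1) / (2 beta) >= r0 for every j > i at once. *)
exists (N + (Num.truncn (2 * beta * r0)).+1)%N => i j iN ij.
have Ni : (N <= i)%N by rewrite (leq_trans _ iN)// leq_addr.
have /andP[i1 i2] := hN i Ni; have /andP[j1 j2] := hN j (leq_trans Ni (ltnW ij)).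
have l0 : 0 < 1 - h / 4 by lra.
have l0' : 0 < 1 + h / 4 by lra.
have w0 := weight_gt0 i j; have t0 := trate_gt0 i j.
have w0' : weight i j != 0 by rewrite gt_eqF.
apply/andP; split; last first.
  apply: (le_trans (kappa_weight_le l0 i1 j1)); rewrite ler_pM2r//.
  by rewrite -[_^-1]mul1r ler_pdivrMr//; nra.
have tr : r0 <= trate i j.
  apply: le_trans (trate_ge l0 i1 j1).
  rewrite ler_pdivlMr//; apply: (le_trans (ler_wpM2l (ltW r00) (weight_le ij))).
  rewrite mulrA ler_pdivrMr//.
  have : 2 * beta * r0 <= i.+1%:R.
    rewrite (le_trans (ltW (truncnS_gt _)))// ler_nat (leq_trans _ (leqnSn _))//.
    by rewrite (leq_trans _ iN)// leq_addl.
  have br0 : 0 <= beta * r0 by rewrite mulr_ge0 ?(ltW beta0) ?(ltW r00).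
  have hl : 2^-1 <= 1 - h / 4 by lra.
  move: (i.+1%:R : R) => x; rewrite -mulrA => hx.
  have x0 : 0 <= x by apply: le_trans hx; rewrite mulr_ge0.
  apply: le_trans (ler_wpM2r x0 hl); rewrite mulrC; lra.
have := hr0 _ tr; have := trate_le l0' i2 j2.
rewrite ler_pdivlMr// => hw hk.
have k0 : 0 <= kappa (trate i j) by case/andP: (kappa01 (trate i j)).
move: (trate i j) (weight i j) (kappa (trate i j)) t0 w0 hw hk k0 => t w k t0 w0 hw hk k0 /=.
(* (1 - h) w <= k follows from (1 - h/2) w <= (t w) k <= (1 + h/4) k *)
have h3 : (1 - h / 2) * w <= (1 + h / 4) * k.
  apply: (@le_trans _ _ ((t * k) * w)); first by rewrite ler_pM2r.
  by rewrite mulrAC ler_wpM2r.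
have h5 : (1 - h) * (1 + h / 4) * w <= (1 - h / 2) * w.
  rewrite ler_pM2r//; have := mulr_ge0 (ltW h0) (ltW h0); lra.
rewrite -(ler_pM2l l0'); apply: le_trans h3; apply: le_trans h5.
by rewrite mulrA [(1 + h / 4) * _]mulrC.
Qed.

(* Limiting expected indegree of the vertex of relative age v. *)
Definition lam (v : R) : R := beta / gamma * (v `^ (- gamma) - 1).

(** The sum is squeezed between two discrete antiderivatives. The lower one starts at ix + 2 = x (1
    + 1/x) with x = ix + 1, which explains the extra term in [gs']. *)
Lemma weight_sum_limit (v : R) (ix : nat -> nat) : 0 < v < 1 ->
  (ix n)%:R / n%:R @[n --> \oo] --> v ->
  \sum_((ix n).+1 <= j < n) weight (ix n) j @[n --> \oo] --> lam v.
Proof.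
move=> /andP[v0 v1] ixv.
pose x n : R := (ix n).+1%:R.
have xx n : 0 < x n by rewrite /x.
have inv0 : (n%:R : R)^-1 @[n --> \oo] --> (0 : R).
  rewrite -cvg_shiftS /=; exact: cvg_harmonic.
have xv : x n / n%:R @[n --> \oo] --> v.
  rewrite -[v]addr0 (_ : (fun n => x n / n%:R) = (fun n => (ix n)%:R / n%:R + (n%:R)^-1)).
    exact: cvgD.
  by apply/funext => n; rewrite /x -natr1 mulrDl mul1r.
have nx : n%:R / x n @[n --> \oo] --> v^-1.
  rewrite (_ : (fun n => n%:R / x n) = (fun n => (x n / n%:R)^-1)).
    by apply: cvgV => //; rewrite gt_eqF.
  by apply/funext => n; rewrite invfM invrK mulrC.
have ivx : (x n)^-1 @[n --> \oo] --> (0 : R).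
  have h : n%:R / x n * (n%:R)^-1 @[n --> \oo] --> (0 : R).
    by rewrite -(mulr0 v^-1); exact: cvgM.
  apply: (cvg_eq_from (N := 1%N)) h => n n0 /=.
  by rewrite mulrAC mulfV ?mul1r// pnatr_eq0 -lt0n.
have gs : beta / gamma * ((n%:R / x n) `^ gamma - 1) @[n --> \oo] --> lam v.
  apply: cvgM; first exact: cvg_cst.
  apply: cvgB; last exact: cvg_cst.
  have v0i : 0 < v^-1 by rewrite invr_gt0.
  have := cvg_powRl (s := gamma) v0i nx.
  by rewrite -[v^-1]powR_inv1 ?(ltW v0)// -powRrM mulN1r.
have gs' : beta / gamma * ((n%:R / x n) `^ gamma - (1 + (x n)^-1) `^ gamma) @[n --> \oo] --> lam v.
  apply: cvgM; first exact: cvg_cst.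
  apply: cvgB.
    have v0i : 0 < v^-1 by rewrite invr_gt0.
  have := cvg_powRl (s := gamma) v0i nx.
    by rewrite -[v^-1]powR_inv1 ?(ltW v0)// -powRrM mulN1r.
  have -> : 1 = 1 `^ gamma :> R by rewrite powR1.
  apply: cvg_powRl => //; rewrite powR1.
  by rewrite -[X in _ --> X]addr0; apply: cvgD => //; exact: cvg_cst.
apply: squeeze_cvgr gs' gs.
(* As v < 1, eventually ix n < n, which both bounds on the sum require. *)
have v1' : 0 < (1 - v) by lra.
move/cvgrPdist_lt : xv => /(_ _ v1')[N _ hN].
exists N.+1 => // n /= nN.
have nR : 0 < n%:R :> R by rewrite ltr0n (leq_trans _ nN).
have xn : (ix n < n)%N.
  have := hN n (ltnW nN); rewrite /= ltr_distl => /andP[+ _].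
  rewrite ltrBlDr (_ : v + (1 - v) = 1) ?ltr_pdivrMr ?mul1r//; last lra.
  by rewrite /x ltr_nat => /ltnW.
have E : \sum_((ix n).+1 <= j < n) weight (ix n) j =
    beta * x n `^ (- gamma) * \sum_((ix n).+1 <= j < n) j.+1%:R `^ (gamma - 1).
  by rewrite mulr_sumr; apply: eq_bigr => j _; rewrite /weight mulrA mulrAC.
have xg : x n `^ (- gamma) = (x n `^ gamma)^-1 by rewrite powRN.
have xg0 : x n `^ gamma != 0 by rewrite gt_eqF// powR_gt0.
have gn0 : gamma != 0 by rewrite gt_eqF.
have nxE : (n%:R / x n) `^ gamma = n%:R `^ gamma / x n `^ gamma.
  rewrite powRM ?invr_ge0 ?(ltW (xx n))//; congr (_ * _).
  by rewrite -powR_inv1 ?(ltW (xx n))// -powRrM mulN1r powRN.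
have c0 : 0 <= beta * x n `^ (- gamma) by rewrite mulr_ge0 ?powR_ge0 ?(ltW beta0).
rewrite E; apply/andP; split; last first.
  apply: (le_trans (ler_wpM2l c0 (sum_powR_le gamma01 xn))).
  rewrite nxE xg /x -/(x n) le_eqVlt; apply/orP; left; apply/eqP.
  by move: (x n `^ gamma) xg0 => y y0; field; rewrite y0 gn0.
apply: le_trans (ler_wpM2l c0 (sum_powR_ge gamma01 xn)).
have -> : (ix n).+2%:R = x n * (1 + (x n)^-1) :> R.
  by rewrite mulrDr mulfV ?gt_eqF// mulr1 /x natr1.
rewrite powRM ?(ltW (xx n)) ?addr_ge0 ?invr_ge0 ?(ltW (xx n))// nxE xg.
have nn : n%:R `^ gamma <= n.+1%:R `^ gamma :> R.
  by apply: ge0_ler_powR; rewrite ?nnegrE ?(ltW g0)// ler_nat.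
apply: (@le_trans _ _ (beta / x n `^ gamma * ((n%:R `^ gamma - x n `^ gamma * (1 + (x n)^-1) `^ gamma) / gamma))).
  rewrite le_eqVlt; apply/orP; left; apply/eqP.
  by move: (x n `^ gamma) xg0 => y y0; field; rewrite y0 gn0.
rewrite -xg ler_wpM2l// ler_wpM2r ?invr_ge0 ?(ltW g0)//.
by rewrite lerD2r.
Qed.

Lemma index_infty (v : R) (ix : nat -> nat) (K : nat) : 0 < v ->
  (ix n)%:R / n%:R @[n --> \oo] --> v ->
  exists N, forall n, (N <= n)%N -> (K <= ix n)%N.
Proof.
move=> v0 /cvgrPdist_lt /(_ _ (divr_gt0 v0 (ltr0Sn _ 1)))[N _ hN].
exists (N + (Num.truncn (2 * K%:R / v)).+1)%N => n nN.
have /hN/= : (N <= n)%N by rewrite (leq_trans _ nN)// leq_addr.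
have nR : 0 < n%:R :> R by rewrite ltr0n (leq_trans _ nN)// addnS.
have : 2 * K%:R / v <= n%:R.
  by rewrite (le_trans (ltW (truncnS_gt _)))// ler_nat (leq_trans _ nN)// leq_addl.
rewrite ler_pdivrMr// ltr_distl => h1 /andP[_ h2].
have : v / 2 < (ix n)%:R / n%:R by lra.
by rewrite ltr_pdivlMr// -(ler_nat R) => h3; nra.
Qed.

(** Factor by factor from exp(-x / (1 - x)) <= 1 - x <= exp(-x). For large i every x is at most h,
    and (1 + h) / (1 - h) <= 1 + 4 h because h <= 1/2. *)
Lemma prod_bounds (c h : R) : 0 <= c <= 1 -> 0 < h -> h <= 2^-1 ->
  exists N, forall i n, (N <= i)%N ->
    expR (- (c * (1 + 4 * h) * \sum_(i.+1 <= j < n) weight i j)) <=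
      \prod_(i.+1 <= j < n) (1 - c * kappa (trate i j)) <=
    expR (- (c * (1 - h) * \sum_(i.+1 <= j < n) weight i j)).
Proof.
move=> /andP[c0 c1] h0 h2; have h01 : 0 < h < 1 by lra.
have [N hN] := kappa_weight_asymp h01.
exists (N + (Num.truncn (2 * beta / h)).+1)%N => i n iN.
have Ni : (N <= i)%N by rewrite (leq_trans _ iN)// leq_addr.
have bh : beta / i.+1%:R <= h / 2.
  have : 2 * beta / h <= i.+1%:R.
    rewrite (le_trans (ltW (truncnS_gt _)))// ler_nat (leq_trans _ (leqnSn _))//.
    by rewrite (leq_trans _ iN)// leq_addl.
  by rewrite ler_pdivrMr// ler_pdivrMr// => hh; lra.
have key j : (i < j)%N -> expR (- (c * (1 + 4 * h) * weight i j)) <=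
    1 - c * kappa (trate i j) <= expR (- (c * (1 - h) * weight i j)).
  move=> ij; have /andP[k1 k2] := hN i j Ni ij.
  have w0 := weight_gt0 i j; have wb := le_trans (weight_le ij) bh.
  have /andP[k0 _] := kappa01 (trate i j).
  move: (kappa _) (weight i j) k1 k2 w0 wb k0 => k w k1 k2 w0 wb k0 /=.
  have kh : k <= h by apply: le_trans k2 _; nra.
  have x0 : 0 <= c * k by exact: mulr_ge0.
  have xh : c * k <= h by apply: le_trans kh; rewrite ler_piMl.
  apply/andP; split.
    have x1 : 0 <= c * k < 1 by rewrite x0/=; lra.
    apply: le_trans (onem_ge_expR x1); rewrite ler_expR lerN2.
    rewrite ler_pdivrMr; last lra.
    have hk : k <= (1 + 4 * h) * w * (1 - c * k).
      apply: (le_trans k2); apply: (@le_trans _ _ ((1 + 4 * h) * w * (1 - h))).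
        by rewrite mulrAC ler_pM2r//; nra.
      by rewrite ler_wpM2l// ?mulr_ge0 ?(ltW w0)//; lra.
    apply: (le_trans (ler_wpM2l c0 hk)).
    by rewrite !mulrA.
  apply: (@le_trans _ _ (expR (- (c * k)))).
    by have := expR_ge1Dx (- (c * k)).
  by rewrite ler_expR lerN2 -mulrA ler_wpM2l.
rewrite !mulr_sumr -!sumrN !expR_sum !big_nat.
apply/andP; split; apply: ler_prod => j /andP[ij _]; have /andP[h3 h4] := key j ij.
  by rewrite expR_ge0.
by rewrite h4 (le_trans _ h3)// expR_ge0.
Qed.

Lemma prod_limit (c v : R) (ix : nat -> nat) : 0 <= c <= 1 -> 0 < v < 1 ->
  (ix n)%:R / n%:R @[n --> \oo] --> v ->
  \prod_((ix n).+1 <= j < n) (1 - c * kappa (trate (ix n) j)) @[n --> \oo] -->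
    expR (- (c * lam v)).
Proof.
move=> c01 v01 ixv; have /andP[c0 c1] := c01; have /andP[v0 v1] := v01.
pose W n := \sum_((ix n).+1 <= j < n) weight (ix n) j.
pose Q n := \prod_((ix n).+1 <= j < n) (1 - c * kappa (trate (ix n) j)).
have WL := weight_sum_limit v01 ixv.
have L0 : 0 <= lam v.
  rewrite mulr_ge0 ?divr_ge0 ?(ltW beta0) ?(ltW g0)// subr_ge0 powRN.
  rewrite invf_ge1 ?powR_gt0// [leRHS](_ : 1 = 1 `^ gamma); last by rewrite powR1.
  by apply: ge0_ler_powR; rewrite ?nnegrE ?(ltW g0) ?(ltW v0) ?(ltW v1).
have half : (0 : R) < 2^-1 by [].
(* This first use, with h = 1/2, only provides positivity, so that logarithms may be taken. *)
have [N0 hN0] := prod_bounds c01 half (lexx _).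
have [N1 hN1] := index_infty N0 v0 ixv.
have Qpos n : (N1 <= n)%N -> 0 < Q n.
  by move=> /hN1 h; have /andP[+ _] := hN0 (ix n) n h; apply: lt_le_trans; exact: expR_gt0.
have lnQ : ln (Q n) @[n --> \oo] --> - (c * lam v).
  apply/cvgrPdist_le => e e0.
  (* Eventually the weights sum to at most lam v + 1, so the relative error 4 h costs at most e / 2;
     the other half pays for the convergence of the sum. *)
  pose h := Num.min 2^-1 (e / (8 * (lam v + 1))).
  have e8 : 0 < e / (8 * (lam v + 1)) by rewrite divr_gt0// mulr_gt0//; lra.
  have h0 : 0 < h by rewrite /h lt_min half e8.
  have h2 : h <= 2^-1 by rewrite /h ge_min lexx.
  have he : 4 * h * (lam v + 1) <= e / 2.
    have : h <= e / (8 * (lam v + 1)) by rewrite /h ge_min lexx orbT.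
    by rewrite ler_pdivlMr; lra.
  have [M1 hM1] := prod_bounds c01 h0 h2.
  have [M2 hM2] := index_infty M1 v0 ixv.
  have e20 : 0 < Num.min (e / 2) 1 by rewrite lt_min; lra.
  move/cvgrPdist_le : WL => /(_ _ e20)[M3 _ hM3].
  exists (maxn N1 (maxn M2 M3)) => // n /=; rewrite !geq_max => /and3P[n1 n2 n3].
  have /andP[q1 q2] := hM1 _ n (hM2 _ n2); have := hM3 n n3.
  rewrite -/(W n) /= le_min => /andP[w1 w2].
  have W0 : 0 <= W n by apply: sumr_ge0 => j _; rewrite ltW ?weight_gt0.
  rewrite -/(Q n) -/(W n) in q1 q2.
  have qp := Qpos n n1.
  rewrite -[_ <= Q n]ler_ln ?posrE ?expR_gt0// expRK in q1.
  rewrite -[Q n <= _]ler_ln ?posrE ?expR_gt0// expRK in q2.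
  have W1 : W n <= lam v + 1 by move: w2; rewrite ler_distl => /andP[]; lra.
  have cw : c * (4 * h * W n) <= e / 2.
    apply: le_trans he; apply: (@le_trans _ _ (4 * h * W n)).
      by rewrite ler_piMl// mulr_ge0//; lra.
    by rewrite ler_wpM2l//; lra.
  have hcw : 0 <= c * (h * W n) by rewrite !mulr_ge0// ltW.
  have cd : `|c * (lam v - W n)| <= e / 2.
    by rewrite normrM (ger0_norm c0) (le_trans (ler_piMl _ c1)).
  rewrite ler_norml in cd; have /andP[d1 d2] := cd.
  rewrite ler_norml; move: (ln (Q n)) q1 q2 => y q1 q2.
  have E1 : c * (1 + 4 * h) * W n = c * W n + c * (4 * h * W n) by ring.
  have E2 : c * (1 - h) * W n = c * W n - c * (h * W n) by ring.
  have E3 : c * (4 * h * W n) = 4 * (c * (h * W n)) by ring.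
  have E4 : c * (lam v - W n) = c * lam v - c * W n by ring.
  rewrite E4 in d1 d2; rewrite E1 in q1; rewrite E2 in q2; rewrite E3 in q1 cw.
  by apply/andP; split; lra.
have cE : {for - (c * lam v), continuous (@expR R)} by exact: continuous_expR.
have h : expR (ln (Q n)) @[n --> \oo] --> expR (- (c * lam v)) by exact: (continuous_cvg _ cE lnQ).
apply: (cvg_eq_from (N := N1)) h => n n1 /=.
by rewrite lnK// posrE Qpos.
Qed.

End pathwise_limit.

(** * The mixing density and its cells of equal mass *)

Section mixing_density.
Variables (R : realType) (gamma beta : R).
Hypotheses (gamma01 : 0 < gamma < 1) (beta0 : 0 < beta).
Local Notation mu := (@lebesgue_measure R).
Local Notation dens := (mixing_density gamma beta).

Let g0 : 0 < gamma. Proof. by case/andP: gamma01. Qed.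
Let gV : 0 < gamma^-1. Proof. by rewrite invr_gt0. Qed.

(* The mixing distribution is the image of the uniform distribution on (0,1)
   under [lam]; [ulam] is the inverse of [lam]. *)
Definition ulam (l : R) : R := beta `^ gamma^-1 * (gamma * l + beta) `^ (- gamma^-1).

Let arg_gt0 l : 0 <= l -> 0 < gamma * l + beta.
Proof. by move=> l0; rewrite ltr_wpDl// mulr_ge0// ltW. Qed.

Lemma ulam_gt0 l : 0 <= l -> 0 < ulam l.
Proof. by move=> l0; rewrite mulr_gt0// powR_gt0// arg_gt0. Qed.

Lemma mixing_density_ge0 l : 0 <= dens l.
Proof. by rewrite mulr_ge0 ?powR_ge0. Qed.

Lemma ulam0 : ulam 0 = 1.
Proof.
rewrite /ulam mulr0 add0r -powRD; last by rewrite (gt_eqF beta0) implybT.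
by rewrite addrN powRr0.
Qed.

Lemma ulam_decr (a b : R) : 0 <= a -> a < b -> ulam b < ulam a.
Proof.
move=> a0 ab; rewrite ltr_pM2l ?powR_gt0// !powRN.
have b0 : 0 <= b by rewrite ltW// (le_lt_trans a0).
rewrite ltf_pV2 ?posrE ?powR_gt0 ?arg_gt0//.
apply: gt0_ltr_powR => //; rewrite ?nnegrE ?(ltW (arg_gt0 _))//.
by rewrite ltrD2r ltr_pM2l.
Qed.

Lemma lamK (x : R) : 0 < x -> ulam (lam gamma beta x) = x.
Proof.
move=> x0; rewrite /ulam /lam.
have -> : gamma * (beta / gamma * (x `^ (- gamma) - 1)) + beta = beta * x `^ (- gamma).
  by field; rewrite gt_eqF.
rewrite powRM ?powR_ge0 ?(ltW beta0)// mulrA -powRD; last by rewrite (gt_eqF beta0) implybT.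
rewrite addrN powRr0 mul1r.
by rewrite -powRrM mulrNN mulfV ?gt_eqF// powRr1// ltW.
Qed.

Lemma ulamK (l : R) : 0 <= l -> lam gamma beta (ulam l) = l.
Proof.
move=> l0; rewrite /ulam /lam.
have al := arg_gt0 l0.
rewrite powRM ?powR_ge0// -!powRrM mulrNN mulrN !mulVf ?gt_eqF//.
rewrite powRr1 ?(ltW al)// powR_inv1 ?(ltW beta0)//.
by field; rewrite !gt_eqF.
Qed.

Lemma lam_ge0 (x : R) : 0 < x <= 1 -> 0 <= lam gamma beta x.
Proof.
move=> /andP[x0 x1]; rewrite mulr_ge0 ?divr_ge0 ?(ltW beta0) ?(ltW g0)// subr_ge0 powRN.
rewrite invf_ge1 ?powR_gt0// [leRHS](_ : 1 = 1 `^ gamma); last by rewrite powR1.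
by apply: ge0_ler_powR; rewrite ?nnegrE ?(ltW g0) ?(ltW x0).
Qed.

Let is_derive_power (l p : R) : 0 <= l ->
  is_derive l 1 (fun x : R => (gamma * x + beta) `^ p) (p * (gamma * l + beta) `^ (p - 1) * gamma).
Proof.
move=> l0; have al := arg_gt0 l0.
have d1 : is_derive l 1 (fun x : R => gamma * x + beta) gamma.
  by apply: is_derive_eq; rewrite addr0 -[RHS]mulr1; congr (_ * _).
have d0 : is_derive (gamma * l + beta) 1 (fun y : R => y `^ p)
    (p * (gamma * l + beta) `^ (p - 1)) by exact: is_derive1_powR.
exact: (@is_derive1_comp R (fun y => y `^ p) (fun x => gamma * x + beta) l _ _ d0 d1).
Qed.

Lemma is_derive_ulam (l : R) : 0 <= l -> is_derive l 1 (fun x => - ulam x) (dens l).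
Proof.
move=> l0; have d := is_derive_power (- gamma^-1) l0.
apply: is_derive_eq; rewrite /mixing_density -[_ *: _]/(_ * _).
rewrite (_ : - gamma^-1 - 1 = - (1 + gamma^-1)); last by ring.
move: (_ `^ (- _)) (_ `^ gamma^-1) => x y.
by field; rewrite gt_eqF.
Qed.

Lemma derivable_mixing_density (l : R) : 0 <= l -> derivable dens l 1.
Proof.
move=> l0; have d := is_derive_power (- (1 + gamma^-1)) l0.
rewrite /mixing_density; apply: derivableM; first exact: derivable_cst.
exact: ex_derive.
Qed.

Lemma measurable_mixing_density : measurable_fun setT dens.
Proof.
apply: measurable_funM => //; apply: (measurableT_comp (measurable_powR _)).
exact: measurable_affine.
Qed.

Let measurable_EFin_dens : measurable_fun setT (fun l => (dens l)%:E).
Proof. by apply/measurable_EFinP; exact: measurable_mixing_density. Qed.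

Lemma ulam_cvg0 : (- ulam x) @[x --> +oo%R] --> 0.
Proof.
apply/cvgrPdist_le => e e0.
pose M := beta `^ gamma^-1 / e; have M0 : 0 < M by rewrite divr_gt0// powR_gt0.
exists (M `^ gamma / gamma); split; first exact: num_real.
move=> x Mx; have x0 : 0 < x by apply: le_lt_trans Mx; rewrite divr_ge0 ?powR_ge0// ltW.
rewrite sub0r opprK ger0_norm ?(ltW (ulam_gt0 (ltW x0)))//.
rewrite /ulam powRN ler_pdivrMr ?powR_gt0 ?(arg_gt0 (ltW x0))// mulrC -ler_pdivrMr//.
rewrite -/M -[leLHS]powRr1 ?(ltW M0)// -(mulfV (lt0r_neq0 g0)) powRrM.
apply: ge0_ler_powR; rewrite ?nnegrE ?powR_ge0 ?(ltW gV) ?(ltW (arg_gt0 (ltW x0)))//.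
rewrite ltr_pdivrMr// in Mx; rewrite mulrC ltW//.
by rewrite (lt_trans Mx)// ltrDl.
Qed.

(** [ulam] is minus an antiderivative of the density and vanishes at infinity; it is the tail
    function of the mixing law. *)
Lemma mixing_density_tail (a : R) : 0 <= a ->
  (\int[mu]_(l in `[a, +oo[) (dens l)%:E = (ulam a)%:E)%E.
Proof.
move=> a0; rewrite (@ge0_continuous_FTC2y R dens (fun x => - ulam x) a 0).
- by rewrite -EFinN opprK add0e.
- by move=> x _; exact: mixing_density_ge0.
- apply: derivable_within_continuous => x; rewrite in_itv/= andbT => ax.
  by apply: derivable_mixing_density; exact: le_trans ax.
- exact: ulam_cvg0.
- move=> x ax; have d := is_derive_ulam (le_trans a0 (ltW ax)); exact: ex_derive.
- have d := is_derive_ulam a0.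
  apply: cvg_at_right_filter.
  have : {for a, continuous (fun x => - ulam x)} by apply: differentiable_continuous; apply/derivable1_diffP; exact: ex_derive.
  exact.
- move=> x; rewrite in_itv/= andbT => ax; have d := is_derive_ulam (le_trans a0 (ltW ax)).
  by rewrite derive1E derive_val.
Qed.

Lemma mixing_density_integral :
  (\int[mu]_(l in `]0%R, +oo[) (dens l)%:E = 1)%E.
Proof.
rewrite integral_itv_obnd_cbnd; last exact: measurable_funTS measurable_EFin_dens.
by rewrite mixing_density_tail// ulam0.
Qed.

Lemma mixing_density_integrable : mu.-integrable `]0%R, +oo[ (EFin \o dens).
Proof.
apply/integrableP; split; first exact: measurable_funTS measurable_EFin_dens.
under eq_integral do rewrite /= ger0_norm ?mixing_density_ge0//.
by rewrite mixing_density_integral ltry.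
Qed.

Definition ulevel (x : R) : set R := [set l | 0 < l /\ ulam l < x].

Lemma ulevelE x : 0 < x <= 1 -> ulevel x = `]lam gamma beta x, +oo[%classic.
Proof.
move=> x01; have /andP[x0 x1] := x01; have L0 := lam_ge0 x01.
apply/seteqP; split => l /=; rewrite in_itv/= andbT.
  move=> [l0 lx]; rewrite ltNge; apply/negP => lL.
  move: lL; rewrite le_eqVlt => /orP[/eqP E|]; first by move: lx; rewrite E lamK// ltxx.
  by move/(ulam_decr (ltW l0)); rewrite lamK// => /(lt_trans lx); rewrite ltxx.
move=> Ll; split; first exact: le_lt_trans Ll.
by have := ulam_decr L0 Ll; rewrite lamK.
Qed.

Lemma ulevel0 : ulevel 0 = set0.
Proof.
by apply/seteqP; split => // l /= [l0]; rewrite ltNge (ltW (ulam_gt0 (ltW l0))).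
Qed.

Lemma measurable_ulevel x : 0 <= x <= 1 -> measurable (ulevel x).
Proof.
move=> /andP[]; rewrite le_eqVlt => /orP[/eqP <- _|x0 x1]; first by rewrite ulevel0.
by rewrite ulevelE ?x0.
Qed.

Lemma ulevel_integral x : 0 <= x <= 1 -> (\int[mu]_(l in ulevel x) (dens l)%:E = x%:E)%E.
Proof.
move=> /andP[]; rewrite le_eqVlt => /orP[/eqP <- _|x0 x1].
  by rewrite ulevel0 integral_set0.
have x01 : 0 < x <= 1 by rewrite x0.
rewrite ulevelE// integral_itv_obnd_cbnd; last exact: measurable_funTS measurable_EFin_dens.
by rewrite mixing_density_tail ?lamK// lam_ge0.
Qed.

(** The relative ages in [i / n, (i + 1) / n), carried over to the l-axis. All n cells have mixing
    mass 1 / n. *)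
Definition ucell (n i : nat) : set R := ulevel (i.+1%:R / n%:R) `\` ulevel (i%:R / n%:R).

Let level01 n i : (0 < n)%N -> (i <= n)%N -> 0 <= (i%:R / n%:R : R) <= 1.
Proof.
move=> n0 iN; rewrite divr_ge0//= ler_pdivrMr ?ltr0n// mul1r ler_nat//.
Qed.

Lemma measurable_ucell n i : (i < n)%N -> measurable (ucell n i).
Proof.
move=> iN; have n0 : (0 < n)%N by exact: leq_ltn_trans iN.
by apply: measurableD; apply: measurable_ulevel; apply: level01 => //; exact: ltnW.
Qed.

Lemma ucell_integral n i : (i < n)%N ->
  (\int[mu]_(l in ucell n i) (dens l)%:E = (n%:R^-1)%:E)%E.
Proof.
move=> iN; have n0 : (0 < n)%N by exact: leq_ltn_trans iN.
have nR : 0 < n%:R :> R by rewrite ltr0n.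
have sub : ulevel (i%:R / n%:R) `<=` ulevel (i.+1%:R / n%:R).
  move=> l [l0 lx]; split => //; rewrite (lt_le_trans lx)// ler_pM2r ?invr_gt0//.
  by rewrite ler_nat.
have E : (\int[mu]_(l in ulevel (i.+1%:R / n%:R)) (dens l)%:E =
    \int[mu]_(l in ulevel (i%:R / n%:R)) (dens l)%:E + \int[mu]_(l in ucell n i) (dens l)%:E)%E.
  rewrite -ge0_integral_setU//.
  - by rewrite /ucell setDUK.
  - by apply: measurable_ulevel; apply: level01 => //; exact: ltnW.
  - exact: measurable_ucell.
  - exact: measurable_funTS measurable_EFin_dens.
  - by move=> l _; rewrite lee_fin mixing_density_ge0.
  - by apply/disj_setPRL => l [].
rewrite !ulevel_integral ?level01 ?(ltnW iN)// in E.
have I0 : (0 <= \int[mu]_(l in ucell n i) (dens l)%:E)%E.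
  by apply: integral_ge0 => l _; rewrite lee_fin mixing_density_ge0.
case: (\int[mu]_(l in ucell n i) _)%E I0 E => [r _ [] E|//|//].
by congr EFin; move: E; rewrite -[i.+1%:R]natr1 mulrDl mul1r => /addrI.
Qed.

Lemma ucellP n i l : (0 < n)%N ->
  ucell n i l <-> 0 < l /\ Num.truncn (n%:R * ulam l) = i.
Proof.
move=> n0; have nR : 0 < n%:R :> R by rewrite ltr0n.
have E l' : 0 < l' -> 0 <= n%:R * ulam l' by move=> l0; rewrite mulr_ge0// ltW// ulam_gt0// ltW.
split.
  move=> [[l0]]; rewrite ltr_pdivlMr// mulrC => h1 h2; split => //.
  apply/eqP; rewrite truncn_eq ?E// h1 andbT leNgt; apply/negP => h3; apply: h2; split => //.
  by rewrite ltr_pdivlMr// mulrC.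
move=> [l0 /eqP]; rewrite truncn_eq ?E// => /andP[h1 h2]; split.
  by split => //; rewrite ltr_pdivlMr// mulrC.
by move=> [_]; rewrite ltr_pdivlMr// mulrC ltNge h1.
Qed.

Lemma ucell_index n l : (0 < n)%N -> 0 < l -> (Num.truncn (n%:R * ulam l) < n)%N.
Proof.
move=> n0 l0; have nR : 0 < n%:R :> R by rewrite ltr0n.
have u0 : 0 <= n%:R * ulam l by rewrite mulr_ge0// ltW// ulam_gt0// ltW.
have /andP[h _] := truncn_itv u0; rewrite -(ltr_nat R); apply: (le_lt_trans h).
by rewrite gtr_pMr// -ulam0 ulam_decr.
Qed.

(** Turns the average of a over n indices into an integral against the density, which takes the
    place of a change of variables in the limit. *)
Definition ustep (a : nat -> R) n l : R := \sum_(i < n) a i * \1_(ucell n i) l.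

Lemma ustepE a n l : (0 < n)%N -> 0 < l -> ustep a n l = a (Num.truncn (n%:R * ulam l)).
Proof.
move=> n0 l0; rewrite /ustep (bigD1 (Ordinal (ucell_index n0 l0)))//= big1 ?addr0.
  by rewrite indicE mem_set ?mulr1//; apply/ucellP.
move=> i ij; rewrite indicE memNset ?mulr0// => /(ucellP _ _ n0)[_ E].
by move/eqP: ij; apply; apply/val_inj.
Qed.

Lemma measurable_ustep a n : measurable_fun setT (ustep a n).
Proof.
apply: measurable_sum => i; apply: measurable_funM => //.
by apply: measurable_indic; exact: measurable_ucell.
Qed.

Lemma ustep_integral (a : nat -> R) n : (0 < n)%N -> (forall i, 0 <= a i) ->
  (\int[mu]_(l in `]0%R, +oo[) (ustep a n l * dens l)%:E =
   (n%:R^-1 * \sum_(0 <= i < n) a i)%:E)%E.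
Proof.
move=> n0 a0.
under eq_integral do rewrite /ustep mulr_suml -sumEFin.
rewrite ge0_integral_sum//; last 2 first.
- move=> i; apply/measurable_EFinP; apply: measurable_funTS.
  apply: measurable_funM; last exact: measurable_mixing_density.
  by apply: measurable_funM => //; apply: measurable_indic; exact: measurable_ucell.
- move=> i l _; rewrite lee_fin; apply: mulr_ge0; last exact: mixing_density_ge0.
  by apply: mulr_ge0; [exact: a0|rewrite indicE].
rewrite mulr_sumr -sumEFin big_mkord; apply: eq_bigr => i _.
have -> : (\int[mu]_(l in `]0%R, +oo[) (a i * \1_(ucell n i) l * dens l)%:E =
    \int[mu]_(l in ucell n i) (a i * dens l)%:E)%E.
  rewrite [LHS]integral_mkcond [RHS]integral_mkcond; apply: eq_integral => l _.
  rewrite !patchE indicE; have [li|li] := boolP (l \in ucell n i).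
    rewrite mulr1 ifT// inE/= in_itv/= andbT.
    by move/set_mem : li => /(ucellP _ _ n0)[].
  by rewrite mulr0 mul0r if_same.
under eq_integral do rewrite EFinM.
rewrite ge0_integralZl//; last 4 first.
- exact: measurable_ucell.
- exact: measurable_funTS measurable_EFin_dens.
- by move=> l _; rewrite lee_fin mixing_density_ge0.
- by rewrite lee_fin.
by rewrite ucell_integral// -EFinM mulrC.
Qed.

(** Dominated convergence for the step functions, with the density itself as majorant. *)
Lemma ustep_average_limit (A : nat -> nat -> R) (h : R -> R) :
  (forall n i, 0 <= A n i <= 1) -> measurable_fun setT h ->
  (forall l, 0 < l -> A n (Num.truncn (n%:R * ulam l)) @[n --> \oo] --> h l) ->
  (n%:R^-1 * \sum_(0 <= i < n) A n i)%:E @[n --> \oo] -->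
    (\int[mu]_(l in `]0%R, +oo[) (h l * dens l)%:E)%E.
Proof.
move=> A01 mh Ah.
pose D : set R := `]0, +oo[%classic.
pose f n l := (ustep (A n.+1) n.+1 l * dens l)%:E.
have mf n : measurable_fun D (f n).
  apply/measurable_EFinP; apply: measurable_funTS.
  by apply: measurable_funM; [exact: measurable_ustep|exact: measurable_mixing_density].
have mhd : measurable_fun D (fun l => (h l * dens l)%:E).
  apply/measurable_EFinP; apply: measurable_funTS.
  by apply: measurable_funM => //; exact: measurable_mixing_density.
have hae : {ae mu, forall l, D l -> f ^~ l @ \oo --> (h l * dens l)%:E}.
  apply: aeW => l; rewrite /D /= in_itv/= andbT => l0.
  apply: cvg_EFin; first exact: nearW.
  apply: cvgM; last exact: cvg_cst.
  have := Ah l l0; rewrite -cvg_shiftS; apply: cvg_trans; apply: near_eq_cvg.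
  by apply: nearW => n /=; rewrite ustepE.
have hdom : {ae mu, forall l n, D l -> (`|f n l| <= (EFin \o dens) l)%E}.
  apply: aeW => l n; rewrite /D /= in_itv/= andbT => l0.
  rewrite lee_fin normrM (ger0_norm (mixing_density_ge0 l)).
  rewrite ler_piMl ?mixing_density_ge0// ustepE//.
  by have /andP[h0 h1] := A01 n.+1 (Num.truncn (n.+1%:R * ulam l)); rewrite ger0_norm.
have [_ _] := @dominated_convergence _ _ _ mu D (measurable_itv _) f _ _ mf mhd hae
  mixing_density_integrable hdom.
rewrite -(cvg_shiftS (fun n => (n%:R^-1 * \sum_(0 <= i < n) A n i)%:E)).
apply: cvg_trans; apply: near_eq_cvg; apply: nearW => n /=.
by rewrite -ustep_integral// => i; have /andP[] := A01 n.+1 i.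
Qed.

End mixing_density.

(** * The generating function of the mixed Poisson law *)

Section generating_function.
Variables (R : realType) (gamma beta : R).
Hypotheses (gamma01 : 0 < gamma < 1) (beta0 : 0 < beta).
Local Notation mu := (@lebesgue_measure R).
Local Notation dens := (mixing_density gamma beta).

(** The Laplace transform of the mixing law at c, which is the generating function of the mixed
    Poisson law at 1 - c. *)
Definition mixed_gen (c : R) : \bar R :=
  (\int[mu]_(l in `]0%R, +oo[) (expR (- (c * l)) * dens l)%:E)%E.

Lemma measurable_expR_scale (c : R) : measurable_fun setT (fun l : R => expR (- (c * l))).
Proof.
apply: (measurableT_comp (@measurable_expR R)); apply: (@measurable_funN _ _ _ _ (fun l => c * l)).
exact: mulrl_measurable.
Qed.

Lemma expR_nneseries (x : R) : 0 <= x ->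
  (\sum_(0 <= k <oo) (x ^+ k / k`!%:R)%:E = (expR x)%:E)%E.
Proof.
move=> x0; apply/cvg_lim => //.
have h : series (exp_coeff x) n @[n --> \oo] --> expR x by exact: is_cvg_series_exp_coeff.
apply: cvg_EFin; first by apply: nearW => n; rewrite sumEFin.
by apply: cvg_trans h; apply: near_eq_cvg; apply: nearW => n /=; rewrite sumEFin.
Qed.

(** Tonelli brings the sum inside the integral, where exp(-l) exp((1 - c) l) = exp(-c l). *)
Lemma mixed_gen_series (c : R) : 0 <= c <= 1 ->
  (\sum_(0 <= k <oo) ((1 - c) ^+ k)%:E * mixed_poisson_pmf gamma beta k = mixed_gen c)%E.
Proof.
move=> /andP[c0 c1]; have t0 : 0 <= 1 - c by rewrite subr_ge0.
have m k : measurable_fun (`]0, +oo[%classic : set R)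
    (fun l => (expR (- l) * (l ^+ k / k`!%:R) * dens l)%:E).
  apply/measurable_EFinP; apply: measurable_funTS; apply: measurable_funM; last exact: measurable_mixing_density.
  apply: measurable_funM; last by apply: measurable_funM => //; exact: exprn_measurable.
  exact: (measurableT_comp (@measurable_expR R) (@oppr_measurable R setT)).
have p k l : l \in (`]0, +oo[%classic : set R) -> (0 <= (expR (- l) * (l ^+ k / k`!%:R) * dens l)%:E)%E.
  rewrite inE/= in_itv/= andbT => l0.
  by rewrite lee_fin !mulr_ge0 ?expR_ge0 ?exprn_ge0 ?invr_ge0 ?(ltW l0) ?mixing_density_ge0 ?powR_ge0.
transitivity (\sum_(0 <= k <oo) \int[mu]_(l in `]0%R, +oo[)
    (((1 - c) ^+ k)%:E * (expR (- l) * (l ^+ k / k`!%:R) * dens l)%:E))%E.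
  apply: eq_eseriesr => k _; rewrite /mixed_poisson_pmf ge0_integralZl//.
  - exact: m.
  - by move=> l l0; apply: p; rewrite inE.
  - by rewrite lee_fin exprn_ge0.
rewrite -integral_nneseries//; last 2 first.
- by move=> k; apply: measurable_funeM; exact: m.
- move=> k l l0; apply: mule_ge0; first by rewrite lee_fin exprn_ge0.
  by apply: p; rewrite inE.
apply: eq_integral => l; rewrite inE/= in_itv/= andbT => l0.
transitivity (\sum_(0 <= k <oo) (expR (- l) * dens l)%:E * (((1 - c) * l) ^+ k / k`!%:R)%:E)%E.
  apply: eq_eseriesr => k _; rewrite -!EFinM; congr (_%:E).
  by rewrite exprMn; ring.
rewrite nneseriesZl; last first.
  by move=> k _; rewrite lee_fin !mulr_ge0 ?invr_ge0 ?exprn_ge0// mulr_ge0// ltW.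
rewrite expR_nneseries; last by rewrite mulr_ge0// ltW.
rewrite -EFinM; congr (_%:E); rewrite mulrAC -expRD; congr (expR _ * _); ring.
Qed.

Lemma mixed_gen0 : mixed_gen 0 = 1%E.
Proof.
rewrite -(mixing_density_integral gamma01 beta0); apply: eq_integral => l _.
by rewrite mul0r oppr0 expR0 mul1r.
Qed.

Lemma mixed_gen_fin (c : R) : 0 <= c -> mixed_gen c \is a fin_num.
Proof.
move=> c0; have g0 : (0 <= mixed_gen c)%E.
  by apply: integral_ge0 => l _; rewrite lee_fin mulr_ge0 ?expR_ge0 ?mixing_density_ge0.
rewrite ge0_fin_numE//; apply: (@le_lt_trans _ _ 1%E); last exact: ltry.
rewrite -(mixing_density_integral gamma01 beta0); apply: ge0_le_integral => //.
- by move=> l _; rewrite lee_fin mulr_ge0 ?expR_ge0 ?mixing_density_ge0.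
- apply/measurable_EFinP; apply: measurable_funTS; apply: measurable_funM.
    exact: measurable_expR_scale.
  exact: measurable_mixing_density.
- by apply/measurable_EFinP; apply: measurable_funTS; exact: measurable_mixing_density.
- move=> l; rewrite /= in_itv/= andbT => l0; rewrite lee_fin ler_piMl ?mixing_density_ge0//.
  by rewrite expR_le1 oppr_le0 mulr_ge0// ltW.
Qed.

Section pathwise.
Variables (kappa : R -> R) (tau : nat -> R).
Hypotheses (kappa01 : forall r, 0 <= kappa r <= 1)
  (kappa_le : forall r, 0 < r -> kappa r <= r^-1)
  (kappa_asymp : forall e : R, 0 < e ->
     exists2 r0 : R, 0 < r0 & forall r, r0 <= r -> 1 - e <= r * kappa r).
Hypotheses (tau0 : forall n, 0 < tau n)
  (tau_asymp : tau n.+1 / n.+1%:R @[n --> \oo] --> (1 : R)).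

Lemma truncn_ratio (v : R) : 0 <= v ->
  (Num.truncn (n%:R * v))%:R / n%:R @[n --> \oo] --> v.
Proof.
move=> v0; have inv0 : (n%:R : R)^-1 @[n --> \oo] --> (0 : R).
  by rewrite -cvg_shiftS /=; exact: cvg_harmonic.
have lo : v - n%:R^-1 @[n --> \oo] --> v.
  by rewrite -[X in _ --> X]subr0; apply: cvgB => //; exact: cvg_cst.
apply: squeeze_cvgr lo (cvg_cst v).
exists 1%N => // n /= n0; have nR : 0 < n%:R :> R by rewrite ltr0n.
have /andP[h1 h2] := truncn_itv (mulr_ge0 (ltW nR) v0).
rewrite -[X in _ <= _ <= X](mulKf (lt0r_neq0 nR)) [X in _ <= _ <= X]mulrC.
rewrite ler_pM2r ?invr_gt0// h1 andbT ler_pdivlMr// mulrBl mulVf ?gt_eqF//.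
by rewrite lerBlDr natr1 mulrC ltW.
Qed.

(** The index of the cell containing l has relative age tending to [ulam l], where the limiting mean
    indegree is lam (ulam l) = l. *)
Lemma pathwise_average (c : R) : 0 <= c <= 1 ->
  (n%:R^-1 * \sum_(0 <= i < n) \prod_(i.+1 <= j < n)
     (1 - c * kappa (trate gamma beta tau i j)))%:E @[n --> \oo] --> mixed_gen c.
Proof.
move=> c01; have /andP[c0 c1] := c01.
apply: (ustep_average_limit gamma01 beta0 (h := fun l => expR (- (c * l)))
  (A := fun n i => \prod_(i.+1 <= j < n) (1 - c * kappa (trate gamma beta tau i j)))).
- move=> n i; have h j : 0 <= 1 - c * kappa (trate gamma beta tau i j) <= 1.
    by have /andP[k0 k1] := kappa01 (trate gamma beta tau i j); apply/andP; split; nra.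
  by rewrite prodr_ge0 ?prodr_ile1// => j _; have /andP[] := h j.
- exact: measurable_expR_scale.
- move=> l l0; rewrite -[X in expR (- (c * X))](ulamK gamma01 beta0 (ltW l0)).
  have u0 := ulam_gt0 gamma01 beta0 (ltW l0).
  apply: prod_limit => //; last exact: truncn_ratio (ltW u0).
  by rewrite u0 -(ulam0 gamma beta0) ulam_decr.
Qed.

End pathwise.
End generating_function.

(** * Second moments on regular configurations *)

Section second_moment.
Context {R : realType} {dO} {Omega : measurableType dO} (P : probability Omega R).
Variables (n : nat) (e m : nat -> Omega -> R) (r : nat -> nat -> Omega -> R).
Variables (A : set Omega) (B : R).
Hypotheses (mA : measurable A) (be : forall i, bmf (e i)) (bm : forall i, bmf (m i))
  (br : forall i j, bmf (r i j)).
Hypotheses (e01 : forall i w, 0 <= e i w <= 1) (m01 : forall i w, 0 <= m i w <= 1)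
  (r0 : forall i j w, 0 <= r i j w).
Hypothesis Ex_em : forall i, Ex P (fun w => \1_A w * e i w) = Ex P (fun w => \1_A w * m i w).
Hypothesis Ex_em2 : forall i i', (i < i')%N -> (i' < n)%N ->
  Ex P (fun w => \1_A w * (e i w * e i' w)) <=
  Ex P (fun w => \1_A w * (m i w * m i' w)) +
  Ex P (fun w => \1_A w * \sum_(j < n) r i j w * r i' j w).
Hypothesis rB : forall j w, A w -> (j < n)%N -> \sum_(i < n) r i j w <= B.

Let bA : bmf (\1_A : Omega -> R). Proof. exact: bmf_indic. Qed.
Let A0 w : 0 <= (\1_A w : R). Proof. by rewrite indicE. Qed.
Let pair_le (i i' : 'I_n) :
  Ex P (fun w => \1_A w * (e i w * e i' w)) <=
  Ex P (fun w => \1_A w * (m i w * m i' w)) +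
  Ex P (fun w => \1_A w * \sum_(j < n) r i j w * r i' j w) +
  (i == i')%:R * Ex P (\1_A : Omega -> R).
Proof.
have bc : bmf (fun w => \sum_(j < n) r i j w * r i' j w).
  by apply: bmf_sum => j; apply: bmfM.
have [<-|ii'] := eqVneq i i'.
  rewrite mul1r -[leLHS]add0r lerD//.
    rewrite addr_ge0// Ex_ge0// => w; rewrite mulr_ge0//.
      by rewrite mulr_ge0//; have /andP[] := m01 i w.
    by apply: sumr_ge0 => j _; rewrite mulr_ge0.
  apply: Ex_le => //; first by apply: bmfM => //; exact: bmfM.
  move=> w; rewrite ler_piMr//; have /andP[? ?] := e01 i w; exact: mulr_ile1.
rewrite mul0r addr0; have [ii|ii|/val_inj ii] := ltngtP i i'; first exact: Ex_em2.
  have -> : Ex P (fun w => \1_A w * (e i w * e i' w)) = Ex P (fun w => \1_A w * (e i' w * e i w)).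
    by apply: eq_Ex => w; rewrite [e i w * _]mulrC.
  apply: (le_trans (Ex_em2 ii (ltn_ord i))); rewrite le_eqVlt; apply/orP; left; apply/eqP.
  congr (_ + _); apply: eq_Ex => w; first by rewrite [m i w * _]mulrC.
  by congr (_ * _); apply: eq_bigr => j _; rewrite mulrC.
by rewrite ii eqxx in ii'.
Qed.

(** First moments agree exactly, so the squares differ in the pair terms only. The diagonal costs n,
    and the common-neighbour errors add up to sum_j (sum_i r_ij)^2 <= n B^2: order n, against the
    order n^2 of the square. *)
Lemma second_moment (a : R) :
  Ex P (fun w => \1_A w * (\sum_(i < n) e i w - a) ^+ 2) <=
  Ex P (fun w => \1_A w * (\sum_(i < n) m i w - a) ^+ 2) +
  (n%:R + n%:R * B ^+ 2) * Ex P (\1_A : Omega -> R).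
Proof.
have expand (h : nat -> Omega -> R) : (forall i, bmf (h i)) ->
    Ex P (fun w => \1_A w * (\sum_(i < n) h i w - a) ^+ 2) =
    \sum_(i < n) \sum_(i' < n) Ex P (fun w => \1_A w * (h i w * h i' w)) -
    2 * a * (\sum_(i < n) Ex P (fun w => \1_A w * h i w)) + a ^+ 2 * Ex P (\1_A : Omega -> R).
  move=> bh.
  have b1 i i' : bmf (fun w => \1_A w * (h i w * h i' w)) by apply: bmfM => //; exact: bmfM.
  have b2 i : bmf (fun w => \1_A w * h i w) by exact: bmfM.
  transitivity (Ex P (fun w => \sum_(i < n) \sum_(i' < n) \1_A w * (h i w * h i' w) -
      (2 * a) * (\sum_(i < n) \1_A w * h i w) + a ^+ 2 * \1_A w)).
    apply: eq_Ex => w.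
    have -> : \sum_(i < n) \sum_(i' < n) \1_A w * (h i w * h i' w) =
        \1_A w * (\sum_(i < n) h i w) ^+ 2.
      rewrite expr2 mulr_suml mulr_sumr; apply: eq_bigr => i _.
      by rewrite mulr_sumr mulr_sumr; apply: eq_bigr.
    rewrite -mulr_sumr; move: (\1_A w : R) (\sum_(i < n) h i w) => x y; ring.
  have bS2 : bmf (fun w => \sum_(i < n) \sum_(i' < n) \1_A w * (h i w * h i' w)).
    by apply: bmf_sum => i; apply: bmf_sum => i'.
  have bS1 : bmf (fun w => \sum_(i < n) \1_A w * h i w) by apply: bmf_sum => i.
  have bcst (x : R) (f : Omega -> R) : bmf f -> bmf (fun w => x * f w).
    by move=> bf; apply: bmfM => //; exact: bmf_cst.
  rewrite ExD ?ExB ?ExZ//; [|exact: bcst|by apply: bmfB => //; exact: bcst|exact: bcst].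
  rewrite !Ex_sum//; last by move=> i; apply: bmf_sum => i'.
  congr (_ - _ + _); apply: eq_bigr => i _; by rewrite Ex_sum.
rewrite !expand//.
have -> : \sum_(i < n) Ex P (fun w => \1_A w * e i w) =
  \sum_(i < n) Ex P (fun w => \1_A w * m i w) by apply: eq_bigr.
rewrite [leRHS]addrAC lerD2r [leRHS]addrAC lerD2r.
apply: (@le_trans _ _ (\sum_(i < n) \sum_(i' < n)
  (Ex P (fun w => \1_A w * (m i w * m i' w)) +
  Ex P (fun w => \1_A w * \sum_(j < n) r i j w * r i' j w) +
  (i == i')%:R * Ex P (\1_A : Omega -> R)))).
  by apply: ler_sum => i _; apply: ler_sum => i' _; exact: pair_le.
have -> : \sum_(i < n) \sum_(i' < n)
  (Ex P (fun w => \1_A w * (m i w * m i' w)) +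
  Ex P (fun w => \1_A w * \sum_(j < n) r i j w * r i' j w) +
  (i == i')%:R * Ex P (\1_A : Omega -> R)) =
  \sum_(i < n) \sum_(i' < n) Ex P (fun w => \1_A w * (m i w * m i' w)) +
  Ex P (fun w => \1_A w * \sum_(j < n) (\sum_(i < n) r i j w) ^+ 2) +
  n%:R * Ex P (\1_A : Omega -> R).
  under eq_bigr do rewrite !big_split/=.
  rewrite !big_split/=; congr (_ + _ + _).
    have b i i' : bmf (fun w => \1_A w * \sum_(j < n) r i j w * r i' j w).
      by apply: bmfM => //; apply: bmf_sum => j; exact: bmfM.
    under eq_bigr do rewrite -Ex_sum//.
    rewrite -Ex_sum; last by move=> i; exact: bmf_sum.
    apply: eq_Ex => w.
    rewrite (eq_bigr (fun i : 'I_n => \1_A w *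
      \sum_(i' < n) \sum_(j < n) r i j w * r i' j w)); last first.
      by move=> i _; rewrite mulr_sumr.
    rewrite -mulr_sumr; congr (_ * _).
    transitivity (\sum_(i < n) \sum_(j < n) r i j w * \sum_(i' < n) r i' j w).
      apply: eq_bigr => i _; rewrite exchange_big/=; apply: eq_bigr => j _.
      by rewrite mulr_sumr.
    by rewrite exchange_big/=; apply: eq_bigr => j _; rewrite expr2 mulr_suml.
  rewrite (eq_bigr (fun _ => Ex P (\1_A : Omega -> R))).
    by rewrite sumr_const card_ord mulr_natl.
  move=> i _; rewrite (bigD1 i)//= eqxx mul1r big1 ?addr0// => i' ii'.
  by rewrite eq_sym (negbTE ii') mul0r.
rewrite -addrA lerD2l [leRHS]mulrDl addrC lerD2l.
rewrite -ExZ//; apply: Ex_le.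
- have bq (j : 'I_n) : bmf (fun w => \sum_(i < n) r i j w) by apply: bmf_sum => i.
  apply: bmfM => //; apply: bmf_sum => j.
  by under eq_fun do rewrite expr2; exact: bmfM.
- by apply: bmfM => //; exact: bmf_cst.
move=> w; rewrite [leRHS]mulrC indicE; have [/set_mem Aw|_] := boolP (w \in A); last by rewrite !mul0r.
rewrite !mul1r; apply: (@le_trans _ _ (\sum_(j < n) B ^+ 2)).
  apply: ler_sum => j _; have h := rB Aw (ltn_ord j).
  have h0 : 0 <= \sum_(i < n) r i j w by apply: sumr_ge0.
  by rewrite ler_pXn2r// nnegrE// (le_trans h0).
by rewrite sumr_const card_ord mulr_natl.
Qed.

End second_moment.

(** * Regular configurations, split by the number of vertices *)

Section cells.
Context {R : realType} {dO : measure_display} {Omega : measurableType dO}.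
Variable P : probability Omega R.
Variable T : nat -> {RV P >-> measurableTypeR R}.
Hypothesis poissonT : unit_poisson_process T.
Local Notation sigT := (generated_sigma_algebra T).
Local Notation genT := (\bigcup_n preimage_set_system setT (T n) measurable).
Local Notation OmegaT := (g_sigma_algebraType genT).

Let T_gt0 w : 0 < (T 0%N w : R). Proof. by case: poissonT => + _ _; exact. Qed.
Let T_incr n w : (T n w : R) < T n.+1 w. Proof. by case: poissonT => _ + _; exact. Qed.

(** Linear bounds valid for all indices at once. They make n comparable to t and edge probabilities
    comparable to [weight], with constants depending on M only. *)
Definition regular (M : nat) : set Omega :=
  [set w | forall i, i.+1%:R / M.+1%:R <= (T i w : R) <= M.+1%:R * i.+1%:R].

(* On [cell M t n] the vertices of G_t are exactly 0, ..., n-1. *)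
Definition cell (M : nat) (t : R) (n : nat) : set Omega :=
  regular M `&` ([set w | t < (T n w : R)] `&` \bigcap_(j < n) [set w | (T j w : R) <= t]).

(** Exceeds the number of vertices at time t on [regular M], so the splitting into cells is a finite
    sum. *)
Definition ncells (M : nat) (t : R) : nat := (Num.truncn (M.+1%:R * t)).+1.

Lemma sigT_preimage i (B : set R) : measurable B -> sigT [set w | B (T i w : R)].
Proof.
move=> mB; apply: sub_sigma_algebra; exists i => //; exists B => //.
by rewrite setTI.
Qed.

Lemma sigT_regular M : sigT (regular M).
Proof.
have -> : regular M = \bigcap_i [set w |
    (`[(i.+1%:R / M.+1%:R)%R, (M.+1%:R * i.+1%:R)%R]%classic : set R) (T i w)].
  by apply/seteqP; split => w h i /=; have := h i; rewrite /= in_itv//=; exact.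
apply: (@bigcapT_measurable _ OmegaT) => i; apply: sigT_preimage; exact: measurable_itv.
Qed.

Lemma sigT_cell M t n : sigT (cell M t n).
Proof.
apply: (@measurableI _ OmegaT); first exact: sigT_regular.
apply: (@measurableI _ OmegaT).
  have := @sigT_preimage n `]t, +oo[%classic (measurable_itv _).
  rewrite (_ : [set w | _] = [set w | t < (T n w : R)])//.
  by apply/seteqP; split => w /=; rewrite in_itv/= andbT.
apply: (@fin_bigcap_measurable _ OmegaT) => // j _.
by have := @sigT_preimage j `]-oo, t]%classic (measurable_itv _); rewrite (_ : [set w | _] = [set w | (T j w : R) <= t]).
Qed.

Lemma measurable_cell M t n : measurable (cell M t n).
Proof. exact: generated_sigma_algebra_measurable (sigT_cell M t n). Qed.

Lemma measurable_regular M : measurable (regular M).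
Proof. exact: generated_sigma_algebra_measurable (sigT_regular M). Qed.

Lemma cell_size M t n w : 0 < t -> cell M t n w -> n%:R <= M.+1%:R * t.
Proof.
move=> t0; case: n => [|n] [rw [tn h]]; first by rewrite mulr_ge0// ltW.
have := h n (ltnSn n); have /andP[+ _] := rw n => h1 /(le_trans h1).
by rewrite ler_pdivrMr// mulrC.
Qed.

Lemma cell_lt_ncells M t n w : 0 < t -> cell M t n w -> (n < ncells M t)%N.
Proof.
move=> t0 /(cell_size t0) nt; rewrite -(ltr_nat R).
by rewrite (le_lt_trans nt)// truncnS_gt.
Qed.

Lemma regular_cell M t w : 0 < t -> regular M w -> exists n, cell M t n w.
Proof.
move=> t0 rw; have : exists n, t < (T n w : R).
  exists (Num.truncn (M.+1%:R * t)); have /andP[+ _] := rw (Num.truncn (M.+1%:R * t)).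
  by apply: lt_le_trans; rewrite ltr_pdivlMr// mulrC truncnS_gt.
move=> /ex_minnP[n tn hn]; exists n; split => //; split => //= j jn.
by rewrite /= leNgt; apply/negP => /hn; rewrite leqNgt jn.
Qed.

Lemma cell_vertices M t n w : cell M t n w -> vertices (fun i w => T i w : R) t w = `I_n.
Proof.
move=> [_ [tn h]]; apply/seteqP; split => i /=; last exact: h.
rewrite /vertices /= => it; rewrite ltnNge; apply/negP => ni.
have := arrival_le poissonT w ni; have := le_lt_trans it tn.
by rewrite ltNge => /negP.
Qed.

Lemma cell_inj M t n n' w : cell M t n w -> cell M t n' w -> n = n'.
Proof.
move=> /cell_vertices h1 /cell_vertices h2.
by apply/card_eq_II; rewrite -h1 -h2; exact: card_eqxx.
Qed.

Lemma sum_cell M t n w (h : nat -> R) : 0 < t -> cell M t n w ->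
  \sum_(k < ncells M t) \1_(cell M t k) w * h k = h n.
Proof.
move=> t0 cw; rewrite (bigD1 (Ordinal (cell_lt_ncells t0 cw)))//= big1 ?addr0.
  by rewrite indicE mem_set// mul1r.
move=> k kn; rewrite indicE memNset ?mul0r// => ck.
by move/eqP: kn; apply; apply/val_inj; exact: cell_inj ck cw.
Qed.

Lemma sum_cell0 M t w (h : nat -> R) : ~ regular M w ->
  \sum_(k < ncells M t) \1_(cell M t k) w * h k = 0.
Proof.
move=> rw; rewrite big1// => k _; rewrite indicE memNset ?mul0r//.
by move=> [].
Qed.

Lemma sum_cell1 M t w : 0 < t ->
  \sum_(k < ncells M t) \1_(cell M t k) w = \1_(regular M) w :> R.
Proof.
move=> t0; have [rw|rw] := pselect (regular M w).
  have [n cw] := regular_cell t0 rw.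
  have := sum_cell (fun=> 1) t0 cw; under eq_bigr do rewrite mulr1.
  by move=> ->; rewrite indicE mem_set.
have := sum_cell0 t (fun=> 1) rw; under eq_bigr do rewrite mulr1.
by move=> ->; rewrite indicE memNset.
Qed.

Lemma regular_nondecreasing : nondecreasing_seq regular.
Proof.
move=> M N MN; apply/subsetPset => w rw i; have /andP[h1 h2] := rw i.
rewrite (le_trans _ h1)/=; last by rewrite ler_pM2l// lef_pV2 ?posrE// ler_nat.
by rewrite (le_trans h2)// ler_pM2r// ler_nat.
Qed.

Lemma regular_prob : P (regular M) @[M --> \oo] --> 1%E.
Proof.
have [N [PN mN] hN] := arrival_asymptotic poissonT.
have mU : measurable (\bigcup_M regular M) by apply: bigcupT_measurable => M; exact: measurable_regular.
have U1 : P (\bigcup_M regular M) = 1%E.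
  have NU : ~` N `<=` \bigcup_M regular M.
    move=> w Nw; have half : (0 : R) < 2^-1 by [].
    move/cvgrPdist_le : (hN w Nw) => /(_ _ half)[k _ hk].
    have Tp i : 0 < (T i w : R) by exact: arrival_gt0 T_gt0 T_incr i w.
    (* [r i] dominates both ratios that [regular] bounds. Far out it is at most 2 + 4, by the
       asymptotics with tolerance 1/2 and the index shift; the first k + 1 values are absorbed by
       their sum. *)
    pose r i : R := (T i w : R) / i.+1%:R + i.+1%:R / (T i w : R).
    have r0 i : 0 <= r i by rewrite addr_ge0// divr_ge0// ltW.
    have rb i : r i <= 6 + \sum_(j < k.+1) r j.
      have [ik|ik] := ltnP i k.+1.
        by rewrite (bigD1 (Ordinal ik))//= addrCA lerDl addr_ge0// sumr_ge0.
      case: i ik => // i ik; have /= := hk i ik.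
      have iR : 0 < i.+1%:R :> R by [].
      rewrite ler_distl => /andP[]; rewrite lerBlDr ler_pdivrMr// -lerBlDr ler_pdivlMr// => h1 h2.
      have : r i.+1 <= 6; last by move=> /le_trans; apply; rewrite lerDl sumr_ge0.
      have i2 : i.+1%:R + 1 = i.+2%:R :> R by rewrite natr1.
      have i1 : 1 <= i.+1%:R :> R by rewrite ler1n.
      apply: (@le_trans _ _ (2 + 4)); last lra.
      by rewrite /r -i2 lerD// ler_pdivrMr ?Tp//; [lra|lra].
    exists (Num.truncn (6 + \sum_(j < k.+1) r j)) => // i.
    have rM : r i <= (Num.truncn (6 + \sum_(j < k.+1) r j)).+1%:R.
      by rewrite (le_trans (rb i))// ltW// truncnS_gt.
    move: (_.+1%:R : R) rM (ltr0Sn R (Num.truncn (6 + \sum_(j < k.+1) r j))) => m rM m0.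
    rewrite ler_pdivrMr// -ler_pdivrMl// mulrC -ler_pdivrMr//; apply/andP; split.
      by apply: le_trans rM; rewrite lerDr divr_ge0// ltW.
    by apply: le_trans rM; rewrite lerDl divr_ge0// ltW.
  apply/eqP; rewrite eq_le; apply/andP; split; first exact: probability_le1.
  rewrite -[leLHS](_ : P (~` N) = 1%E); first by apply: le_measure => //; rewrite inE//; exact: measurableC.
  by rewrite probability_setC// PN sube0.
rewrite -U1; apply: nondecreasing_cvg_mu => //.
- exact: measurable_regular.
- exact: regular_nondecreasing.
Qed.

End cells.

(** * Calculus of errors that vanish as t tends to infinity *)

Section vanishing.
Variable R : realType.
Implicit Types (F G : R -> R).

(** Only upper bounds are asked for, so the property passes to anything smaller; it is applied to
    nonnegative errors. *)
Definition vanishing F := forall e : R, 0 < e -> exists2 t0 : R, 0 < t0 &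
  forall t, t0 <= t -> F t <= e.

Lemma vanishingD F G : vanishing F -> vanishing G -> vanishing (fun t => F t + G t).
Proof.
move=> hF hG e e0; have e20 : 0 < e / 2 by rewrite divr_gt0.
have [a a0 ha] := hF _ e20; have [b b0 hb] := hG _ e20.
exists (a + b) => [|t abt]; first by rewrite addr_gt0.
by rewrite [leRHS]splitr lerD// ?ha ?hb//; lra.
Qed.

Lemma vanishingZ F c : 0 <= c -> vanishing F -> vanishing (fun t => c * F t).
Proof.
move=> c0 hF e e0; have c1 : 0 < c + 1 by lra.
have [a a0 ha] := hF _ (divr_gt0 e0 c1); exists a => // t /ha h.
apply: (le_trans (ler_wpM2l c0 h)); rewrite mulrA ler_pdivrMr// mulrC.
by rewrite ler_pM2l//; lra.
Qed.

Lemma vanishing_le F G : (forall t, 0 < t -> F t <= G t) -> vanishing G -> vanishing F.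
Proof.
move=> FG hG e e0; have [a a0 ha] := hG _ e0; exists a => // t t0.
by rewrite (le_trans (FG t _))// ?ha// (lt_le_trans a0).
Qed.

Lemma vanishing_sum (n : nat) (F : nat -> R -> R) : (forall i, (i < n)%N -> vanishing (F i)) ->
  vanishing (fun t => \sum_(0 <= i < n) F i t).
Proof.
elim: n => [|n IH] hF.
  by move=> e e0; exists 1 => // t _; rewrite big_geq// ltW.
apply: (@vanishing_le _ (fun t => \sum_(0 <= i < n) F i t + F n t)).
  by move=> t _; rewrite big_nat_recr.
by apply: vanishingD; [apply: IH => i ni; apply: hF; exact: ltnW|exact: hF].
Qed.

(** [G] may depend on the tolerance, so its constants are allowed to blow up as d tends to 0. *)
Lemma vanishing_approx F : (forall d, 0 < d -> exists2 G, vanishing G &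
  forall t, 1 <= t -> F t <= G t + d) -> vanishing F.
Proof.
move=> h e e0; have e20 : 0 < e / 2 by rewrite divr_gt0.
have [G hG FG] := h _ e20; have [a a0 ha] := hG _ e20.
exists (a + 1) => [|t at_]; first by rewrite addr_gt0.
rewrite (le_trans (FG t _))//; first lra.
by rewrite [leRHS]splitr lerD2r ha//; lra.
Qed.

Lemma vanishing_inv : vanishing (fun t => t^-1).
Proof.
move=> e e0; exists e^-1 => [|t et]; first by rewrite invr_gt0.
by rewrite -[e]invrK lef_pV2 ?posrE ?invr_gt0// (lt_le_trans _ et)// invr_gt0.
Qed.

(** Passes from the continuous parameter to sequences, along which dominated convergence applies. *)
Lemma vanishing_seq F : (forall t, 0 <= F t) ->
  (forall u : nat -> R, u n @[n --> \oo] --> +oo -> (forall n, 0 < u n) ->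
    F (u n) @[n --> \oo] --> 0) -> vanishing F.
Proof.
move=> F0 h e e0; apply: contrapT => hn.
have {}hn (n : nat) : exists t : R, n.+1%:R <= t /\ e < F t.
  apply: contrapT => /forallNP k; apply: hn; exists n.+1%:R => // t nt.
  by rewrite leNgt; apply/negP => eF; apply: (k t).
have [u hu] := choice hn.
have u0 n : 0 < u n by apply: lt_le_trans (hu n).1.
have uoo : u n @[n --> \oo] --> +oo.
  apply/cvgryPge => A; exists (Num.truncn `|A|).+1 => // n /= An.
  apply: le_trans (hu n).1; rewrite (le_trans (ler_norm A))// ltW//.
  by rewrite (lt_le_trans (truncnS_gt _))// ler_nat ltnW.
move/cvgrPdist_lt : (h u uoo u0) => /(_ _ e0)[N _ /(_ N (leqnn N))/=].
by rewrite sub0r normrN ger0_norm// => /ltW; rewrite leNgt (hu N).2.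
Qed.

End vanishing.

(** * L^2 convergence of the generating functions on regular configurations *)

Section network_L2.
Context {R : realType} {d : nat} {dO : measure_display} {Omega : measurableType dO}.
Variables (P : probability Omega R) (gamma beta : R) (phi : R -> R).
Variables (T : nat -> {RV P >-> measurableTypeR R}) (X : nat -> {RV P >-> Rspace R d}).
Variable E : nat -> nat -> set Omega.
Hypotheses (d_gt0 : (0 < d)%N) (phi_profile : profile_function d phi).
Hypotheses (gamma01 : 0 < gamma < 1) (beta0 : 0 < beta).
Hypotheses (poissonT : unit_poisson_process T) (iidX : iid_uniform_positions T X)
  (indepE : independent_edges gamma beta phi T X E).
Local Notation q := (qedge (d := d) gamma beta phi T).
Local Notation W := (weight gamma beta).

Let T_gt0 w : 0 < (T 0%N w : R). Proof. by case: poissonT => + _ _; exact. Qed.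
Let T_incr n w : (T n w : R) < T n.+1 w. Proof. by case: poissonT => _ + _; exact. Qed.
Let tau w n : R := T n w.
Let tau0 w n : 0 < tau w n. Proof. exact: arrival_gt0 T_gt0 T_incr n w. Qed.
Let q01 i j w : 0 <= q i j w <= 1. Proof. exact: qedge01. Qed.
Let q0 i j w : 0 <= q i j w. Proof. by case/andP: (q01 i j w). Qed.
Let g0 : 0 < gamma. Proof. by case/andP: gamma01. Qed.
Let g1 : 0 < 1 - gamma. Proof. by rewrite subr_gt0; case/andP: gamma01. Qed.

Lemma kappa_profile r : 0 <= edge_mass d phi r <= 1.
Proof. by rewrite (edge_mass_ge0 phi_profile) (edge_mass_le1 phi_profile). Qed.

Lemma qedge_weight_le M i j w : regular T M w -> q i j w <= M.+1%:R * W i j.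
Proof.
move=> rw; have l0 : 0 < (M.+1%:R : R)^-1 by rewrite invr_gt0.
have /andP[h1 _] := rw i; have /andP[h2 _] := rw j.
rewrite mulrC in h1; rewrite mulrC in h2.
have := @kappa_weight_le R gamma beta (edge_mass d phi) (tau w) gamma01 beta0
  (edge_mass_le d_gt0 phi_profile) (tau0 w) _ i j l0 h1 h2.
by rewrite invrK.
Qed.

(** Uniform in j: a newborn vertex sends out a bounded expected number of edges. This is the source
    of the bound [B] in [second_moment]. *)
Lemma weight_older_sum j : \sum_(0 <= i < j) W i j <= beta / (1 - gamma).
Proof.
have -> : \sum_(0 <= i < j) W i j =
    beta * j.+1%:R `^ (gamma - 1) * \sum_(0 <= i < j) i.+1%:R `^ (- gamma).
  by rewrite mulr_sumr; apply: eq_bigr => i _; rewrite /weight mulrA.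
have c0 : 0 <= beta * j.+1%:R `^ (gamma - 1) by rewrite mulr_ge0 ?powR_ge0 ?(ltW beta0).
apply: (le_trans (ler_wpM2l c0 (sum_powRN_le j gamma01))).
rewrite mulrA ler_wpM2r ?invr_ge0 ?(ltW g1)// -mulrA ler_piMr ?(ltW beta0)//.
rewrite -opprB powRN mulrC ler_pdivrMr ?powR_gt0// mul1r.
by apply: ge0_ler_powR; rewrite ?nnegrE ?(ltW g1)// ler_nat.
Qed.

(** The expected indegree of vertex i grows like (n / i)^gamma; the tail estimate starts from
    this. *)
Lemma weight_younger_sum i n :
  \sum_(i.+1 <= j < n) W i j <= beta / gamma * (n%:R / i.+1%:R) `^ gamma.
Proof.
have R0 : 0 <= beta / gamma * (n%:R / i.+1%:R) `^ gamma.
  by rewrite mulr_ge0 ?powR_ge0 ?divr_ge0 ?(ltW beta0) ?(ltW g0).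
have [ni|ni] := leqP n i.+1; first by rewrite big_geq.
have -> : \sum_(i.+1 <= j < n) W i j =
    beta * i.+1%:R `^ (- gamma) * \sum_(i.+1 <= j < n) j.+1%:R `^ (gamma - 1).
  by rewrite mulr_sumr; apply: eq_bigr => j _; rewrite /weight mulrA mulrAC.
have c0 : 0 <= beta * i.+1%:R `^ (- gamma) by rewrite mulr_ge0 ?powR_ge0 ?(ltW beta0).
apply: (le_trans (ler_wpM2l c0 (sum_powR_le gamma01 (ltnW ni)))).
apply: (@le_trans _ _ (beta * i.+1%:R `^ (- gamma) * (n%:R `^ gamma / gamma))).
  rewrite ler_wpM2l// ler_wpM2r ?invr_ge0 ?(ltW g0)//.
  by rewrite gerBl powR_ge0.
rewrite powRM ?invr_ge0// le_eqVlt; apply/orP; left; apply/eqP.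
have -> : (i.+1%:R : R)^-1 `^ gamma = i.+1%:R `^ (- gamma).
  by rewrite -powR_inv1// -powRrM mulN1r.
by move: (_ `^ (- gamma)) (_ `^ gamma) => x y; field; rewrite gt_eqF.
Qed.

Section fixed_c.
Variable c : R.
Hypothesis c01 : 0 <= c <= 1.

Definition edge_sum n w : R := \sum_(i < n) eprod E c i i.+1 n w.
Definition mean_sum n w : R := \sum_(i < n) qprod c q i i.+1 n w.

Lemma bmf_eprod i n : bmf (eprod E c i i.+1 n : Omega -> R).
Proof.
rewrite /eprod (_ : (fun w => _) = (fun w => \prod_(j <- index_iota i.+1 n)
    (if (i < j)%N then 1 - c * (\1_(E i j) w : R) else 1))).
  apply: bmf_prod => j; case: (ltnP i j) => ij; last exact: bmf_cst.
  by apply: bmf_onem; exact: (bmf_E indepE).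
apply/funext => w; rewrite big_seq [in RHS]big_seq; apply: eq_bigr => j.
by rewrite mem_index_iota => /andP[->].
Qed.

Lemma eprod01 i n w : 0 <= eprod E c i i.+1 n w <= 1.
Proof.
have h j : 0 <= 1 - c * (\1_(E i j) w : R) <= 1.
  have /andP[? ?] := c01; rewrite indicE; case: (_ \in _) => /=; apply/andP; split; lra.
by rewrite prodr_ge0 ?prodr_ile1// => j _; have /andP[] := h j.
Qed.

Lemma bmf_qprodO i n : bmf (qprod c q i i.+1 n : Omega -> R).
Proof. by apply: (bmfT (T := T)); apply: bmf_qprod => i' j; exact: bmf_qedge. Qed.

Lemma qprodO01 i n w : 0 <= qprod c q i i.+1 n w <= 1.
Proof. exact: (qprod01 c01 q01). Qed.

Definition row_bound M : R := M.+1%:R * (beta / (1 - gamma)).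

Lemma cell_second_moment M t n a :
  Ex P (fun w => \1_(cell T M t n) w * (edge_sum n w - a) ^+ 2) <=
  Ex P (fun w => \1_(cell T M t n) w * (mean_sum n w - a) ^+ 2) +
  (n%:R + n%:R * row_bound M ^+ 2) * Ex P (\1_(cell T M t n) : Omega -> R).
Proof.
have sC := @sigT_cell _ _ _ P T M t n.
have bq i j : bmf (q i j) by apply: (bmfT (T := T)); exact: bmf_qedge.
(* Setting r to zero unless i < j lets all sums run over the full index range. *)
apply: (@second_moment _ _ _ P n (fun i => eprod E c i i.+1 n) (fun i => qprod c q i i.+1 n)
  (fun i j w => if (i < j)%N then q i j w else 0)).
- exact: measurable_cell.
- by move=> i; exact: bmf_eprod.
- by move=> i; exact: bmf_qprodO.
- by move=> i j; case: (ltnP i j) => _; [exact: bq|exact: bmf_cst].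
- by move=> i w; exact: eprod01.
- by move=> i w; exact: qprodO01.
- by move=> i j w; case: ifP.
- by move=> i; apply: (Ex_eprod phi_profile beta0 iidX indepE T_gt0 T_incr).
- move=> i i' ii' i'n.
  have -> : (fun w => \1_(cell T M t n) w * \sum_(j < n)
      (if (i < j)%N then q i j w else 0) * (if (i' < j)%N then q i' j w else 0)) =
    (fun w => \1_(cell T M t n) w * \sum_(i'.+1 <= j < n) q i j w * q i' j w).
    apply/funext => w; congr (_ * _).
    rewrite -(big_mkord xpredT (fun j => (if (i < j)%N then q i j w else 0) *
      (if (i' < j)%N then q i' j w else 0))) (big_cat_nat (n := i'.+1))//=.
    rewrite big_nat_cond big1 ?add0r; last first.
      by move=> j /andP[/andP[_ ji'] _]; rewrite [X in _ * X]ifN ?mulr0// -leqNgt.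
    apply: eq_big_nat => j /andP[i'j _]; rewrite i'j ifT//.
    exact: ltn_trans i'j.
  exact: (Ex_eprod2 phi_profile beta0 iidX indepE T_gt0 T_incr).
- move=> j w [rw _] jn.
  rewrite -(big_mkord xpredT (fun i => if (i < j)%N then q i j w else 0)).
  rewrite (big_cat_nat (n := j))//=; last exact: ltnW.
  rewrite [X in _ + X]big_nat_cond [X in _ + X]big1 ?addr0; last first.
    by move=> i /andP[/andP[ji _] _]; rewrite ltnNge ji.
  apply: (@le_trans _ _ (\sum_(0 <= i < j) M.+1%:R * W i j)).
    by apply: ler_sum_nat => i /andP[_ ->]; exact: qedge_weight_le.
  by rewrite -mulr_sumr ler_wpM2l// weight_older_sum.
Qed.

Local Notation G := (fine (mixed_gen gamma beta c)).

Lemma mixed_gen01 : 0 <= G <= 1.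
Proof.
have c0 : 0 <= c by case/andP: c01.
have fG := mixed_gen_fin gamma01 beta0 c0.
rewrite -!lee_fin fineK//; apply/andP; split.
  by apply: integral_ge0 => l _; rewrite lee_fin mulr_ge0 ?expR_ge0 ?mixing_density_ge0.
rewrite -(mixing_density_integral gamma01 beta0); apply: ge0_le_integral => //.
- by move=> l _; rewrite lee_fin mulr_ge0 ?expR_ge0 ?mixing_density_ge0.
- apply/measurable_EFinP; apply: measurable_funTS; apply: measurable_funM.
    exact: measurable_expR_scale.
  exact: measurable_mixing_density.
- by apply/measurable_EFinP; apply: measurable_funTS; exact: measurable_mixing_density.
- move=> l; rewrite /= in_itv/= andbT => l0; rewrite lee_fin ler_piMl ?mixing_density_ge0//.
  by rewrite expR_le1 oppr_le0 mulr_ge0// ltW.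
Qed.

Lemma mean_sum_ge0 n w : 0 <= mean_sum n w.
Proof. by apply: sumr_ge0 => i _; have /andP[] := qprodO01 i n w. Qed.

Lemma mean_sum_le n w : mean_sum n w <= n%:R.
Proof.
apply: (@le_trans _ _ (\sum_(i < n) 1)).
  by apply: ler_sum => i _; have /andP[] := qprodO01 i n w.
by rewrite sumr_const card_ord.
Qed.

Lemma mean_sum_average w : (T n.+1 w : R) / n.+1%:R @[n --> \oo] --> (1 : R) ->
  n%:R^-1 * mean_sum n w @[n --> \oo] --> G.
Proof.
move=> Tn; have c0 : 0 <= c by case/andP: c01.
have := @pathwise_average R gamma beta gamma01 beta0 (edge_mass d phi) (tau w)
  kappa_profile (edge_mass_le d_gt0 phi_profile) (edge_mass_asymp d_gt0 phi_profile)
  (tau0 w) Tn c c01.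
rewrite -[X in _ --> X -> _](fineK (mixed_gen_fin gamma01 beta0 c0)).
move=> /fine_cvgP[_]; apply: cvg_trans; apply: near_eq_cvg; apply: nearW => n /=.
by rewrite big_mkord.
Qed.

Lemma cell_mean_limit M w : regular T M w ->
  (T n.+1 w : R) / n.+1%:R @[n --> \oo] --> (1 : R) ->
  forall e : R, 0 < e -> exists2 t0 : R, 0 < t0 & forall t n, t0 <= t -> cell T M t n w ->
    `|t^-1 * mean_sum n w - G| <= e.
Proof.
(* The ratio n / t contributes an error 2 h and the average an error h, in total 3 h <= e. *)
move=> rw Tn e e0; pose h := Num.min 4^-1 (e / 4).
have h0 : 0 < h by rewrite lt_min invr_gt0 ltr0n divr_gt0.
have h4 : h <= 4^-1 by rewrite ge_min lexx.
have he : h <= e / 4 by rewrite ge_min lexx orbT.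
have [N1 hN1] := @tau_near R (tau w) Tn h h0.
have /cvgrPdist_le /(_ _ h0)[N2 _ hN2] := mean_sum_average Tn.
pose N := (N1 + N2).+1.
(* The first summand gives 1 <= h t, which absorbs the difference between n and n + 1. The second
   forces N < n, as t < T n <= (M + 1) (n + 1). *)
exists (h^-1 + M.+1%:R * N.+1%:R) => [|t n tt0 [_ [tn hn]]].
  by rewrite addr_gt0 ?invr_gt0// mulr_gt0.
have t1 : h^-1 <= t by apply: le_trans tt0; rewrite lerDl mulr_ge0.
have t0 : 0 < t by apply: lt_le_trans t1; rewrite invr_gt0.
have nN : (N < n)%N.
  have /andP[_ h1] := rw n; have h2 := le_lt_trans tt0 (lt_le_trans tn h1).
  have : M.+1%:R * N.+1%:R < M.+1%:R * n.+1%:R :> R.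
    by apply: le_lt_trans h2; rewrite lerDr invr_ge0 ltW.
  by rewrite ltr_pM2l// ltr_nat ltnS.
case: n nN tn hn => // n nN tn hn.
have n1 : (N1 <= n)%N by rewrite -ltnS (leq_trans _ nN)// ltnS /N leqW// leq_addr.
have n2 : (N2 <= n.+1)%N by rewrite (leq_trans _ (ltnW nN))// /N leqW// leq_addl.
have /andP[lo _] := hN1 n n1; have /andP[_ up] := hN1 n.+1 (leqW n1).
have {}lo : (1 - h) * n.+1%:R <= t by exact: le_trans lo (hn n (ltnSn n)).
have {}up : t <= (1 + h) * n.+2%:R by exact: ltW (lt_le_trans tn up).
have /= := hN2 n.+1 n2.
have nR : 0 < n.+1%:R :> R by [].
have s0 := mean_sum_ge0 n.+1 w; have s1 := mean_sum_le n.+1 w.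
have -> : t^-1 * mean_sum n.+1 w = (n.+1%:R / t) * (n.+1%:R^-1 * mean_sum n.+1 w).
  by field; rewrite !gt_eqF.
have x0 : 0 <= n.+1%:R^-1 * mean_sum n.+1 w by rewrite mulr_ge0 ?invr_ge0.
have x1 : n.+1%:R^-1 * mean_sum n.+1 w <= 1 by rewrite mulrC ler_pdivrMr// mul1r.
move: (_^-1 * mean_sum _ w) x0 x1 => x x0 x1; rewrite distrC => xG.
have r1 : n.+1%:R / t <= 1 + 2 * h.
  rewrite ler_pdivrMr//; apply: (@le_trans _ _ ((1 + 2 * h) * ((1 - h) * n.+1%:R))).
    by rewrite mulrA ler_peMl ?(ltW nR)//; nra.
  by rewrite ler_wpM2l//; lra.
have r2 : 1 - 2 * h <= n.+1%:R / t.
  rewrite ler_pdivlMr//; rewrite -[n.+2%:R]natr1 in up.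
  have ht : 1 <= h * t by rewrite -ler_pdivrMl// mulr1.
  have : (1 - h) * t <= n.+1%:R + 1.
    apply: (@le_trans _ _ ((1 - h) * ((1 + h) * (n.+1%:R + 1)))).
      by rewrite ler_wpM2l//; lra.
    by rewrite mulrA ler_piMl ?addr_ge0//; nra.
  lra.
move: (n.+1%:R / t) r1 r2 => r r1 r2.
have -> : r * x - G = (r - 1) * x + (x - G) by ring.
apply: (le_trans (ler_normD _ _)).
have : `|(r - 1) * x| <= 2 * h.
  rewrite normrM (ger0_norm x0) (le_trans (ler_piMr _ x1))//.
  by rewrite ler_norml; apply/andP; split; lra.
lra.
Qed.

Definition mean_error M (t : R) : R :=
  Ex P (fun w => \sum_(n < ncells M t) \1_(cell T M t n) w * (t^-1 * mean_sum n w - G) ^+ 2).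

Let bmf_mean t n : bmf (fun w => (t^-1 * mean_sum n w - G) ^+ 2).
Proof.
have b : bmf (fun w => t^-1 * mean_sum n w - G).
  apply: bmfB; last exact: bmf_cst.
  by apply: bmfM; [exact: bmf_cst|apply: bmf_sum => i; exact: bmf_qprodO].
by under eq_fun do rewrite expr2; exact: bmfM.
Qed.

(** Dominated convergence from the almost sure limit. On a cell the average is at most n / t <= M +
    1, hence the bound (M + 2)^2 on the integrand. *)
Lemma mean_error_vanishing M : vanishing (mean_error M).
Proof.
apply: vanishing_seq => [t|u uoo u0].
  apply: Ex_ge0 => w; apply: sumr_ge0 => n _.
  by rewrite mulr_ge0 ?sqr_ge0// indicE.
have [N [PN mN] hN] := arrival_asymptotic poissonT.
pose f n w := \sum_(k < ncells M (u n)) \1_(cell T M (u n) k) w * ((u n)^-1 * mean_sum k w - G) ^+ 2.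
have bf n : bmf (f n).
  by apply: bmf_sum => k; apply: bmfM => //; apply: bmf_indic; exact: measurable_cell.
have /andP[G0 G1] := mixed_gen01.
have fle n w : 0 <= f n w <= (M.+1%:R + 1) ^+ 2.
  apply/andP; split.
    by apply: sumr_ge0 => k _; rewrite mulr_ge0 ?sqr_ge0// indicE.
  have [rw|rw] := pselect (regular T M w); last first.
    by rewrite /f (sum_cell0 (u n) (fun k => ((u n)^-1 * mean_sum k w - G) ^+ 2) rw) sqr_ge0.
  have [k ck] := regular_cell (u0 n) rw.
  rewrite /f (sum_cell poissonT (fun k => ((u n)^-1 * mean_sum k w - G) ^+ 2) (u0 n) ck).
  have a0 : 0 <= (u n)^-1 * mean_sum k w by rewrite mulr_ge0 ?invr_ge0 ?(ltW (u0 n)) ?mean_sum_ge0.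
  have a1 : (u n)^-1 * mean_sum k w <= M.+1%:R.
    rewrite mulrC ler_pdivrMr//; exact: le_trans (mean_sum_le _ _) (cell_size (u0 n) ck).
  rewrite -real_normK ?num_real// ler_pXn2r ?nnegrE//.
  by rewrite ler_norml; apply/andP; split; have : 0 <= M.+1%:R :> R by []; lra.
have mf n : measurable_fun setT (EFin \o f n) by apply/measurable_EFinP; exact: (bf n).1.
have hae : {ae P, forall w, setT w -> (fun n => (EFin \o f n) w) @ \oo --> 0%E}.
  exists N; split => // w /= hw; apply: contrapT => Nw; apply: hw => _.
  apply: cvg_EFin; first exact: nearW.
  have [rw|rw] := pselect (regular T M w); last first.
    apply: cvg_near_cst; apply: nearW => n /=.
    exact: (sum_cell0 (u n) (fun k => ((u n)^-1 * mean_sum k w - G) ^+ 2) rw).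
  apply/cvgrPdist_le => e e0.
  (* Capping at 1 ensures that the square of the error does not exceed the error. *)
  have e1 : 0 < Num.min e 1 by rewrite lt_min e0 ltr01.
  have [t0 t00 ht0] := cell_mean_limit rw (hN w Nw) e1.
  have /cvgryPge /(_ t0)[n0 _ hn0] := uoo.
  exists n0 => // n /= nn0; have [k ck] := regular_cell (u0 n) rw.
  rewrite sub0r normrN /f (sum_cell poissonT (fun k => ((u n)^-1 * mean_sum k w - G) ^+ 2) (u0 n) ck).
  have := ht0 _ _ (hn0 n nn0) ck; rewrite le_min => /andP[h1 h2].
  rewrite normrX expr2 (le_trans _ h1)// ler_piMl//.
pose B : R := (M.+1%:R + 1) ^+ 2.
have hdom : {ae P, forall w n, setT w -> (`|(EFin \o f n) w| <= (EFin \o cst B) w)%E}.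
  apply: aeW => w n _; rewrite lee_fin; have /andP[h1 h2] := fle n w.
  by rewrite ger0_norm.
have int : P.-integrable setT (EFin \o cst B : Omega -> \bar R).
  by apply: bmf_integrable; exact: bmf_cst.
have [_ _] := @dominated_convergence _ _ _ P setT measurableT (fun n => EFin \o f n) (cst 0%E) _
  mf (measurable_cst _) hae int hdom.
rewrite integral0 => /fine_cvgP[_]; apply: cvg_trans; apply: near_eq_cvg.
by apply: nearW => n.
Qed.

Definition L2_error M (t : R) : R :=
  Ex P (fun w => \sum_(n < ncells M t) \1_(cell T M t n) w * (t^-1 * edge_sum n w - G) ^+ 2).

(** The excess over [mean_error] is t^-2 n (1 + B^2) on each cell, and n <= (M + 1) t there, so
    summing over cells leaves an error of order 1 / t. *)
Lemma L2_error_vanishing M : vanishing (L2_error M).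
Proof.
apply: (@vanishing_le _ _ (fun t => mean_error M t + M.+1%:R * (1 + row_bound M ^+ 2) * t^-1)); last first.
  apply: vanishingD; first exact: mean_error_vanishing.
  apply: vanishingZ; last exact: vanishing_inv.
  by rewrite mulr_ge0// addr_ge0// sqr_ge0.
move=> t t0; have t0' : t != 0 by rewrite gt_eqF.
have bC n : bmf (\1_(cell T M t n) : Omega -> R) by apply: bmf_indic; exact: measurable_cell.
have bS (S : nat -> Omega -> R) (x y : R) n : bmf (S n) -> bmf (fun w => (x * S n w - y) ^+ 2).
  move=> b; have b' : bmf (fun w => x * S n w - y).
    by apply: bmfB; [apply: bmfM => //; exact: bmf_cst|exact: bmf_cst].
  by under eq_fun do rewrite expr2; exact: bmfM.
have be n : bmf (edge_sum n) by apply: bmf_sum => i; exact: bmf_eprod.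
have bm n : bmf (mean_sum n) by apply: bmf_sum => i; exact: bmf_qprodO.
have scale (S : nat -> Omega -> R) n : bmf (S n) ->
    Ex P (fun w => \1_(cell T M t n) w * (t^-1 * S n w - G) ^+ 2) =
    t^-1 ^+ 2 * Ex P (fun w => \1_(cell T M t n) w * (S n w - t * G) ^+ 2).
  move=> b; rewrite -ExZ.
    apply: eq_Ex => w; rewrite [RHS]mulrCA -[in RHS]exprMn; congr (_ * _ ^+ 2).
    by rewrite mulrBr mulKf.
  by apply: bmfM => //; have := bS S 1 (t * G) n b; under eq_fun do rewrite mul1r.
rewrite /L2_error /mean_error Ex_sum; last by move=> n; apply: bmfM => //; exact: bS.
rewrite Ex_sum; last by move=> n; apply: bmfM => //; exact: bS.
have key (n : 'I_(ncells M t)) :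
    Ex P (fun w => \1_(cell T M t n) w * (t^-1 * edge_sum n w - G) ^+ 2) <=
    Ex P (fun w => \1_(cell T M t n) w * (t^-1 * mean_sum n w - G) ^+ 2) +
    M.+1%:R * (1 + row_bound M ^+ 2) * t^-1 * Ex P (\1_(cell T M t n) : Omega -> R).
  rewrite !scale//.
  have t2 : 0 <= t^-1 ^+ 2 by rewrite sqr_ge0.
  apply: (le_trans (ler_wpM2l t2 (cell_second_moment M t n (t * G)))).
  rewrite mulrDr lerD2l.
  have -> : (n%:R + n%:R * row_bound M ^+ 2) * Ex P (\1_(cell T M t n) : Omega -> R) =
      (1 + row_bound M ^+ 2) * Ex P (fun w => n%:R * (\1_(cell T M t n) w : R)).
    by rewrite ExZ//; ring.
  have h : Ex P (fun w => n%:R * (\1_(cell T M t n) w : R)) <=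
      (M.+1%:R * t) * Ex P (\1_(cell T M t n) : Omega -> R).
    rewrite -ExZ//; apply: Ex_le => [| |w]; try by apply: bmfM => //; exact: bmf_cst.
    rewrite indicE; have [/set_mem cw|_] := boolP (w \in _); last by rewrite !mulr0.
    by rewrite !mulr1 (cell_size t0 cw).
  have r0 : 0 <= 1 + row_bound M ^+ 2 by rewrite addr_ge0// sqr_ge0.
  apply: (le_trans (ler_wpM2l t2 (ler_wpM2l r0 h))).
  by rewrite le_eqVlt; apply/orP; left; apply/eqP; field.
apply: (le_trans (ler_sum _ (fun n _ => key n))).
rewrite big_split/= lerD2l -mulr_sumr -Ex_sum//.
have c0 : 0 <= M.+1%:R * (1 + row_bound M ^+ 2) * t^-1.
  by rewrite !mulr_ge0 ?invr_ge0 ?(ltW t0)// addr_ge0// sqr_ge0.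
rewrite -[leRHS]mulr1 ler_wpM2l//.
have -> : Ex P (fun w => \sum_(n < ncells M t) (\1_(cell T M t n) w : R)) =
    Ex P (\1_(regular T M) : Omega -> R).
  by apply: eq_Ex => w; rewrite (sum_cell1 poissonT).
rewrite -[leRHS](Ex_cst P); apply: Ex_le => [| |w]; last by rewrite indicE; case: (_ \in _).
  by apply: bmf_indic; exact: measurable_regular.
exact: bmf_cst.
Qed.

End fixed_c.
End network_L2.

(** * Convergence of indegree averages *)

Section cell_sums.
Context {R : realType} {dO : measure_display} {Omega : measurableType dO}.
Variable P : probability Omega R.
Variable T : nat -> {RV P >-> measurableTypeR R}.
Hypothesis poissonT : unit_poisson_process T.
Implicit Types (F H : nat -> Omega -> R).

(* Expectation of F N 1_(regular M), where N is the number of vertices of G_t. *)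
Definition cell_mean M t F : R :=
  Ex P (fun w => \sum_(n < ncells M t) \1_(cell T M t n) w * F n w).

Lemma bmf_cell M t n : bmf (\1_(cell T M t n) : Omega -> R).
Proof. by apply: bmf_indic; exact: measurable_cell. Qed.

Lemma bmf_cell_sum M t F : (forall n, bmf (F n)) ->
  bmf (fun w => \sum_(n < ncells M t) \1_(cell T M t n) w * F n w).
Proof. by move=> bF; apply: bmf_sum => n; apply: bmfM => //; exact: bmf_cell. Qed.

Lemma cell_meanE M t F : (forall n, bmf (F n)) ->
  cell_mean M t F = \sum_(n < ncells M t) Ex P (fun w => \1_(cell T M t n) w * F n w).
Proof. by move=> bF; rewrite /cell_mean Ex_sum// => n; apply: bmfM => //; exact: bmf_cell. Qed.

Lemma cell_mean_le M t F H : (forall n, bmf (F n)) -> (forall n, bmf (H n)) ->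
  (forall n w, cell T M t n w -> F n w <= H n w) -> cell_mean M t F <= cell_mean M t H.
Proof.
move=> bF bH FH; apply: Ex_le; [exact: bmf_cell_sum|exact: bmf_cell_sum|move=> w].
apply: ler_sum => n _; rewrite indicE; have [/set_mem cw|_] := boolP (w \in _).
  by rewrite !mul1r FH.
by rewrite !mul0r.
Qed.

Lemma cell_meanD M t F H : (forall n, bmf (F n)) -> (forall n, bmf (H n)) ->
  cell_mean M t (fun n w => F n w + H n w) = cell_mean M t F + cell_mean M t H.
Proof.
move=> bF bH; rewrite /cell_mean -ExD; [|exact: bmf_cell_sum|exact: bmf_cell_sum].
by apply: eq_Ex => w; rewrite -big_split/=; apply: eq_bigr => n _; rewrite mulrDr.
Qed.

Lemma cell_meanZ M t c F : (forall n, bmf (F n)) ->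
  cell_mean M t (fun n w => c * F n w) = c * cell_mean M t F.
Proof.
move=> bF; rewrite /cell_mean -ExZ; last exact: bmf_cell_sum.
by apply: eq_Ex => w; rewrite mulr_sumr; apply: eq_bigr => n _; rewrite mulrCA.
Qed.

Lemma cell_mean_cst M t c : 0 < t -> cell_mean M t (fun _ _ => c) = c * fine (P (regular T M)).
Proof.
move=> t0; rewrite -Ex_indic; last exact: measurable_regular.
rewrite -ExZ; last by apply: bmf_indic; exact: measurable_regular.
by apply: eq_Ex => w; rewrite -mulr_suml mulrC (sum_cell1 poissonT).
Qed.

Lemma regular_prob01 M : 0 <= fine (P (regular T M)) <= 1.
Proof.
rewrite fine_ge0//= -[leRHS]/(fine 1%E) fine_le ?fin_num_measure ?probability_le1//;
  exact: measurable_regular.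
Qed.

Lemma cell_mean_cst_le M t c : 0 < t -> 0 <= c -> cell_mean M t (fun _ _ => c) <= c.
Proof.
by move=> t0 c0; rewrite cell_mean_cst// ler_piMr//; case/andP: (regular_prob01 M).
Qed.

Lemma cell_mean_sum M t (K : nat) (F : nat -> nat -> Omega -> R) :
  (forall k n, bmf (F k n)) ->
  cell_mean M t (fun n w => \sum_(0 <= k < K) F k n w) = \sum_(0 <= k < K) cell_mean M t (F k).
Proof.
move=> bF; elim: K => [|K IH].
  rewrite [RHS]big_geq// -[RHS](Ex_cst P); apply: eq_Ex => w.
  by rewrite big1// => n _; rewrite big_geq// mulr0.
rewrite big_nat_recr//= -IH -cell_meanD//; last by move=> n; exact: bmf_sum.
by congr cell_mean; apply/funext => n; apply/funext => w; rewrite big_nat_recr.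
Qed.

End cell_sums.

Section degrees.
Context {R : realType} {Omega : Type}.
Variable E : nat -> nat -> set Omega.

(** The indegree of i when exactly 0, ..., n-1 are born. The range is deterministic; [indegree_deg]
    identifies it with the true indegree on a cell. *)
Definition deg (i n : nat) (w : Omega) : nat := \sum_(i.+1 <= j < n) (w \in E i j).

Lemma deg_le i n w : (deg i n w <= n)%N.
Proof.
apply: (@leq_trans (\sum_(i.+1 <= j < n) 1)); first by apply: leq_sum => j _; exact: leq_b1.
by rewrite sum_nat_const_nat muln1 leq_subr.
Qed.

Definition avg (f : nat -> R) (t : R) n w : R := t^-1 * \sum_(i < n) f (deg i n w).

Lemma avgD f g t n w : avg (fun k => f k + g k) t n w = avg f t n w + avg g t n w.
Proof. by rewrite /avg big_split mulrDr. Qed.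

Lemma avgZ c f t n w : avg (fun k => c * f k) t n w = c * avg f t n w.
Proof. by rewrite /avg -mulr_sumr mulrCA. Qed.

Lemma avg_le f g t n w : 0 < t -> (forall k, f k <= g k) -> avg f t n w <= avg g t n w.
Proof. by move=> t0 fg; rewrite ler_pM2l ?invr_gt0//; apply: ler_sum. Qed.

Lemma avg_sum (K : nat) (f : nat -> nat -> R) t n w :
  avg (fun k => \sum_(0 <= j < K) f j k) t n w = \sum_(0 <= j < K) avg (f j) t n w.
Proof. by rewrite /avg exchange_big/= mulr_sumr. Qed.

Lemma avg_cst c t n w : avg (fun=> c) t n w = c * (t^-1 * n%:R).
Proof. by rewrite /avg sumr_const card_ord -[c *+ n]mulr_natr mulrCA. Qed.

End degrees.

Section degree_moments.
Context {R : realType} {d : nat} {dO : measure_display} {Omega : measurableType dO}.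
Variables (P : probability Omega R) (gamma beta : R) (phi : R -> R).
Variables (T : nat -> {RV P >-> measurableTypeR R}) (X : nat -> {RV P >-> Rspace R d}).
Variable E : nat -> nat -> set Omega.
Hypotheses (d_gt0 : (0 < d)%N) (phi_profile : profile_function d phi).
Hypotheses (gamma01 : 0 < gamma < 1) (beta0 : 0 < beta).
Hypotheses (poissonT : unit_poisson_process T) (iidX : iid_uniform_positions T X)
  (indepE : independent_edges gamma beta phi T X E).
Local Notation q := (qedge (d := d) gamma beta phi T).

(** Each edge present contributes one factor 1 - c, so the edge products of the decoupling are
    generating functions of the indegree. *)
Lemma eprod_deg (c : R) i n w : eprod E c i i.+1 n w = (1 - c) ^+ deg E i n w.
Proof.
rewrite /deg expr_sum; apply: eq_bigr => j _.
by rewrite indicE; case: (_ \in _); rewrite ?mulr1 ?mulr0 ?subr0 ?expr1 ?expr0.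
Qed.

Lemma measurable_deg i n : measurable_fun setT (fun w => (deg E i n w)%:R : R).
Proof.
rewrite (_ : (fun w => _) = fun w => \sum_(j <- index_iota i.+1 n)
    (if (i < j)%N then \1_(E i j) w else 0)).
  apply: measurable_sum => j; case: (ltnP i j) => // ij.
  by apply: measurable_indic; exact: (indepE.1 _ _ ij).
apply/funext => w; rewrite natr_sum big_seq [in RHS]big_seq; apply: eq_bigr => j.
by rewrite mem_index_iota => /andP[->] _; rewrite indicE.
Qed.

Lemma bmf_deg (f : nat -> R) i n : bmf (fun w => f (deg E i n w)).
Proof.
have mk k : measurable [set w | deg E i n w = k].
  have := measurable_deg i n measurableT (@measurable_set1 R k%:R).
  rewrite setTI; congr measurable; apply/seteqP; split => w /=; last by move=> ->.
  by move=> /eqP; rewrite eqr_nat => /eqP.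
(* Since the indegree is at most n, any function of it is a finite combination of indicators, hence
   bounded without assumptions on f. *)
rewrite (_ : (fun w => _) = fun w => \sum_(k < n.+1) f k * \1_[set w | deg E i n w = k] w).
  by apply: bmf_sum => k; apply: bmfM; [exact: bmf_cst|exact: bmf_indic].
apply/funext => w; have dn : (deg E i n w < n.+1)%N by rewrite ltnS deg_le.
rewrite (bigD1 (Ordinal dn))//= big1 ?addr0; first by rewrite indicE mem_set ?mulr1.
move=> k kn; rewrite indicE memNset ?mulr0//= => dk; move/eqP: kn; apply.
exact/val_inj.
Qed.

Lemma bmf_avg (f : nat -> R) t n : bmf (avg E f t n).
Proof. by apply: bmfM; [exact: bmf_cst|apply: bmf_sum => i; exact: bmf_deg]. Qed.

Lemma Ex_cell_deg M t i n :
  Ex P (fun w => \1_(cell T M t n) w * (deg E i n w)%:R) =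
  Ex P (fun w => \1_(cell T M t n) w * \sum_(i.+1 <= j < n) q i j w).
Proof.
have bq j : bmf (q i j) by apply: (bmfT (T := T)); exact: bmf_qedge.
have T_gt0 w : 0 < (T 0%N w : R) by case: poissonT => + _ _; exact.
have T_incr k w : (T k w : R) < T k.+1 w by case: poissonT => _ + _; exact.
have bC : bmf (\1_(cell T M t n) : Omega -> R) by apply: bmf_indic; exact: measurable_cell.
transitivity (\sum_(i.+1 <= j < n) Ex P (fun w => \1_(cell T M t n) w *
    (if (i < j)%N then \1_(E i j) w else 0))).
  rewrite -Ex_sum.
    apply: eq_Ex => w; rewrite natr_sum mulr_sumr !big_seq; apply: eq_bigr => j.
    by rewrite mem_index_iota => /andP[->] _; rewrite indicE.
  move=> j; apply: bmfM => //; case: (ltnP i j) => ij; last exact: bmf_cst.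
  exact: (bmf_E indepE).
transitivity (Ex P (fun w => \sum_(i.+1 <= j < n) \1_(cell T M t n) w * q i j w)); last first.
  by apply: eq_Ex => w; rewrite mulr_sumr.
rewrite Ex_sum; last by move=> j; exact: bmfM.
apply: eq_big_nat => j /andP[ij _]; rewrite ij.
apply: (Ex_edge phi_profile beta0 iidX indepE T_gt0 T_incr) => //.
exact: sigT_cell.
Qed.

Lemma Ex_cell_geom M t i n (c : R) : 0 <= c <= 1 ->
  Ex P (fun w => \1_(cell T M t n) w * (1 - c) ^+ deg E i n w) =
  Ex P (fun w => \1_(cell T M t n) w * qprod c q i i.+1 n w).
Proof.
move=> c01.
have T_gt0 w : 0 < (T 0%N w : R) by case: poissonT => + _ _; exact.
have T_incr k w : (T k w : R) < T k.+1 w by case: poissonT => _ + _; exact.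
rewrite -(Ex_eprod phi_profile beta0 iidX indepE T_gt0 T_incr i n c01 (sigT_cell M t n)).
by apply: eq_Ex => w; rewrite eprod_deg.
Qed.

End degree_moments.

(** * Power series of the limiting generating function *)

Section mixed_poisson_series.
Context {R : realType}.
Variables (gamma beta : R).
Hypotheses (gamma01 : 0 < gamma < 1) (beta0 : 0 < beta).
Local Notation m := (mixed_poisson_pmf gamma beta).

Lemma mixed_poisson_total : (\sum_(0 <= k <oo) m k = 1)%E.
Proof.
have c01 : 0 <= (0 : R) <= 1 by rewrite lexx ler01.
rewrite -[RHS](mixed_gen0 gamma01 beta0) -(mixed_gen_series gamma beta c01).
by apply: eq_eseriesr => k _; rewrite subr0 expr1n mul1e.
Qed.

Lemma mixed_poisson_fin k : m k \is a fin_num.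
Proof.
rewrite ge0_fin_numE ?mixed_poisson_pmf_ge0//; apply: (@le_lt_trans _ _ 1%E); last exact: ltry.
rewrite -mixed_poisson_total.
rewrite (le_trans _ (@nneseries_lim_ge _ _ xpredT 0 k.+1 _))//; last first.
  by move=> n _ _; exact: mixed_poisson_pmf_ge0.
rewrite big_nat_recr//= leeDr// sume_ge0// => i _; exact: mixed_poisson_pmf_ge0.
Qed.

Local Notation p k := (fine (m k)).

Lemma mixed_poisson_ge0 k : 0 <= p k.
Proof. by rewrite fine_ge0// mixed_poisson_pmf_ge0. Qed.

(** The remainder is at most x^K times the total mass 1. *)
Lemma mixed_gen_partial (x : R) K : 0 <= x <= 1 ->
  \sum_(0 <= j < K) x ^+ j * p j <= fine (mixed_gen gamma beta (1 - x)) <=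
  \sum_(0 <= j < K) x ^+ j * p j + x ^+ K.
Proof.
move=> /andP[x0 x1]; have c01 : 0 <= 1 - x <= 1 by apply/andP; split; lra.
have h j : (0 <= (x ^+ j)%:E * m j)%E.
  by rewrite mule_ge0 ?lee_fin ?exprn_ge0// mixed_poisson_pmf_ge0.
have fG : mixed_gen gamma beta (1 - x) \is a fin_num.
  by rewrite mixed_gen_fin//; case/andP: c01.
have sE : ((\sum_(0 <= j < K) x ^+ j * p j)%:E = \sum_(0 <= j < K) (x ^+ j)%:E * m j)%E.
  rewrite -sumEFin; apply: eq_bigr => j _; rewrite EFinM fineK//; exact: mixed_poisson_fin.
rewrite -!lee_fin EFinD sE fineK// -(mixed_gen_series gamma beta c01).
have e1 : 1 - (1 - x) = x by ring.
rewrite e1 (@nneseries_split _ _ 0 K) ?add0n; last by move=> k _.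
rewrite leeDl/=; last by apply: nneseries_ge0.
rewrite leeD2l//.
apply: (@le_trans _ _ (\sum_(K <= j <oo) (x ^+ K)%:E * m j)%E).
  rewrite [leLHS]eseries_cond [leRHS]eseries_cond.
  apply: lee_nneseries => [i _ _|i /= Ki]; first exact: h.
  by rewrite lee_wpmul2r ?mixed_poisson_pmf_ge0// lee_fin ler_wiXn2l// -[(K <= i)%N]andbT.
rewrite nneseriesZl; last by move=> i _; exact: mixed_poisson_pmf_ge0.
rewrite -[leRHS]mule1 lee_wpmul2l ?lee_fin ?exprn_ge0// -mixed_poisson_total.
rewrite [leRHS](@nneseries_split _ _ 0 K) ?add0n; last by move=> k _; exact: mixed_poisson_pmf_ge0.
by rewrite leeDr// sume_ge0// => i _; exact: mixed_poisson_pmf_ge0.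
Qed.

End mixed_poisson_series.

Lemma bmf_norm {R : realType} {d} {S : measurableType d} (f : S -> R) :
  bmf f -> bmf (fun w => `|f w|).
Proof.
move=> [mf [M fM]]; split.
  by apply: measurableT_comp mf; exact: normr_measurable.
by exists M => w; rewrite normr_id.
Qed.

(** A and G are two generating functions, s1 and s3 their terms below order k, z1 and z2 their terms
    of order k, ym and y bounds on their remainders. *)
Lemma isolate_term {R : realType} (A G s1 s2 s3 z1 z2 y ym : R) : 0 <= y -> 0 <= ym ->
  `|s1 - s3| <= s2 -> s1 + z1 <= A -> A <= s1 + z1 + ym ->
  s3 + z2 <= G -> G <= s3 + z2 + y -> `|z1 - z2| <= `|A - G| + s2 + (ym + y).
Proof.
move=> y0 ym0; rewrite ler_norml => /andP[k1 k2] S1 S2 G1 G2.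
have := lexx `|A - G|; rewrite {1}ler_norml => /andP[n1 n2].
by rewrite ler_norml; apply/andP; split; lra.
Qed.

(** * From generating functions to frequencies of indegrees *)

Section network_good.
Context {R : realType} {d : nat} {dO : measure_display} {Omega : measurableType dO}.
Variables (P : probability Omega R) (gamma beta : R) (phi : R -> R).
Variables (T : nat -> {RV P >-> measurableTypeR R}) (X : nat -> {RV P >-> Rspace R d}).
Variable E : nat -> nat -> set Omega.
Hypotheses (d_gt0 : (0 < d)%N) (phi_profile : profile_function d phi).
Hypotheses (gamma01 : 0 < gamma < 1) (beta0 : 0 < beta).
Hypotheses (poissonT : unit_poisson_process T) (iidX : iid_uniform_positions T X)
  (indepE : independent_edges gamma beta phi T X E).
Local Notation avg := (avg E).
Local Notation p k := (fine (mixed_poisson_pmf gamma beta k)).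
Local Notation pt k := (fun l : nat => (l == k)%:R : R).

Let bavg (f : nat -> R) t n : bmf (avg f t n).
Proof. exact: (bmf_avg indepE f t n). Qed.

Definition deviation M (f : nat -> R) (L t : R) : R :=
  cell_mean T M t (fun n w => `|avg f t n w - L|).

Lemma bmf_deviation (f : nat -> R) (L : R) t n : bmf (fun w => `|avg f t n w - L|).
Proof. by apply: bmf_norm; apply: bmfB; [exact: bavg|exact: bmf_cst]. Qed.

(** L^1 convergence on every regular event; convergence in probability follows since these events
    have probability close to 1. *)
Definition good f L := forall M, vanishing (deviation M f L).

Lemma good_geometric (x : R) : 0 <= x <= 1 ->
  good (fun k => x ^+ k) (fine (mixed_gen gamma beta (1 - x))).
Proof.
move=> /andP[x0 x1] M; have c01 : 0 <= 1 - x <= 1 by apply/andP; split; lra.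
have e1 : 1 - (1 - x) = x by ring.
set G := fine _; apply: vanishing_approx => e e0.
exists (fun t => e^-1 * L2_error gamma beta T E (1 - x) M t).
  apply: vanishingZ; first by rewrite invr_ge0 ltW.
  exact: (L2_error_vanishing d_gt0 phi_profile gamma01 beta0 poissonT iidX indepE).
move=> t t1; have t0 : 0 < t by lra.
have bsq n : bmf (fun w => (avg (fun k => x ^+ k) t n w - G) ^+ 2).
  under eq_fun do rewrite expr2.
  by apply: bmfM; apply: bmfB; [exact: bavg|exact: bmf_cst|exact: bavg|exact: bmf_cst].
have -> : L2_error gamma beta T E (1 - x) M t =
    cell_mean T M t (fun n w => (avg (fun k => x ^+ k) t n w - G) ^+ 2).
  apply: eq_Ex => w; apply: eq_bigr => n _; congr (_ * (_ * _ - _) ^+ 2).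
  by apply: eq_bigr => i _; rewrite eprod_deg e1.
(* The L^1 error is bounded through |y| <= y^2 / e + e. *)
apply: (@le_trans _ _ (cell_mean T M t (fun n w =>
    e^-1 * (avg (fun k => x ^+ k) t n w - G) ^+ 2 + e))).
  apply: cell_mean_le => [n|n|n w _].
  - exact: bmf_deviation.
  - by apply: bmfD; [apply: bmfM; [exact: bmf_cst|exact: bsq]|exact: bmf_cst].
  - rewrite -[X in _ <= _ * X + _]real_normK ?num_real//.
    move: `|_| (normr_ge0 (avg (fun k => x ^+ k) t n w - G)) => y y0.
    have -> : e^-1 * y ^+ 2 + e = e^-1 * (y ^+ 2 + e ^+ 2) by field; rewrite gt_eqF.
    by rewrite mulrC ler_pdivlMr//; nra.
rewrite cell_meanD//; last 2 first.
- by move=> n; apply: bmfM; [exact: bmf_cst|exact: bsq].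
- by move=> n; exact: bmf_cst.
rewrite cell_meanZ// lerD2l; exact: (cell_mean_cst_le poissonT M t0 (ltW e0)).
Qed.

Lemma indicator_geometric (x : R) k l : 0 <= x <= 1 ->
  \sum_(0 <= j < k.+1) x ^+ j * pt j l <= x ^+ l <=
  \sum_(0 <= j < k.+1) x ^+ j * pt j l + x ^+ k.+1.
Proof.
move=> /andP[x0 x1]; have [lk|lk] := ltnP l k.+1.
  have -> : \sum_(0 <= j < k.+1) x ^+ j * pt j l = x ^+ l.
    rewrite big_mkord (bigD1 (Ordinal lk))//= eqxx mulr1 big1 ?addr0// => j jl.
    by rewrite (_ : (l == j) = false) ?mulr0//; apply/negbTE; rewrite eq_sym.
  by rewrite lexx lerDl exprn_ge0.
rewrite big_nat big1 ?add0r ?exprn_ge0 ?ler_wiXn2l// => j /andP[_ jk].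
by rewrite gtn_eqF ?mulr0// (leq_trans jk).
Qed.

(* x^l = sum_(j <= k) x^j 1{l = j} + O(x^(k+1)): divide by x^k and let x -> 0. *)
Lemma good_indicator k : good (pt k) (p k).
Proof.
elim/ltn_ind: k => k IH M; apply: vanishing_approx => e e0.
have M0 : 0 < M.+2%:R + e by rewrite addr_gt0.
(* The remainders are x^(k+1) (M + 1) for the network, which has at most (M + 1) t vertices, and
   x^(k+1) for the limit. Divided by x^k they total x (M + 2) <= e. *)
pose x := e / (M.+2%:R + e).
have x0 : 0 < x by rewrite divr_gt0.
have x1 : x <= 1 by rewrite ler_pdivrMr// mul1r lerDr.
have xM : x * M.+2%:R <= e.
  by rewrite mulrAC ler_pdivrMr// ler_pM2l// lerDl ltW.
have x01 : 0 <= x <= 1 by rewrite x1 ltW.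
have xk0 : 0 < x ^+ k by rewrite exprn_gt0.
pose G := fine (mixed_gen gamma beta (1 - x)).
pose H t := deviation M (fun l => x ^+ l) G t + \sum_(0 <= j < k) deviation M (pt j) (p j) t.
exists (fun t => (x ^+ k)^-1 * H t).
  apply: vanishingZ; first by rewrite invr_ge0 ltW.
  apply: vanishingD; first exact: good_geometric.
  by apply: vanishing_sum => i ik; exact: IH.
move=> t t1; have t0 : 0 < t by lra.
suff : x ^+ k * deviation M (pt k) (p k) t <= H t + x ^+ k.+1 * M.+2%:R.
  rewrite -ler_pdivlMl// => /le_trans; apply.
  rewrite mulrDr lerD2l exprSr -mulrA mulKf// gt_eqF//.
have bS n : bmf (fun w => \sum_(0 <= j < k) `|avg (pt j) t n w - p j|).
  by apply: bmf_sum => j; exact: bmf_deviation.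
apply: (@le_trans _ _ (cell_mean T M t (fun n w => (`|avg (fun l => x ^+ l) t n w - G| +
    \sum_(0 <= j < k) `|avg (pt j) t n w - p j|) + x ^+ k.+1 * M.+2%:R))); last first.
  rewrite cell_meanD; last 2 first.
  - by move=> n; apply: bmfD; [exact: bmf_deviation|].
  - by move=> n; exact: bmf_cst.
  rewrite cell_meanD//; last by move=> n; exact: bmf_deviation.
  rewrite cell_mean_sum; last by move=> j n; exact: bmf_deviation.
  apply: lerD => //.
  apply: (cell_mean_cst_le poissonT M t0); rewrite mulr_ge0// ltW// exprn_gt0//.
rewrite -cell_meanZ; last by move=> n; exact: bmf_deviation.
apply: cell_mean_le => [n|n|n w cw].
- by apply: bmfM; [exact: bmf_cst|exact: bmf_deviation].
- by apply: bmfD; [apply: bmfD; [exact: bmf_deviation|]|exact: bmf_cst].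
have nt : t^-1 * n%:R <= M.+1%:R.
  by rewrite mulrC ler_pdivrMr//; exact: cell_size cw.
have S1 : \sum_(0 <= j < k.+1) x ^+ j * avg (pt j) t n w <= avg (fun l => x ^+ l) t n w.
  rewrite (eq_bigr (fun j => avg (fun l => x ^+ j * pt j l) t n w)); last first.
    by move=> j _; rewrite avgZ.
  rewrite -avg_sum; apply: avg_le => // l.
  by have /andP[] := @indicator_geometric x k l x01.
have S2 : avg (fun l => x ^+ l) t n w <=
    \sum_(0 <= j < k.+1) x ^+ j * avg (pt j) t n w + x ^+ k.+1 * M.+1%:R.
  apply: (@le_trans _ _ (\sum_(0 <= j < k.+1) x ^+ j * avg (pt j) t n w + x ^+ k.+1 * (t^-1 * n%:R))).
    rewrite (eq_bigr (fun j => avg (fun l => x ^+ j * pt j l) t n w)); last first.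
      by move=> j _; rewrite avgZ.
    rewrite -avg_sum -(avg_cst E _ t n w) -avgD; apply: avg_le => // l.
    by have /andP[] := @indicator_geometric x k l x01.
  by rewrite lerD2l ler_wpM2l// exprn_ge0// ltW.
have /andP[G1 G2] := mixed_gen_partial gamma01 beta0 k.+1 x01.
rewrite -/G in G1 G2.
rewrite !big_nat_recr//= in S1 S2 G1 G2.
rewrite -[x ^+ k in leLHS](ger0_norm (ltW xk0)) -normrM mulrBr.
set A := avg (fun l => x ^+ l) t n w in S1 S2 *.
set a := avg (pt k) t n w in S1 S2 *.
have key : `|\sum_(0 <= j < k) x ^+ j * avg (pt j) t n w - \sum_(0 <= j < k) x ^+ j * p j| <=
    \sum_(0 <= j < k) `|avg (pt j) t n w - p j|.
  rewrite -sumrB; apply: (le_trans (ler_norm_sum _ _ _)); apply: ler_sum => j _.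
  rewrite -mulrBr normrM ler_piMl// ger0_norm ?exprn_ge0 ?(ltW x0)//.
  by rewrite exprn_ile1// ltW.
have -> : M.+2%:R = M.+1%:R + 1 :> R by rewrite natr1.
have y0 : 0 <= x ^+ k.+1 by rewrite exprn_ge0// ltW.
have ym0 : 0 <= x ^+ k.+1 * M.+1%:R by rewrite mulr_ge0.
by rewrite mulrDr mulr1; exact: (isolate_term y0 ym0 key S1 S2 G1 G2).
Qed.

Lemma good_truncated (g : nat -> R) K :
  good (fun k => \sum_(0 <= j < K) g j * pt j k) (\sum_(0 <= j < K) g j * p j).
Proof.
move=> M; apply: (@vanishing_le _ _ (fun t => \sum_(0 <= j < K) `|g j| * deviation M (pt j) (p j) t)).
  move=> t t0; have b j n : bmf (fun w => `|g j| * `|avg (pt j) t n w - p j|).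
    by apply: bmfM; [exact: bmf_cst|exact: bmf_deviation].
  rewrite [leRHS](_ : _ = cell_mean T M t (fun n w =>
      \sum_(0 <= j < K) `|g j| * `|avg (pt j) t n w - p j|)); last first.
    rewrite cell_mean_sum//; apply: eq_bigr => j _.
    by rewrite cell_meanZ// => n; exact: bmf_deviation.
  apply: cell_mean_le => [n|n|n w _].
  - exact: bmf_deviation.
  - exact: bmf_sum.
  - rewrite avg_sum -sumrB; apply: (le_trans (ler_norm_sum _ _ _)).
    by apply: ler_sum => j _; rewrite avgZ -mulrBr normrM.
by apply: vanishing_sum => j _; apply: vanishingZ => //; exact: good_indicator.
Qed.

End network_good.

(** * Uniform bound on the share of large indegrees *)

Section tail_inequalities.
Context {R : realType}.

(** A rational counterpart of prod (1 - a_i) <= exp(- sum a_i), sufficient for the tail. *)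
Lemma prod_onem_sum_le I (r : seq I) (a : I -> R) : (forall i, 0 <= a i <= 1) ->
  \prod_(i <- r) (1 - a i) * (1 + \sum_(i <- r) a i) <= 1.
Proof.
move=> a01; elim: r => [|i r IH]; first by rewrite !big_nil addr0 mulr1.
rewrite !big_cons; have /andP[a0 a1] := a01 i.
have p01 : 0 <= \prod_(j <- r) (1 - a j) <= 1.
  have h j : 0 <= 1 - a j <= 1 by have /andP[? ?] := a01 j; apply/andP; split; lra.
  by rewrite prodr_ge0 ?prodr_ile1// => j _; have /andP[] := h j.
move: IH; move: (\prod_(j <- r) _) p01 (\sum_(j <- r) _) (a i) a0 a1 => p /andP[p0 p1] s b b0 b1 IH.
have -> : (1 - b) * p * (1 + (b + s)) = (1 - b) * (p * (1 + s)) + p * (b * (1 - b)) by ring.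
have h1 : (1 - b) * (p * (1 + s)) <= 1 - b by rewrite ler_piMr// subr_ge0.
have h2 : p * (b * (1 - b)) <= b * (1 - b) by rewrite ler_piMl// mulr_ge0// subr_ge0.
nra.
Qed.

(** The left side is at most min(1, y), and y^e dominates that on both sides of y = 1. *)
Lemma div_onep_le_powR (e y : R) : 0 < e < 1 -> 0 <= y -> y / (1 + y) <= y `^ e.
Proof.
move=> /andP[e0 e1] y0; have y10 : 0 < 1 + y by lra.
have [y1|y1] := leP y 1; last first.
  apply: (@le_trans _ _ 1); first by rewrite ler_pdivrMr// mul1r lerDr.
  by rewrite -[leLHS](powRr0 y); apply: ler_powR; exact: ltW.
apply: (@le_trans _ _ y); first by rewrite ler_pdivrMr// ler_peMr// lerDl.
have [->|yn0] := eqVneq y 0; first exact: powR_ge0.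
rewrite -[leLHS]powRr1//; apply: ger_powR; last exact: ltW.
by rewrite y1 lt_neqAle eq_sym yn0 y0.
Qed.

Lemma bernoulli_onem (c : R) k : 0 <= c <= 1 -> 1 - k%:R * c <= (1 - c) ^+ k.
Proof.
move=> /andP[c0 c1]; elim: k => [|k IH]; first by rewrite mul0r subr0 expr0.
rewrite exprS; apply: (@le_trans _ _ ((1 - c) * (1 - k%:R * c))); last first.
  by rewrite ler_wpM2l// subr_ge0.
have : 0 <= k%:R * c ^+ 2 by rewrite mulr_ge0// sqr_ge0.
by rewrite -natr1; lra.
Qed.

(* With c = 2 / K, (1 - (1 - c)^k) / c behaves like min (k, K / 2), so the large
   part of k is controlled by the mean and the generating function alone. *)
Lemma truncation_le (K k : nat) (c : R) : 0 < c -> c <= 1 -> c * K%:R = 2 ->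
  (if (K <= k)%N then k%:R else 0) <= 2 * (k%:R - (1 - (1 - c) ^+ k) / c).
Proof.
move=> c0 c1 cK; have e0 : 0 <= (1 - c) ^+ k by rewrite exprn_ge0// subr_ge0.
case: leqP => Kk.
  have Kk' : (K%:R : R) <= k%:R by rewrite ler_nat.
  have : (1 - (1 - c) ^+ k) / c <= K%:R / 2 by rewrite ler_pdivrMr//; lra.
  lra.
rewrite mulr_ge0// subr_ge0 ler_pdivrMr//.
have c01 : 0 <= c <= 1 by rewrite c1 ltW.
have := bernoulli_onem k c01; lra.
Qed.

(** With Q <= 1 / (1 + c l) the left side is at most l * (c l) / (1 + c l), and the fraction is at
    most (c L)^e. The power of c is what makes the tail small. *)
Lemma defect_le (c e l L Q : R) : 0 < e < 1 -> 0 < c -> 0 <= l -> l <= L ->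
  Q * (1 + c * l) <= 1 -> l - (1 - Q) / c <= c `^ e * (L * L `^ e).
Proof.
move=> e01 c0 l0 lL hQ; have y0 : 0 <= c * l by rewrite mulr_ge0// ltW.
have y1 : 0 < 1 + c * l by lra.
have L0 : 0 <= L by exact: le_trans lL.
apply: (@le_trans _ _ (l * (c * l / (1 + c * l)))).
  have {}hQ : Q <= (1 + c * l)^-1 by rewrite -[leRHS]mul1r ler_pdivlMr.
  have : (1 - (1 + c * l)^-1) / c <= (1 - Q) / c by rewrite ler_pM2r ?invr_gt0// lerD2l lerN2.
  have -> : (1 - (1 + c * l)^-1) / c = l / (1 + c * l) by field; rewrite !gt_eqF.
  have -> : l * (c * l / (1 + c * l)) = l - l / (1 + c * l) by field; rewrite gt_eqF.
  lra.
apply: (@le_trans _ _ (L * (c * L) `^ e)); last by rewrite powRM ?(ltW c0)// mulrCA.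
have e0 : 0 <= e by case/andP: e01 => /ltW.
rewrite ler_pM ?divr_ge0 ?(ltW y1)//; apply: (le_trans (div_onep_le_powR e01 y0)).
by rewrite ge0_ler_powR ?nnegrE// ?mulr_ge0 ?(ltW c0)// ler_pM2l.
Qed.

Lemma sum_ratio_powR_le (s : R) n : 0 < s < 1 ->
  \sum_(i < n) (n%:R / i.+1%:R) `^ s <= n%:R / (1 - s).
Proof.
move=> s01; have /andP[s0 s1] := s01.
case: n => [|n]; first by rewrite big_ord0 mul0r.
have -> : \sum_(i < n.+1) (n.+1%:R / i.+1%:R) `^ s =
    n.+1%:R `^ s * \sum_(0 <= i < n.+1) (i.+1%:R : R) `^ (- s).
  rewrite big_mkord mulr_sumr; apply: eq_bigr => i _.
  by rewrite powRM ?invr_ge0// -powR_inv1// -powRrM mulN1r.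
rewrite (le_trans (ler_wpM2l (powR_ge0 _ _) (sum_powRN_le n.+1 s01)))//.
rewrite mulrA -powRD ?subrKC ?powRr1//.
by apply/implyP => _; rewrite pnatr_eq0.
Qed.

End tail_inequalities.

Section network_tail.
Context {R : realType} {d : nat} {dO : measure_display} {Omega : measurableType dO}.
Variables (P : probability Omega R) (gamma beta : R) (phi : R -> R).
Variables (T : nat -> {RV P >-> measurableTypeR R}) (X : nat -> {RV P >-> Rspace R d}).
Variable E : nat -> nat -> set Omega.
Hypotheses (d_gt0 : (0 < d)%N) (phi_profile : profile_function d phi).
Hypotheses (gamma01 : 0 < gamma < 1) (beta0 : 0 < beta).
Hypotheses (poissonT : unit_poisson_process T) (iidX : iid_uniform_positions T X)
  (indepE : independent_edges gamma beta phi T X E).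
Local Notation q := (qedge (d := d) gamma beta phi T).
Local Notation avg := (avg E).
Local Notation p k := (fine (mixed_poisson_pmf gamma beta k)).
(** [e] is the power of c gained in [defect_le], and [s] = gamma (1 + e) is the power of n / i that
    results; 1 - s = (1 - gamma)^2 > 0 makes the sum over i of order n. *)
Local Notation e := (1 - gamma).
Local Notation s := (gamma + gamma * (1 - gamma)).

Let T_gt0 w : 0 < (T 0%N w : R). Proof. by case: poissonT => + _ _; exact. Qed.
Let T_incr n w : (T n w : R) < T n.+1 w. Proof. by case: poissonT => _ + _; exact. Qed.
Let q01 i j w : 0 <= q i j w <= 1. Proof. exact: qedge01. Qed.
Let bq i j : bmf (q i j). Proof. by apply: (bmfT (T := T)); exact: bmf_qedge. Qed.
Let bavg (f : nat -> R) t n : bmf (avg f t n).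
Proof. exact: (bmf_avg indepE f t n). Qed.
Let g0 : 0 < gamma. Proof. by case/andP: gamma01. Qed.
Let e01 : 0 < e < 1. Proof. by have /andP[? ?] := gamma01; apply/andP; split; lra. Qed.
Let s01 : 0 < s < 1. Proof. by have /andP[? ?] := gamma01; apply/andP; split; nra. Qed.

Definition younger_mass i n w : R := \sum_(i.+1 <= j < n) q i j w.

Lemma bmf_younger_mass i n : bmf (younger_mass i n).
Proof. by apply: bmf_sum => j; exact: bq. Qed.

Definition younger_const M : R := M.+1%:R * (beta / gamma).

Lemma younger_const_ge0 M : 0 <= younger_const M.
Proof. by rewrite mulr_ge0// divr_ge0 ?ltW. Qed.

Lemma younger_mass_le M i n w : regular T M w ->
  younger_mass i n w <= younger_const M * (n%:R / i.+1%:R) `^ gamma.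
Proof.
move=> rw; apply: (@le_trans _ _ (\sum_(i.+1 <= j < n) M.+1%:R * weight gamma beta i j)).
  apply: ler_sum => j _.
  exact: (qedge_weight_le d_gt0 phi_profile gamma01 beta0 poissonT).
rewrite -mulr_sumr /younger_const -mulrA ler_wpM2l//.
exact: weight_younger_sum.
Qed.

(** Half the majorant of [truncation_le], with the indegree averaged over the edges. *)
Definition defect c i n w : R :=
  younger_mass i n w - (1 - qprod c q i i.+1 n w) / c.

Lemma bmf_defect c i n : bmf (defect c i n).
Proof.
apply: bmfB; first exact: bmf_younger_mass.
apply: bmfM; last exact: bmf_cst.
by apply: bmfB; [exact: bmf_cst|exact: bmf_qprodO].
Qed.

Lemma sum_defect_le M c n w : 0 < c -> c <= 1 -> regular T M w ->
  \sum_(i < n) defect c i n w <=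
  c `^ e * (younger_const M * younger_const M `^ e * (n%:R / (1 - s))).
Proof.
move=> c0 c1 rw; set B := younger_const M; have B0 : 0 <= B by exact: younger_const_ge0.
apply: (@le_trans _ _ (\sum_(i < n) c `^ e * (B * B `^ e * (n%:R / i.+1%:R) `^ s))); last first.
  have BB : 0 <= B * B `^ e by exact: (mulr_ge0 B0 (powR_ge0 _ _)).
  rewrite -mulr_sumr ler_wpM2l ?powR_ge0// -mulr_sumr ler_wpM2l//.
  exact: sum_ratio_powR_le.
apply: ler_sum => i _.
pose L := B * (n%:R / i.+1%:R) `^ gamma.
have -> : B * B `^ e * (n%:R / i.+1%:R) `^ s = L * L `^ e.
  rewrite /L powRM ?powR_ge0// -powRrM powRD; last first.
    apply/implyP => _; rewrite mulf_neq0 ?invr_neq0// pnatr_eq0 -lt0n.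
    exact: leq_ltn_trans (ltn_ord i).
  by rewrite mulrACA.
apply: defect_le => //.
- by apply: sumr_ge0 => j _; have /andP[] := q01 i j w.
- exact: younger_mass_le.
- have a01 j : 0 <= c * q i j w <= 1.
    by have /andP[h1 h2] := q01 i j w; apply/andP; split; nra.
  by have := prod_onem_sum_le (index_iota i.+1 n) a01; rewrite -mulr_sumr.
Qed.

Lemma Ex_affine_sum (C : Omega -> R) (A D : nat -> Omega -> R) (t c : R) n :
  bmf C -> (forall i, bmf (A i)) -> (forall i, bmf (D i)) ->
  Ex P (fun w => C w * (t * \sum_(i < n) 2 * (A i w - (1 - D i w) / c))) =
  t * \sum_(i < n) 2 * (Ex P (fun w => C w * A i w) -
    (Ex P C - Ex P (fun w => C w * D i w)) * c^-1).
Proof.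
move=> bC bA bD.
have bCA i : bmf (fun w => C w * A i w) by exact: bmfM.
have bCD i : bmf (fun w => C w * D i w) by exact: bmfM.
have bCD' i : bmf (fun w => C w - C w * D i w) by exact: bmfB.
have bZ i : bmf (fun w => c^-1 * (C w - C w * D i w)) by apply: bmfM => //; exact: bmf_cst.
have bAD i : bmf (fun w => C w * A i w - c^-1 * (C w - C w * D i w)) by exact: bmfB.
transitivity (Ex P (fun w => t * \sum_(i < n) 2 * (C w * A i w - c^-1 * (C w - C w * D i w)))).
  apply: eq_Ex => w; rewrite mulrCA; congr (_ * _); rewrite mulr_sumr; apply: eq_bigr => i _.
  ring.
have b2 i : bmf (fun w => 2 * (C w * A i w - c^-1 * (C w - C w * D i w))).
  by apply: bmfM => //; exact: bmf_cst.
rewrite ExZ; last exact: bmf_sum.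
rewrite Ex_sum//; congr (_ * _); apply: eq_bigr => i _.
by rewrite ExZ// ExB// ExZ// ExB// [_^-1 * _]mulrC.
Qed.

Definition tail_const M : R :=
  2 * (younger_const M * younger_const M `^ e * (M.+1%:R / (1 - s))).

Lemma tail_const_ge0 M : 0 <= tail_const M.
Proof.
have /andP[_ s1] := s01; have := younger_const_ge0 M => h.
apply: mulr_ge0 => //; apply: mulr_ge0; first exact: (mulr_ge0 h (powR_ge0 _ _)).
by rewrite divr_ge0// subr_ge0 ltW.
Qed.

Definition large_part K (k : nat) : R := if (K <= k)%N then k%:R else 0.

Lemma cell_mean_tail M K t : 0 < t -> (2 <= K)%N ->
  cell_mean T M t (avg (large_part K) t) <= tail_const M * (2 / K%:R) `^ e.
Proof.
(* The value prescribed by [truncation_le]; K >= 2 makes it at most 1. *)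
move=> t0 K2; pose c : R := 2 / K%:R.
have K0 : 0 < K%:R :> R by rewrite ltr0n (leq_trans _ K2).
have c0 : 0 < c by rewrite divr_gt0.
have c1 : c <= 1 by rewrite ler_pdivrMr// mul1r ler_nat.
have cK : c * K%:R = 2 by rewrite divfK// gt_eqF.
have c01 : 0 <= c <= 1 by rewrite c1 ltW.
have bC n : bmf (\1_(cell T M t n) : Omega -> R) by exact: bmf_cell.
pose F n w := t^-1 * \sum_(i < n) 2 * ((deg E i n w)%:R - (1 - (1 - c) ^+ deg E i n w) / c).
pose H n w := t^-1 * \sum_(i < n) 2 * defect c i n w.
have bF n : bmf (F n).
  exact: (bavg (fun k => 2 * (k%:R - (1 - (1 - c) ^+ k) / c)) t n).
have bH n : bmf (H n).
  apply: bmfM; first exact: bmf_cst.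
  by apply: bmf_sum => i; apply: bmfM; [exact: bmf_cst|exact: bmf_defect].
(* The majorant is affine in the indegree and in (1 - c)^indegree, and both have exact averages. *)
have FH : cell_mean T M t F = cell_mean T M t H.
  rewrite !cell_meanE//; apply: eq_bigr => n _.
  have h1 i : bmf (fun w => (deg E i n w)%:R : R).
    exact: (bmf_deg indepE (fun k => k%:R) i n).
  have h2 i : bmf (fun w => (1 - c) ^+ deg E i n w).
    exact: (bmf_deg indepE (fun k => (1 - c) ^+ k) i n).
  rewrite [LHS](Ex_affine_sum t^-1 c n (bC n) h1 h2).
  rewrite [RHS](Ex_affine_sum t^-1 c n (bC n) (bmf_younger_mass^~ n) 
    (fun i => bmf_qprodO gamma beta T phi_profile c i n)).
  congr (_ * _); apply: eq_bigr => i _; congr (_ * (_ - (_ - _) * _)).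
    exact: (Ex_cell_deg phi_profile beta0 poissonT iidX indepE).
  exact: (Ex_cell_geom phi_profile beta0 poissonT iidX indepE).
apply: (@le_trans _ _ (cell_mean T M t F)).
  apply: cell_mean_le => // n w _.
  have h k : large_part K k <= 2 * (k%:R - (1 - (1 - c) ^+ k) / c) by exact: truncation_le.
  exact: (avg_le E n w t0 h).
rewrite FH; apply: (@le_trans _ _ (cell_mean T M t (fun _ _ => tail_const M * c `^ e))); last first.
  by apply: cell_mean_cst_le => //; rewrite mulr_ge0 ?powR_ge0 ?tail_const_ge0.
apply: cell_mean_le => // [n|n w cw]; first exact: bmf_cst.
rewrite /H -mulr_sumr ler_pdivrMl//.
have rw : regular T M w by case: cw.
apply: (@le_trans _ _ (2 * (c `^ e * (younger_const M * younger_const M `^ e * (n%:R / (1 - s)))))).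
  by rewrite ler_wpM2l// sum_defect_le.
apply: (@le_trans _ _ (2 * (c `^ e * (younger_const M * younger_const M `^ e * (M.+1%:R * t / (1 - s)))))).
  have h : 0 <= younger_const M * younger_const M `^ e.
    exact: (mulr_ge0 (younger_const_ge0 M) (powR_ge0 _ _)).
  rewrite ler_wpM2l// ler_wpM2l ?powR_ge0// ler_wpM2l//.
  have /andP[_ s1] := s01.
  by rewrite ler_wpM2r ?invr_ge0 ?subr_ge0 ?(ltW s1)//; exact: cell_size cw.
rewrite le_eqVlt; apply/orP; left; apply/eqP; rewrite /tail_const.
by move: (_ `^ _) (_ `^ _) (_ - s)^-1 => x y z; ring.
Qed.

End network_tail.

(** * Extension to functions of linear growth *)

Section network_limit.
Context {R : realType} {d : nat} {dO : measure_display} {Omega : measurableType dO}.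
Variables (P : probability Omega R) (gamma beta : R) (phi : R -> R).
Variables (T : nat -> {RV P >-> measurableTypeR R}) (X : nat -> {RV P >-> Rspace R d}).
Variable E : nat -> nat -> set Omega.
Hypotheses (d_gt0 : (0 < d)%N) (phi_profile : profile_function d phi).
Hypotheses (gamma01 : 0 < gamma < 1) (beta0 : 0 < beta).
Hypotheses (poissonT : unit_poisson_process T) (iidX : iid_uniform_positions T X)
  (indepE : independent_edges gamma beta phi T X E).
Local Notation avg := (avg E).
Local Notation p k := (fine (mixed_poisson_pmf gamma beta k)).
Local Notation pt j := (fun l : nat => (l == j)%:R : R).
Local Notation tail M K := (tail_const gamma beta M * (2 / K%:R) `^ (1 - gamma)).

Let bavg (f : nat -> R) t n : bmf (avg f t n).
Proof. exact: (bmf_avg indepE f t n). Qed.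
Let p0 k : 0 <= p k. Proof. exact: mixed_poisson_ge0. Qed.

Lemma regular_half : exists M, 2^-1 <= fine (P (regular T M)).
Proof.
have /fine_cvgP[_ /cvgrPdist_le] := regular_prob poissonT.
have half : (0 : R) < 2^-1 by [].
move=> /(_ _ half)[M _ /(_ M (leqnn M))/=]; rewrite ler_distl => /andP[_ h].
by exists M; lra.
Qed.

Lemma large_part_ge0 K k : 0 <= large_part K k :> R.
Proof. by rewrite /large_part; case: ifP. Qed.

Lemma truncated_sumE (f : nat -> R) K k :
  \sum_(0 <= j < K) f j * pt j k = if (k < K)%N then f k else 0.
Proof.
case: ltnP => kK.
  rewrite big_mkord (bigD1 (Ordinal kK))//= eqxx mulr1 big1 ?addr0// => j jk.
  by rewrite (_ : (k == j) = false) ?mulr0//; apply/negbTE; rewrite eq_sym.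
rewrite big_nat big1// => j /andP[_ jK].
by rewrite gtn_eqF ?mulr0// (leq_trans jK).
Qed.

(* The tail estimate for the network passes to the limit through any regular
   event of positive probability. *)
Lemma mixed_poisson_tail M K L : (2 <= K)%N -> 2^-1 <= fine (P (regular T M)) ->
  \sum_(0 <= j < L) large_part K j * p j <= 2 * tail M K.
Proof.
move=> K2 hM; set m := \sum_(0 <= j < L) _.
have m0 : 0 <= m by apply: sumr_ge0 => j _; rewrite mulr_ge0 ?large_part_ge0.
suff : m * 2^-1 <= tail M K by rewrite ler_pdivrMr// mulrC.
apply/ler_addgt0Pr => e e0.
pose f k := \sum_(0 <= j < L) large_part K j * pt j k.
(* A single t with deviation at most e is enough, because the tail bound for the network does not
   depend on t. *)
have [t t0 /(_ t (lexx t)) ht] := good_truncated d_gt0 phi_profile gamma01 beta0 poissonT iidX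
  indepE (large_part K) L M e0.
have fle k : f k <= large_part K k.
  by rewrite /f truncated_sumE; case: ifP => // _; exact: large_part_ge0.
apply: (@le_trans _ _ (cell_mean T M t (fun _ _ => m))).
  by rewrite cell_mean_cst// ler_wpM2l.
apply: (@le_trans _ _ (cell_mean T M t (fun n w => avg (large_part K) t n w + `|avg f t n w - m|))).
  apply: cell_mean_le => [n|n|n w _]; first exact: bmf_cst.
    by apply: bmfD => //; exact: (bmf_deviation indepE).
  have h1 := avg_le E n w t0 fle; have := ler_norm (- (avg f t n w - m)).
  by rewrite normrN; lra.
rewrite cell_meanD//; last by move=> n; exact: (bmf_deviation indepE).
rewrite lerD//.
exact: (cell_mean_tail d_gt0 phi_profile gamma01 beta0 poissonT iidX indepE M t0 K2).
Qed.

Lemma tail_small (A e : R) : 0 <= A -> 0 < e ->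
  exists2 K, (2 <= K)%N & A * (2 / K%:R) `^ (1 - gamma) <= e.
Proof.
move=> A0 e0; have /andP[g0 g1] := gamma01.
pose y := e / (A + 1); have y0 : 0 < y by rewrite divr_gt0// ltr_wpDl.
pose x := y `^ (1 - gamma)^-1; have x0 : 0 < x by rewrite powR_gt0.
pose K := (Num.truncn (2 / x)).+2; exists K => //.
have K0 : 0 < K%:R :> R by [].
have h : 2 / K%:R <= x.
  rewrite ler_pdivrMr// mulrC -ler_pdivrMr//.
  by rewrite ltW// (lt_le_trans (truncnS_gt _))// ler_nat /K leqnSn.
have h2 : (2 / K%:R) `^ (1 - gamma) <= y.
  rewrite [leRHS](_ : _ = x `^ (1 - gamma)).
    apply: ge0_ler_powR => //; first by rewrite subr_ge0 ltW.
      by rewrite nnegrE divr_ge0.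
    by rewrite nnegrE ltW.
  by rewrite /x -powRrM mulVf ?powRr1 ?(ltW y0)// subr_eq0 gt_eqF.
apply: (le_trans (ler_wpM2l A0 h2)).
rewrite /y mulrA ler_pdivrMr ?ltr_wpDl// mulrDr mulr1 mulrC.
by rewrite lerDl ltW.
Qed.

Section linear_growth.
Variables (g : nat -> R) (C : R).
Hypotheses (g_ge0 : forall k, 0 <= g k) (g_le : forall k, g k <= C * (1 + k%:R)).

Let C0 : 0 <= C.
Proof. by have := le_trans (g_ge0 0) (g_le 0); rewrite addr0 mulr1. Qed.

Lemma linear_growth_large K k : (1 <= K)%N -> (K <= k)%N -> g k <= 2 * C * large_part K k.
Proof.
move=> K1 Kk; rewrite /large_part Kk; apply: (le_trans (g_le k)).
have : (1 : R) <= k%:R by rewrite ler1n (leq_trans K1).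
have := C0; nra.
Qed.

Let G K := \sum_(0 <= j < K) g j * p j.

(** The constant 4 C is 2 C from [linear_growth_large] times 2 from [mixed_poisson_tail]. *)
Lemma partial_mean_le M K n : (2 <= K)%N -> 2^-1 <= fine (P (regular T M)) ->
  G n <= G K + 4 * C * tail M K.
Proof.
move=> K2 hM.
have tail0 : 0 <= tail M K by rewrite mulr_ge0 ?powR_ge0// tail_const_ge0.
have gp0 j : 0 <= g j * p j by rewrite mulr_ge0.
have [nK|Kn] := leqP n K.
  apply: (@le_trans _ _ (G K)); last by rewrite lerDl mulr_ge0// mulr_ge0.
  by rewrite /G (big_cat_nat (n := n) (p := K))//= lerDl sumr_ge0.
rewrite /G (big_cat_nat (n := K) (p := n))//= ?(ltnW Kn)// lerD2l.
apply: (@le_trans _ _ (2 * C * \sum_(0 <= j < n) large_part K j * p j)).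
  rewrite mulr_sumr (big_cat_nat (m := 0) (n := K) (p := n))//= ?(ltnW Kn)// ler_wpDl//.
    by apply: sumr_ge0 => j _; rewrite !mulr_ge0 ?large_part_ge0.
  apply: ler_sum_nat => j /andP[Kj _]; rewrite mulrA ler_wpM2r//.
  by apply: linear_growth_large => //; exact: ltnW.
have c0 : 0 <= 2 * C by rewrite mulr_ge0.
apply: (le_trans (ler_wpM2l c0 (mixed_poisson_tail n K2 hM))).
by rewrite le_eqVlt; apply/orP; left; apply/eqP; ring.
Qed.

(** Below K the function is a finite combination of indicators; above K the network and the limit
    both have tails of order K^-(1 - gamma). The same tail bound makes the limiting series
    finite. *)
Lemma good_linear : exists2 L : R,
  (\sum_(0 <= k <oo) (g k)%:E * mixed_poisson_pmf gamma beta k = L%:E)%E & good T E g L.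
Proof.
have [M0 hM0] := regular_half.
have term0 k : (0 <= (g k)%:E * mixed_poisson_pmf gamma beta k)%E.
  by rewrite mule_ge0 ?lee_fin// mixed_poisson_pmf_ge0.
set S := (\sum_(0 <= k <oo) _)%E.
have GE n : (\sum_(0 <= k < n) (g k)%:E * mixed_poisson_pmf gamma beta k = (G n)%:E)%E.
  rewrite /G -sumEFin; apply: eq_bigr => k _.
  by rewrite EFinM fineK//; exact: (mixed_poisson_fin gamma01 beta0).
have Slo K : ((G K)%:E <= S)%E by rewrite -GE; apply: nneseries_lim_ge.
have Sup K : (2 <= K)%N -> (S <= (G K + 4 * C * tail M0 K)%:E)%E.
  move=> K2; apply: lime_le; first by apply: is_cvg_nneseries.
  by apply: nearW => n; rewrite GE lee_fin; exact: partial_mean_le.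
have Sfin : S \is a fin_num.
  rewrite ge0_fin_numE ?nneseries_ge0//; exact: (le_lt_trans (Sup 2 _) (ltry _)).
exists (fine S); first by rewrite fineK.
have {}Slo K : G K <= fine S by rewrite -lee_fin fineK.
have {}Sup K : (2 <= K)%N -> fine S <= G K + 4 * C * tail M0 K.
  by move=> K2; rewrite -lee_fin fineK//; exact: Sup.
move: (fine S) Slo Sup => L Llo Lup M; apply: vanishing_approx => e e0.
(* One constant for both tails: the network on [regular M] with M arbitrary, and the limit through
   the fixed M0 whose regular event has probability at least 1/2. *)
pose A := 2 * C * tail_const gamma beta M + 4 * C * tail_const gamma beta M0.
have A0 : 0 <= A.
  by rewrite addr_ge0// mulr_ge0 ?tail_const_ge0// mulr_ge0.
have [K K2 hK] := tail_small A0 e0.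
pose f k := \sum_(0 <= j < K) g j * pt j k.
exists (deviation T E M f (G K)).
  exact: (good_truncated d_gt0 phi_profile gamma01 beta0 poissonT iidX indepE g K M).
move=> t t1; have t0 : 0 < t by lra.
have gf k : f k <= g k <= f k + 2 * C * large_part K k.
  rewrite /f truncated_sumE; case: ltnP => kK.
    by rewrite lexx lerDl !mulr_ge0 ?large_part_ge0.
  by rewrite g_ge0 add0r linear_growth_large// ltnW.
apply: le_trans (_ : _ <= deviation T E M f (G K) t + A * (2 / K%:R) `^ (1 - gamma)) _; last first.
  by rewrite lerD2l.
have b1 n : bmf (fun w => `|avg f t n w - G K|) by exact: (bmf_deviation indepE).
have b2 n : bmf (fun w => 2 * C * avg (large_part K) t n w).
  by apply: bmfM => //; exact: bmf_cst.
have b12 n : bmf (fun w => `|avg f t n w - G K| + 2 * C * avg (large_part K) t n w).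
  exact: bmfD.
apply: (@le_trans _ _ (cell_mean T M t (fun n w => (`|avg f t n w - G K| +
    2 * C * avg (large_part K) t n w) + 4 * C * tail M0 K))).
  apply: cell_mean_le => [n|n|n w _].
  - exact: (bmf_deviation indepE).
  - by apply: bmfD => //; exact: bmf_cst.
  - have h1 : avg f t n w <= avg g t n w.
      by apply: avg_le => // k; case/andP: (gf k).
    have h2 : avg g t n w <= avg f t n w + 2 * C * avg (large_part K) t n w.
      by rewrite -avgZ -avgD; apply: avg_le => // k; case/andP: (gf k).
    have := Llo K; have := Lup K K2.
    have := lexx `|avg f t n w - G K|; rewrite {1}ler_norml => /andP[n1 n2] L1 L2.
    by rewrite ler_norml; apply/andP; split; lra.
have c0 : 0 <= 2 * C by rewrite mulr_ge0.
rewrite cell_meanD//; last by move=> n; exact: bmf_cst.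
rewrite cell_meanD// cell_meanZ// -addrA lerD2l /A [leRHS]mulrDl lerD//.
  rewrite -[leRHS]mulrA ler_wpM2l//.
  exact: (cell_mean_tail d_gt0 phi_profile gamma01 beta0 poissonT iidX indepE M t0 K2).
rewrite -[4 * C * _ * _]mulrA; apply: (cell_mean_cst_le poissonT M t0).
apply: mulr_ge0; first exact: mulr_ge0.
by apply: mulr_ge0; [exact: tail_const_ge0|exact: powR_ge0].
Qed.

End linear_growth.
End network_limit.

(** * Empirical indegree distribution *)

Section nat_measures.
Context {R : realType}.

Lemma ge0_integral_pmf (m : nat -> \bar R) (m_ge0 : forall k, (0 <= m k)%E) (g : nat -> R) :
  (forall k, 0 <= g k) ->
  (\int[pmf_measure m_ge0]_k (g k)%:E = \sum_(0 <= k <oo) (g k)%:E * m k)%E.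
Proof.
move=> g0; have -> : [set: nat] = \bigcup_k [set k].
  by apply/seteqP; split => k // _; exists k.
rewrite ge0_integral_bigcup//.
- apply: eq_eseriesr => k _.
  rewrite (eq_integral (cst (g k)%:E)); last by move=> j; rewrite inE => ->.
  by rewrite integral_cst//= /pmf_measure esum_set1.
- by move=> k _; rewrite lee_fin.
- by apply/trivIsetP => i j _ _ ij; apply/seteqP; split => // k [/= -> /eqP]; rewrite (negbTE ij).
Qed.

Lemma nneseries_point (a : nat -> \bar R) n : (0 <= a n)%E ->
  (\sum_(0 <= k <oo) a k * (n == k)%:R%:E = a n)%E.
Proof.
move=> an0; have h k : (0 <= a k * (n == k)%:R%:E)%E.
  by case: eqP => [<-|_]; rewrite ?mule1// mule0.
rewrite nneseries_esumT// -[RHS](esum_set1 (t := n))// [RHS]esum_mkcond.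
apply: eq_esum => k _; case: eqP => [<-|nk].
  by rewrite mule1 ifT// inE.
by rewrite mule0 ifF//; apply/negbTE/negP; rewrite inE/= => kn; exact: nk.
Qed.

End nat_measures.

Section averages.
Context {R : realType} {Omega : Type}.
Variables (T : nat -> Omega -> R) (E : nat -> nat -> set Omega).

Lemma vertex_averageE (h : nat -> R) t w : (forall k, 0 <= h k) ->
  (vertex_average T E h t w = t^-1%:E *
    \sum_(0 <= i <oo) (h (indegree T E t w i) * (T i w <= t)%R%:R)%:E)%E.
Proof.
move=> h0; rewrite /vertex_average esum_mkcond nneseries_esumT; last first.
  by move=> n; rewrite lee_fin mulr_ge0.
congr (_ * _)%E; apply: eq_esum => i _.
rewrite /vertices; have [it|it] := boolP (T i w <= t)%R; first by rewrite mulr1 mem_set.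
by rewrite mulr0 memNset//; exact/negP.
Qed.

(** True for every outcome: the terms are nonnegative extended reals, so the sums over vertices and
    over indegrees may be interchanged even when infinite. *)
Lemma vertex_average_integral (g : nat -> R) t (t0 : 0 < t) w : (forall k, 0 <= g k) ->
  (vertex_average T E g t w = \int[empirical_indegree T E t0 w]_k (g k)%:E)%E.
Proof.
move=> g0; rewrite ge0_integral_pmf// vertex_averageE//.
have ti0 : (0 <= t^-1%:E :> \bar R)%E by rewrite lee_fin invr_ge0 ltW.
pose u i : R := (T i w <= t)%R%:R; have u0 i : 0 <= u i by rewrite /u.
pose D := indegree T E t w.
transitivity (t^-1%:E * \sum_(0 <= i <oo) \sum_(0 <= k <oo)
    (g k * u i)%:E * (D i == k)%:R%:E)%E.
  congr (_ * _)%E; apply: eq_eseriesr => i _.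
  by rewrite nneseries_point// lee_fin mulr_ge0.
rewrite nneseries_interchange; last first.
  by move=> i k; rewrite -EFinM lee_fin !mulr_ge0.
rewrite -nneseriesZl; last first.
  by move=> k _; apply: nneseries_ge0 => i _ _; rewrite -EFinM lee_fin !mulr_ge0.
apply: eq_eseriesr => k _.
rewrite /empirical_pmf vertex_averageE; last by move=> j.
rewrite muleCA; congr (_ * _)%E; rewrite -nneseriesZl; last first.
  by move=> i _; rewrite lee_fin mulr_ge0.
by apply: eq_eseriesr => i _; rewrite -!EFinM -/(u i) -/(D i); congr (_%:E); ring.
Qed.

End averages.

(** * Indegrees on cells and their measurability *)

Section network_indegree.
Context {R : realType} {d : nat} {dO : measure_display} {Omega : measurableType dO}.
Variables (P : probability Omega R) (T : nat -> {RV P >-> measurableTypeR R}).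
Variable E : nat -> nat -> set Omega.
Hypothesis poissonT : unit_poisson_process T.
Hypothesis mE : forall i j, (i < j)%N -> measurable (E i j).
Local Notation tau := (fun n w => T n w : R).

Let T_incr n w : (T n w : R) < T n.+1 w. Proof. by case: poissonT => _ + _; exact. Qed.

Lemma younger_neighboursE t w i :
  younger_neighbours tau E t w i = [set j | [/\ (T j w : R) <= t, (i < j)%N & E i j w]].
Proof.
apply/seteqP; split => j /=.
  move=> [jt [[ji _]|[ij Eij]]] //; rewrite ltNge => /negP; case.
  by apply: (arrival_le poissonT); exact: ltnW.
move=> [jt ij Eij]; split => //; first by right.
exact: arrival_lt T_incr _ _ _ ij.
Qed.

Lemma indegree_deg M t n w i : cell T M t n w -> indegree tau E t w i = deg E i n w.
Proof.
move=> /cell_vertices hv; rewrite /indegree younger_neighboursE.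
pose s := [seq j <- index_iota i.+1 n | w \in E i j].
have -> : [set j | [/\ (T j w : R) <= t, (i < j)%N & E i j w]] = [set` [fset j in s]%fset].
  apply/seteqP; split => j /=.
    move=> [jt ij Eij]; have jn : `I_n j by rewrite -hv.
    by rewrite in_fset mem_filter mem_set// mem_index_iota ij.
  rewrite in_fset mem_filter mem_index_iota => /andP[/set_mem Eij /andP[ij jn]].
  split => //; have : `I_n j by [].
  by rewrite -hv.
rewrite set_fsetK card_fseq undup_id; last by rewrite filter_uniq// iota_uniq.
by rewrite size_filter /deg -sumn_count sumnE big_map.
Qed.

Lemma vertex_average_cell M t n w (g : nat -> R) : (forall k, 0 <= g k) -> cell T M t n w ->
  vertex_average tau E g t w = (avg E g t n w)%:E.
Proof.
move=> g0 cw; rewrite /vertex_average (cell_vertices poissonT cw) EFinM; congr (_ * _)%E.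
rewrite esum_fset//; last by move=> i _; rewrite lee_fin.
rewrite -fsbig_ord -sumEFin; apply: eq_bigr => i _.
by rewrite (indegree_deg _ cw).
Qed.

Lemma measurable_arrival t i : measurable [set w | (T i w : R) <= t].
Proof.
have := @measurable_funP _ _ _ _ _ (T i) measurableT `]-oo, t]%classic (measurable_itv _).
by rewrite setTI; congr measurable; apply/seteqP; split => w /=; rewrite in_itv.
Qed.

Lemma measurable_indegree t i :
  measurable_fun setT (fun w => (indegree tau E t w i)%:R : R).
Proof.
(* The counting measure of an infinite set is infinite and [fine] sends it to 0, in agreement with
   the value of [fset_set] there. *)
have -> : (fun w => (indegree tau E t w i)%:R : R) =
    fine \o (fun w => \sum_(0 <= j <oo) \d_j (younger_neighbours tau E t w i))%E.
  apply/funext => w /=; rewrite -counting_dirac /counting /indegree.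
  case: asboolP => // h; rewrite /fset_set; case: pselect => [/h//|_].
  by have -> := @cardfs0 nat.
apply: measurableT_comp; first exact: fine_measurable.
apply: ge0_emeasurable_sum => // j _.
pose B := if (i < j)%N then [set w | (T j w : R) <= t] `&` E i j else set0.
rewrite (_ : (fun w => _) = EFin \o (\1_B : Omega -> R)); last first.
  apply/funext => w /=; rewrite younger_neighboursE diracE indicE /B; congr (_%:E).
  congr (_%:R); case: (ltnP i j) => ij.
    by congr nat_of_bool; apply/idP/idP => /set_mem/=; [move=> [? ? ?]; exact/mem_set|
      move=> [? ?]; exact/mem_set].
  by rewrite in_set0 memNset// => -[_ + _]; rewrite ltnNge ij.
apply/measurable_EFinP; apply: measurable_indic; rewrite /B; case: (ltnP i j) => ij //.
by apply: measurableI; [exact: measurable_arrival|exact: mE].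
Qed.

Lemma measurable_indegree_comp (g : nat -> R) t i :
  measurable_fun setT (fun w => g (indegree tau E t w i)).
Proof.
have mk k : measurable [set w | indegree tau E t w i = k].
  have := measurable_indegree t i measurableT (@measurable_set1 R k%:R).
  rewrite setTI; congr measurable; apply/seteqP; split => w /=; last by move=> ->.
  by move=> /eqP; rewrite eqr_nat => /eqP.
move=> _ Y mY; rewrite setTI.
have -> : (fun w => g (indegree tau E t w i)) @^-1` Y =
    \bigcup_(k in g @^-1` Y) [set w | indegree tau E t w i = k].
  by apply/seteqP; split => w /= => [h|[k hk ->//]]; exists (indegree tau E t w i).
exact: bigcup_measurable.
Qed.

Lemma measurable_vertex_average (g : nat -> R) t : (forall k, 0 <= g k) ->
  measurable_fun setT (vertex_average tau E g t).
Proof.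
move=> g0; rewrite (_ : vertex_average tau E g t = fun w => (t^-1%:E *
    \sum_(0 <= i <oo) (g (indegree tau E t w i) * (T i w <= t)%R%:R)%:E)%E); last first.
  by apply/funext => w; rewrite vertex_averageE.
apply: measurable_funeM; apply: ge0_emeasurable_sum => [i w _ _|i _].
  by rewrite lee_fin mulr_ge0.
apply/measurable_EFinP; apply: measurable_funM; first exact: measurable_indegree_comp.
rewrite (_ : (fun w => _) = \1_[set w | (T i w : R) <= t]).
  by apply: measurable_indic; exact: measurable_arrival.
apply/funext => w; rewrite indicE; congr (_%:R); congr nat_of_bool.
by apply/idP/idP => [h|/set_mem//]; exact/mem_set.
Qed.

End network_indegree.

(** * Convergence in probability *)

Section convergence_in_probability.
Context {R : realType} {d : nat} {dO : measure_display} {Omega : measurableType dO}.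
Variables (P : probability Omega R) (gamma beta : R) (phi : R -> R).
Variables (T : nat -> {RV P >-> measurableTypeR R}) (X : nat -> {RV P >-> Rspace R d}).
Variable E : nat -> nat -> set Omega.
Hypotheses (poissonT : unit_poisson_process T)
  (indepE : independent_edges gamma beta phi T X E).
Variables (g : nat -> R) (L : R).
Hypothesis g_ge0 : forall k, 0 <= g k.
Local Notation tau := (fun n w => T n w : R).

Definition far (e t : R) : set Omega :=
  [set w | (e%:E <= `|vertex_average tau E g t w - L%:E|)%E].

Lemma measurable_far e t : measurable (far e t).
Proof.
have mV := measurable_vertex_average poissonT indepE.1 t g_ge0.
have m : measurable_fun setT (fun w => `|vertex_average tau E g t w - L%:E|%E).
  by apply: measurableT_comp => //; apply: emeasurable_funB.
have := m measurableT `[e%:E, +oo[%classic (emeasurable_itv _).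
rewrite setTI; congr measurable; apply/seteqP; split => w /=; by rewrite in_itv/= andbT.
Qed.

(** Markov's inequality on the regular event; the second term pays for its complement. *)
Lemma far_probability M e t : 0 < e -> 0 < t ->
  fine (P (far e t)) <= e^-1 * deviation T E M g L t + (1 - fine (P (regular T M))).
Proof.
move=> e0 t0; have mB := measurable_far e t; have mR := measurable_regular T M.
have bI (A : set Omega) : measurable A -> bmf (\1_A : Omega -> R) by exact: bmf_indic.
have bD n : bmf (fun w => `|avg E g t n w - L|) by exact: (bmf_deviation indepE).
have bS : bmf (fun w => \sum_(n < ncells M t) \1_(cell T M t n) w * `|avg E g t n w - L|).
  exact: (bmf_cell_sum T M t bD).
have bR : bmf (fun w => 1 - \1_(regular T M) w : R) by apply: bmfB; [exact: bmf_cst|exact: bI].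
have b1 : bmf (fun w => e^-1 * \sum_(n < ncells M t) \1_(cell T M t n) w * `|avg E g t n w - L|).
  by apply: bmfM => //; exact: bmf_cst.
rewrite -!Ex_indic// /deviation /cell_mean -ExZ//.
rewrite -[X in _ + (X - _)](Ex_cst P) -ExB//; [|exact: bmf_cst|exact: bI].
rewrite -ExD//; apply: Ex_le; [exact: bI|exact: bmfD|move=> w].
have [rw|rw] := pselect (regular T M w); last first.
  rewrite (sum_cell0 t (fun n => `|avg E g t n w - L|) rw) mulr0 add0r.
  have -> : \1_(regular T M) w = 0 :> R by rewrite indicE memNset.
  by rewrite subr0 indicE; case: (_ \in _).
have [n cw] := regular_cell t0 rw.
rewrite (sum_cell poissonT (fun n => `|avg E g t n w - L|) t0 cw).
have -> : \1_(regular T M) w = 1 :> R by rewrite indicE mem_set.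
rewrite subrr addr0 indicE.
have [/set_mem|_] := boolP (w \in _); last by rewrite mulr_ge0// invr_ge0 ltW.
rewrite /far /= (vertex_average_cell E poissonT g_ge0 cw) -EFinB /= lee_fin => h.
by rewrite ler_pdivlMl// mulr1.
Qed.

Lemma far_probability_cvg e : 0 < e -> good T E g L -> P (far e t) @[t --> +oo%R] --> 0%E.
Proof.
move=> e0 gd; have v : vanishing (fun t => fine (P (far e t))).
  apply: vanishing_approx => x x0.
  have /fine_cvgP[_ /cvgrPdist_le /(_ x x0)[M _ /(_ M (leqnn M))/=]] := regular_prob poissonT.
  rewrite ler_distl => /andP[_ h].
  exists (fun t => e^-1 * deviation T E M g L t).
    by apply: vanishingZ; [rewrite invr_ge0 ltW|exact: gd].
  move=> t t1; have t0 : 0 < t by lra.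
  by have := far_probability M e0 t0; lra.
have fP t : P (far e t) \is a fin_num by apply: fin_num_measure; exact: measurable_far.
apply/fine_cvgP; split; first by apply: nearW.
apply/cvgrPdist_le => x x0; have [t0 _ h] := v x x0.
near=> t; rewrite sub0r normrN ger0_norm /=; last by rewrite fine_ge0.
by apply: h; near: t; apply: nbhs_pinfty_ge; exact: num_real.
Unshelve. all: by end_near. Qed.

End convergence_in_probability.

Theorem theorem4p3 (R : realType) (d : nat) (gamma beta : R) (phi : R -> R)
    (dO : measure_display) (Omega : measurableType dO) (P : probability Omega R)
    (T : nat -> {RV P >-> measurableTypeR R}) (X : nat -> {RV P >-> Rspace R d})
    (E : nat -> nat -> set Omega) (g : nat -> R) :
  (1 <= d)%N -> 0 < gamma < 1 -> 0 < beta -> profile_function d phi ->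
  age_based_network gamma beta phi T X E ->
  (forall k, 0 <= g k) ->
  (exists C : R, forall k, g k <= C * (1 + k%:R)) ->
  (forall (t : R) (t0 : 0 < t) (w : Omega),
     vertex_average T E g t w =
     (\int[empirical_indegree T E t0 w]_k (g k)%:E)%E) /\
  (forall eps : R, 0 < eps ->
     P [set w | (eps%:E <= `| vertex_average T E g t w
                  - \int[mixed_poisson gamma beta]_k (g k)%:E |)%E]
       @[t --> +oo%R] --> 0%E).
Proof.
move=> d0 gamma01 beta0 phi_profile [poissonT iidX indepE] g0 [C gC]; split.
  by move=> t t0 w; exact: vertex_average_integral.
move=> eps eps0.
have [L sL gd] := good_linear d0 phi_profile gamma01 beta0 poissonT iidX indepE g0 gC.
rewrite /mixed_poisson ge0_integral_pmf// sL.
exact: (far_probability_cvg poissonT indepE g0 eps0 gd).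
Qed.
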